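(* Let $N\ge1$ and let $\beta_k^{+}=-N-\alpha_k^{+}$ and $\beta_k^-=-N-\alpha_k^-$, $k\in\mathbb{N}$. Then: (i) for each choice of sign $\pm$ and all $\beta<-N$, the unique radial $\beta$-homogeneous solution $v$ of $b(v)_t=\Delta v$ for $t>0$ with $v(0,1)=\pm1$ has the property that, with $\alpha:=-N-\beta$, $$|x|^{N+\alpha}\Big(\frac{|x|}{\sqrt t}\Big)^{-(N+2\alpha)}e^{\ell|x|^2/(4t)}\,v(x,t)\quad\text{is bounded (as } |x|/\sqrt t\to+\infty)$$ if and only if $\beta=\beta_k^\pm$ (same sign) for some $k\in\mathbb{N}$; (ii) for each choice of sign $\pm$ and all $\beta<0$, the self-similar profile $g$ (with $g(0)=\pm1$) of the radial $\beta$-homogeneous solution does not change sign if and only if $-N\le\beta<0$, changes sign once if and only if $\beta_1^\pm\le\beta<-N$, and changes sign exactly $k$ times ($k\ge2$) if and only if $\beta_k^\pm\le\beta<\beta_{k-1}^\pm$; (iii) the sequences $(\beta_k^+)$ and $(\beta_k^-)$ are strictly decreasing and unbounded; (iv) $\beta_1^+<-N-2<\beta_1^-<-N$; (v) $\beta_{k+2}^-<\beta_{k+1}^+<\beta_k^-$ for all $k\in\mathbb{N}$.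
   Context: $\mathbb{N}=\{1,2,\dots\}$. The nonlinearity is $b(r)=2r-r^+$ (so $b(r)=r$ for $r\ge0$, $b(r)=2r$ for $r<0$). The numbers $\alpha_k^\pm$. For $\alpha>0$ consider functions $f:[0,\infty)\to\mathbb{R}$ of class $C^{1,1}$ on bounded intervals with $f(0)\neq0$, $f'(0)=0$, $$f''+\Big(\frac{N-1}{s}-s\Big)f'+\alpha f=0\ \text{ where } f<0,\ s>0,\qquad f''+\Big(\frac{N-1}{s}-\frac s2\Big)f'+\frac\alpha2 f=0\ \text{ where } f>0,\ s>0.$$ For $k\in\mathbb{N}$, $\alpha_k^{\pm}$ is the unique $\alpha>0$ for which such an $f$ with $f(0)=\pm1$ exists that changes sign exactly $k$ times and has $s^{-\alpha}f(s)$ bounded as $s\to+\infty$. Negatively homogeneous solutions. For $\beta<0$, a radial $\beta$-homogeneous solution of $b(v)_t=\Delta v$ for $t>0$ is a function $v(x,t)=t^{\beta/2}g(|x|/\sqrt t)$, $x\in\mathbb{R}^N$, $t>0$, whose self-similar profile $g:[0,\infty)\to\mathbb{R}$ is of class $C^{1,1}$ on bounded intervals and satisfies $g(0)\ne0$, $g'(0)=0$, $$g''+\Big(\frac{N-1}{r}+r\Big)g'-\beta g=0\ \text{ where } g<0,\ r>0,\qquad g''+\Big(\frac{N-1}{r}+\frac r2\Big)g'-\frac\beta2 g=0\ \text{ where } g>0,\ r>0.$$ Thus $v(0,1)=g(0)$. Moreover $\ell:=\lim_{r\to+\infty}\lambda(g(r))$, where $\lambda(y)=4/(3+\mathrm{sign}(y))$,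 i.e. $\lambda(y)=1$ for $y>0$ and $\lambda(y)=2$ for $y<0$ (this limit exists). *)

(* Defs.v *)
From Stdlib Require Export Reals.
From mathcomp Require Export fintype bigop.
From Coquelicot Require Export Coquelicot.

Open Scope R_scope.

(* The sign of the initial value: [true] stands for +, [false] for -. *)
Definition sgn_val (s : bool) : R := if s then 1 else -1.

(* [f] is of class C^{1,1} on bounded intervals of [0, +oo), with derivative
   [df] (one-sided at 0).  Values at negative arguments are irrelevant. *)
Definition C11_halfline (f df : R -> R) : Prop :=
  (forall s, 0 < s -> is_derive f s (df s)) /\
  filterlim (fun s => (f s - f 0) / s) (at_right 0) (locally (df 0)) /\
  (forall M, exists L, forall s s', 0 <= s <= M -> 0 <= s' <= M ->
     Rabs (df s - df s') <= L * Rabs (s - s')).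

(* f'' + p f' + q f = 0 at the point s, where [df] is the derivative of [f]. *)
Definition ode_at (f df : R -> R) (p q s : R) : Prop :=
  exists d2f, is_derive df s d2f /\ d2f + p * df s + q * f s = 0.

(* [f] takes values of alternating strict sign at some k+1 increasing points
   of [0, +oo), i.e. it changes sign at least k times. *)
Definition changes_sign_at_least (k : nat) (f : R -> R) : Prop :=
  exists p : nat -> R, 0 <= p 0%nat /\
    forall i, (i < k)%nat -> p i < p (S i) /\ f (p i) * f (p (S i)) < 0.

Definition changes_sign_exactly (k : nat) (f : R -> R) : Prop :=
  changes_sign_at_least k f /\ ~ changes_sign_at_least (S k) f.

(** The numbers alpha_k^+ and alpha_k^- *)

Definition alpha_solution (N : nat) (a : R) (f : R -> R) : Prop :=
  exists df : R -> R,
    C11_halfline f df /\ f 0 <> 0 /\ df 0 = 0 /\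
    (forall s, 0 < s -> f s < 0 ->
       ode_at f df ((INR N - 1) / s - s) a s) /\
    (forall s, 0 < s -> 0 < f s ->
       ode_at f df ((INR N - 1) / s - s / 2) (a / 2) s).

Definition is_alpha (N : nat) (s : bool) (k : nat) (a : R) : Prop :=
  0 < a /\
  exists f, alpha_solution N a f /\ f 0 = sgn_val s /\
    changes_sign_exactly k f /\
    exists M S0, 0 < S0 /\
      forall r, S0 <= r -> Rabs (Rpower r (- a) * f r) <= M.

(* [iota] is definite description: "the unique a such that ...".  Meaningful
   for k >= 1 only. *)
Definition alpha (N : nat) (s : bool) (k : nat) : R := iota (is_alpha N s k).

Definition beta (N : nat) (s : bool) (k : nat) : R := - INR N - alpha N s k.

(** Negatively homogeneous radial solutions of b(v)_t = Delta v *)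

Definition enorm (N : nat) (x : 'I_N -> R) : R :=
  sqrt (\big[Rplus/0]_(i < N) (x i) ^ 2).

Definition origin (N : nat) : 'I_N -> R := fun _ => 0.

Definition profile (N : nat) (b : R) (g : R -> R) : Prop :=
  exists dg : R -> R,
    C11_halfline g dg /\ g 0 <> 0 /\ dg 0 = 0 /\
    (forall r, 0 < r -> g r < 0 ->
       ode_at g dg ((INR N - 1) / r + r) (- b) r) /\
    (forall r, 0 < r -> 0 < g r ->
       ode_at g dg ((INR N - 1) / r + r / 2) (- (b / 2)) r).

(* [v] (considered for t > 0 only) is the radial b-homogeneous solution with
   self-similar profile [g]. *)
Definition homogeneous_solution (N : nat) (b : R)
    (v : ('I_N -> R) -> R -> R) (g : R -> R) : Prop :=
  profile N b g /\
  forall x t, 0 < t -> v x t = Rpower t (b / 2) * g (enorm N x / sqrt t).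

Definition unique_homogeneous_solution (N : nat) (b c : R)
    (v : ('I_N -> R) -> R -> R) (g : R -> R) : Prop :=
  homogeneous_solution N b v g /\ v (origin N) 1 = c /\
  forall v' g', homogeneous_solution N b v' g' -> v' (origin N) 1 = c ->
    forall x t, 0 < t -> v' x t = v x t.

Definition lambda (y : R) : R := 4 / (3 + sign y).

Definition decay_bounded (N : nat) (a ell : R) (v : ('I_N -> R) -> R -> R)
    : Prop :=
  exists M R0, 0 < R0 /\
    forall x t, 0 < t -> R0 <= enorm N x / sqrt t ->
      Rabs (Rpower (enorm N x) (INR N + a) *
            Rpower (enorm N x / sqrt t) (- (INR N + 2 * a)) *
            exp (ell * enorm N x ^ 2 / (4 * t)) * v x t) <= M.

(* Main.v *)
Require Import Defs.
From Stdlib Require Import Lra Lia Psatz Classical.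

(* Write the profile equation, with alpha = - N - beta, as the Lipschitz system
   g' = - (r b(g) + w) / 2, w' = alpha b(g) - (N - 1) w / r.  If E' = r c(g), with c = 1 for
   g < 0 and c = 1/2 for g > 0, then f = e^E g solves the alpha-equation and - 2 f' = e^E w:
   so f and g have the same zeros, and (f, - 2 f') and (g, w) the same polar angle theta.
   This angle satisfies a scalar equation that is increasing in alpha, and it crosses the
   levels j pi - pi / 2 (the zeros) upwards only; hence sign changes are counted by theta
   and can only appear as alpha grows.  For large r the logarithmic derivative p = r f' / f
   satisfies r p' = c r^2 (p - alpha) + (2 - N) p - p^2, so that p >= 2 alpha is a trap
   (f grows at least like r^(2 alpha), with no further zero), and a solution which never
   enters it satisfies 0 < p < 2 alpha, whence |f| <= C r^alpha.  Being trapped is an open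
   condition on alpha, and two untrapped solutions with the same number of half-turns
   coincide: therefore the untrapped alpha are exactly the values at which the number of
   sign changes jumps, by one.
   Comparing theta for the two initial signs gives the interlacing, and comparing it for
   alpha = 2 with the solutions r^2 - N / c gives alpha_1^- < 2 < alpha_1^+. *)

(** * Real induction and differential inequalities *)

(** The definitions impose the equations only off the zeros of the solution, b has a corner at 0,
    and r = 0 is singular. This is why the divergence form is used: r^(N-1) w - alpha * int s^(N-1)
    b(g) has zero derivative off the zeros and is continuous, so it stays constant across isolated
    zeros, while uniqueness for the system excludes double zeros. The singular term - (N - 1) w / r
    is dissipative for increasing r, in the system and also in the phase equation close to its
    start; therefore data at r = 0 are admissible and comparison can begin there. The bound 2 alpha
    is a convenient choice: the term c r^2 (p - alpha) repels from p = alpha, so for large r any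
    constant above alpha is a barrier, uniformly for alpha in a bounded range. That uniformity makes
    being trapped an open condition. The remaining regime p <= 0 leads to another zero, just after
    which p is arbitrarily large, hence trapped. Since f = e^E g, one construction serves both
    problems. The thresholds of the counting are defined through g alone; they are identified with
    the numbers alpha_k only at the end, by uniqueness for the alpha-equation. *)

Ltac minmax :=
  unfold Rmin, Rmax in *;
  repeat match goal with
         | |- context [Rle_dec ?a ?b] => destruct (Rle_dec a b)
         | H : context [Rle_dec ?a ?b] |- _ => destruct (Rle_dec a b)
         end; lra.

(** Used to carry properties across the zeros of a solution, which are known only to be isolated,
    without enumerating them. *)
Lemma real_induction (Q : R -> Prop) (a b : R) :
  a <= b -> Q a ->
  (forall x, a <= x < b -> Q x ->
     exists d, 0 < d /\ forall y, x < y < x + d -> y <= b -> Q y) ->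
  (forall x, a < x <= b -> (forall y, a <= y < x -> Q y) -> Q x) ->
  forall x, a <= x <= b -> Q x.
Proof.
  intros Hab Ha Hstep Hlim.
  set (S := fun x => a <= x <= b /\ forall y, a <= y <= x -> Q y).
  assert (SA : S a).
  { split; [lra|]. intros y Hy. replace y with a by lra. exact Ha. }
  destruct (completeness S) as [m [Hub Hlub]].
  { exists b. intros x [Hx _]. lra. }
  { exists a. exact SA. }
  assert (Ham : a <= m) by (apply Hub; exact SA).
  assert (Hmb : m <= b) by (apply Hlub; intros x [Hx _]; lra).
  assert (Hlt : forall y, a <= y < m -> Q y).
  { intros y Hy. apply NNPP. intros Hn.
    assert (m <= y); [|lra].
    apply Hlub. intros x [Hx HQ].
    destruct (Rle_lt_dec x y) as [|Hyx]; [assumption|].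
    exfalso. apply Hn. apply HQ. lra. }
  assert (Hm : Q m).
  { destruct (Req_dec m a) as [->|Hne]; [exact Ha|]. apply Hlim; [lra|exact Hlt]. }
  assert (Hle : forall y, a <= y <= m -> Q y).
  { intros y Hy. destruct (Req_dec y m) as [->|Hne]; [exact Hm|]. apply Hlt. lra. }
  destruct (Req_dec m b) as [<-|Hne]; [exact Hle|].
  destruct (Hstep m) as [d [Hd HQ]]; [lra|exact Hm|].
  set (z := Rmin (m + d / 2) b).
  assert (Hz : m < z <= b /\ z < m + d) by (unfold z; minmax).
  assert (Hm' : S z).
  { split; [lra|]. intros y Hy. destruct (Rle_lt_dec y m); [apply Hle; lra|apply HQ; lra]. }
  apply Hub in Hm'. lra.
Qed.

Lemma point_between_right (a b d : R) :
  a < b -> 0 < d -> exists x, a < x < b /\ x < a + d.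
Proof. intros Hab Hd. exists (Rmin (a + d / 2) ((a + b) / 2)). minmax. Qed.

Lemma point_between_left (a b d : R) :
  a < b -> 0 < d -> exists x, a < x < b /\ b - d < x.
Proof. intros Hab Hd. exists (Rmax (b - d / 2) ((a + b) / 2)). minmax. Qed.

Lemma locally_interval (P : R -> Prop) (x d : R) :
  0 < d -> (forall y, x - d < y < x + d -> P y) -> locally x P.
Proof.
  intros Hd H. exists (mkposreal d Hd). intros y Hy. apply Rabs_def2 in Hy.
  unfold minus, plus, opp in Hy; simpl in Hy. apply H. lra.
Qed.

Lemma is_derive_continuity (f : R -> R) (x l : R) :
  is_derive f x l -> continuity_pt f x.
Proof.
  intros H. apply continuity_pt_filterlim.
  apply (ex_derive_continuous f x). exists l. exact H.
Qed.

Lemma is_derive_eq (f : R -> R) (x l l' : R) :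
  is_derive f x l -> l = l' -> is_derive f x l'.
Proof. intros H <-. exact H. Qed.

Lemma is_derive_opp_R (f : R -> R) (x l : R) :
  is_derive f x l -> is_derive (fun y => - f y) x (- l).
Proof. exact (is_derive_opp f x l). Qed.

Lemma is_derive_plus_R (f g : R -> R) (x l m : R) :
  is_derive f x l -> is_derive g x m -> is_derive (fun y => f y + g y) x (l + m).
Proof. exact (is_derive_plus f g x l m). Qed.

Lemma is_derive_minus_R (f g : R -> R) (x l m : R) :
  is_derive f x l -> is_derive g x m -> is_derive (fun y => f y - g y) x (l - m).
Proof. exact (is_derive_minus f g x l m). Qed.

Lemma is_derive_mult_R (f g : R -> R) (x l m : R) :
  is_derive f x l -> is_derive g x m ->
  is_derive (fun y => f y * g y) x (l * g x + f x * m).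
Proof. intros Hf Hg. exact (is_derive_mult f g x l m Hf Hg Rmult_comm). Qed.

Lemma is_derive_comp_R (f g : R -> R) (x l m : R) :
  is_derive f (g x) l -> is_derive g x m -> is_derive (fun y => f (g y)) x (m * l).
Proof. exact (is_derive_comp f g x l m). Qed.

Lemma nondecreasing_deriv (f df : R -> R) (a b : R) :
  a <= b ->
  (forall x, a <= x <= b -> continuity_pt f x) ->
  (forall x, a < x < b -> is_derive f x (df x)) ->
  (forall x, a < x < b -> 0 <= df x) -> f a <= f b.
Proof.
  intros Hab Hc Hd Hp.
  (* [MVT_gen] may return an endpoint, where nothing is assumed of [df]; the value 0 put there still
     gives the inequality. *)
  set (df' := fun x => if Rlt_dec a x then if Rlt_dec x b then df x else 0 else 0).
  assert (E : forall x, a < x < b -> df' x = df x).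
  { intros x Hx. unfold df'. destruct (Rlt_dec a x), (Rlt_dec x b); lra. }
  destruct (MVT_gen f a b df') as [c [Hcc Heq]].
  - rewrite Rmin_left, Rmax_right by assumption. intros x Hx. rewrite E by exact Hx. apply Hd, Hx.
  - rewrite Rmin_left, Rmax_right by assumption. exact Hc.
  - assert (0 <= df' c).
    { unfold df'. destruct (Rlt_dec a c), (Rlt_dec c b); try lra. apply Hp; lra. }
    nra.
Qed.

Lemma gronwall (e de : R -> R) (C a b : R) :
  a <= b ->
  (forall x, a <= x <= b -> continuity_pt e x) ->
  (forall x, a < x < b -> is_derive e x (de x)) ->
  (forall x, a < x < b -> de x <= C * e x) ->
  e b <= e a * exp (C * (b - a)).
Proof.
  intros Hab Hc Hd Hle.
  assert (H : - (e a * exp (- C * a)) <= - (e b * exp (- C * b))).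
  { apply (nondecreasing_deriv (fun x => - (e x * exp (- C * x)))
             (fun x => (C * e x - de x) * exp (- C * x))); [exact Hab| | |].
    - intros x Hx. apply continuity_pt_opp, continuity_pt_mult; [apply Hc, Hx|].
      apply is_derive_continuity with (- C * exp (- C * x)).
      auto_derive; [exact I|ring].
    - intros x Hx. specialize (Hd x Hx).
      eapply is_derive_eq.
      + assert (Hx' : is_derive (fun y => exp (- C * y)) x (- C * exp (- C * x)))
          by (auto_derive; [exact I|ring]).
        exact (is_derive_opp_R _ _ _ (is_derive_mult_R _ _ _ _ _ Hd Hx')).
      + cbv beta; ring.
    - intros x Hx. specialize (Hle x Hx).
      apply Rmult_le_pos; [lra|]. left. apply exp_pos. }
  assert (E : exp (- C * a) = exp (- C * b) * exp (C * (b - a))).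
  { rewrite <- exp_plus. f_equal. ring. }
  rewrite E in H. pose proof (exp_pos (- C * b)).
  apply Rmult_le_reg_r with (exp (- C * b)); [assumption|]. lra.
Qed.

Lemma gronwall_ge (e de : R -> R) (C a b : R) :
  a <= b ->
  (forall x, a <= x <= b -> continuity_pt e x) ->
  (forall x, a < x < b -> is_derive e x (de x)) ->
  (forall x, a < x < b -> C * e x <= de x) ->
  e a * exp (C * (b - a)) <= e b.
Proof.
  intros Hab Hc Hd Hle.
  assert (- e b <= - e a * exp (C * (b - a))); [|lra].
  apply (gronwall (fun x => - e x) (fun x => - de x) C a b Hab).
  - intros x Hx. apply continuity_pt_opp, Hc, Hx.
  - intros x Hx. apply is_derive_opp_R, Hd, Hx.
  - intros x Hx. specialize (Hle x Hx). lra.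
Qed.

Lemma deriv_pos_local (f : R -> R) (x l : R) :
  is_derive f x l -> 0 < l ->
  exists d, 0 < d /\ (forall y, x < y < x + d -> f x < f y) /\
    (forall y, x - d < y < x -> f y < f x).
Proof.
  intros H Hl. apply is_derive_Reals in H.
  destruct (H (l / 2)) as [d Hd]; [lra|].
  assert (P : forall h, h <> 0 -> Rabs h < d -> 0 < (f (x + h) - f x) / h).
  { intros h Hh Hhd. specialize (Hd h Hh Hhd). apply Rabs_def2 in Hd. lra. }
  exists d. split; [apply cond_pos|]. split; intros y Hy.
  - assert (0 < (f (x + (y - x)) - f x) / (y - x)) by (apply P; [lra|rewrite Rabs_right; lra]).
    replace (x + (y - x)) with y in H0 by ring.
    assert (E : f y - f x = (f y - f x) / (y - x) * (y - x)) by (field; lra).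
    assert (0 < (f y - f x) / (y - x) * (y - x)) by (apply Rmult_lt_0_compat; lra). lra.
  - assert (0 < (f (x + (y - x)) - f x) / (y - x)) by (apply P; [lra|rewrite Rabs_left; lra]).
    replace (x + (y - x)) with y in H0 by ring.
    assert (E : f x - f y = (f y - f x) / (y - x) * (x - y)) by (field; lra).
    assert (0 < (f y - f x) / (y - x) * (x - y)) by (apply Rmult_lt_0_compat; lra). lra.
Qed.

Lemma continuity_pos_local (f : R -> R) (x : R) :
  continuity_pt f x -> 0 < f x ->
  exists d, 0 < d /\ forall y, x - d < y < x + d -> 0 < f y.
Proof.
  intros H Hp. destruct (H (f x) Hp) as [d [Hd H']].
  exists d. split; [exact Hd|]. intros y Hy.
  destruct (Req_dec y x) as [->|Hne]; [exact Hp|].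
  assert (A : Rabs (f y - f x) < f x).
  { apply H'. split; [split; [exact I|intros E; apply Hne; symmetry; exact E]|].
    apply Rabs_def1; lra. }
  apply Rabs_def2 in A. lra.
Qed.

Lemma continuity_ge_limit (f : R -> R) (a x : R) :
  continuity_pt f x -> a < x -> (forall y, a < y < x -> 0 <= f y) -> 0 <= f x.
Proof.
  intros Hc Hax Hf. destruct (Rle_lt_dec 0 (f x)) as [|Hn]; [assumption|].
  destruct (continuity_pos_local (fun y => - f y) x) as [d [Hd H]].
  - apply continuity_pt_opp, Hc.
  - lra.
  - destruct (point_between_left a x d Hax Hd) as [y [Hy Hyd]].
    specialize (Hf y Hy). specialize (H y). lra.
Qed.

(** At a first return to 0 the function would arrive from positive values, against its positive
    derivative there. The sign of the derivative is tested at zeros only, and a start at 0 is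
    allowed. *)
Lemma barrier (f df : R -> R) (a b : R) :
  a <= b -> 0 <= f a ->
  (forall x, a <= x <= b -> is_derive f x (df x)) ->
  (forall x, a <= x <= b -> f x = 0 -> 0 < df x) ->
  forall x, a < x <= b -> 0 < f x.
Proof.
  intros Hab Ha Hd Hz.
  assert (Q : forall x, a <= x <= b -> x = a \/ 0 < f x).
  { apply real_induction; [exact Hab|left; reflexivity| |].
    - intros x Hx HQ.
      destruct (Req_dec (f x) 0) as [E|Hne].
      + destruct (deriv_pos_local f x (df x)) as [d [Hd0 [Hr _]]];
          [apply Hd; lra|apply Hz; lra|].
        exists d. split; [exact Hd0|]. intros y Hy _. right. rewrite <- E. apply Hr, Hy.
      + assert (Hp : 0 < f x) by (destruct HQ as [->|]; lra).
        destruct (continuity_pos_local f x) as [d [Hd0 Hr]];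
          [apply is_derive_continuity with (df x), Hd; lra|exact Hp|].
        exists d. split; [exact Hd0|]. intros y Hy _. right. apply Hr; lra.
    - intros x Hx HQ. right.
      assert (H0 : 0 <= f x).
      { apply continuity_ge_limit with a; [apply is_derive_continuity with (df x), Hd; lra|lra|].
        intros y Hy. destruct (HQ y); lra. }
      destruct (Req_dec (f x) 0) as [E|Hne]; [|lra].
      destruct (deriv_pos_local f x (df x)) as [d [Hd0 [_ Hl]]];
          [apply Hd; lra|apply Hz; lra|].
      destruct (point_between_left a x d ltac:(lra) Hd0) as [y [Hy Hyd]].
      assert (f y < f x) by (apply Hl; lra).
      destruct (HQ y); lra. }
  intros x Hx. destruct (Q x); lra.
Qed.

Lemma is_derive_sqr_neg_part (x : R) :
  is_derive (fun y => Rmin y 0 ^ 2) x (2 * Rmin x 0).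
Proof.
  destruct (Rtotal_order x 0) as [H|[->|H]].
  - apply is_derive_ext_loc with (fun y => y ^ 2).
    + apply locally_interval with (- x); [lra|]. intros y Hy. rewrite Rmin_left; [reflexivity|lra].
    + rewrite Rmin_left by lra. auto_derive; [exact I|ring].
  - apply is_derive_Reals. intros eps He. exists (mkposreal eps He). intros h Hh Hhe.
    simpl in Hhe. rewrite Rplus_0_l, (Rmin_left 0 0) by lra.
    unfold Rmin. destruct (Rle_dec h 0).
    + replace ((h ^ 2 - 0 ^ 2) / h - 2 * 0) with h by (field; exact Hh). exact Hhe.
    + replace ((0 ^ 2 - 0 ^ 2) / h - 2 * 0) with 0 by (field; exact Hh). rewrite Rabs_R0. exact He.
  - apply is_derive_ext_loc with (fun y => 0).
    + apply locally_interval with x; [lra|]. intros y Hy. rewrite Rmin_right; [simpl; ring|lra].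
    + rewrite Rmin_right by lra. auto_derive; [exact I|ring].
Qed.

(* The square of the negative part of [D] is differentiable, so Gronwall applies to it. *)
Lemma nonneg_of_deriv_ge (D dD : R -> R) (C a b : R) :
  a <= b -> 0 <= D a ->
  (forall x, a <= x <= b -> continuity_pt D x) ->
  (forall x, a < x < b -> is_derive D x (dD x)) ->
  (forall x, a < x < b -> D x < 0 -> C * D x <= dD x) -> 0 <= D b.
Proof.
  intros Hab Ha Hc Hd Hle.
  assert (H : Rmin (D b) 0 ^ 2 <= Rmin (D a) 0 ^ 2 * exp (2 * C * (b - a))).
  { apply (gronwall (fun x => Rmin (D x) 0 ^ 2) (fun x => 2 * Rmin (D x) 0 * dD x)).
    - exact Hab.
    - intros x Hx. apply (continuity_pt_comp D (fun y => Rmin y 0 ^ 2)); [apply Hc, Hx|].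
      eapply is_derive_continuity, is_derive_sqr_neg_part.
    - intros x Hx. eapply is_derive_eq.
      + apply (is_derive_comp_R (fun y => Rmin y 0 ^ 2) D); [apply is_derive_sqr_neg_part|apply Hd, Hx].
      + simpl; ring.
    - intros x Hx. specialize (Hle x Hx). unfold Rmin. destruct (Rle_dec (D x) 0); [|lra].
      destruct (Req_dec (D x) 0) as [->|]; [lra|]. specialize (Hle ltac:(lra)). nra. }
  rewrite (Rmin_right (D a)) in H by lra.
  destruct (Rle_lt_dec 0 (D b)); [assumption|].
  rewrite Rmin_left in H by lra. nra.
Qed.

(** Nonnegativity comes first and removes the absolute value; then [D] decays at most exponentially
    and cannot reach 0. *)
Lemma pos_of_deriv_ge (D dD : R -> R) (C a b : R) :
  a <= b -> 0 < D a ->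
  (forall x, a <= x <= b -> continuity_pt D x) ->
  (forall x, a < x < b -> is_derive D x (dD x)) ->
  (forall x, a < x < b -> - C * Rabs (D x) <= dD x) -> 0 < D b.
Proof.
  intros Hab Ha Hc Hd Hle.
  assert (Hnn : forall x, a <= x <= b -> 0 <= D x).
  { intros x Hx. apply (nonneg_of_deriv_ge D dD C a x); try lra.
    - intros; apply Hc; lra.
    - intros; apply Hd; lra.
    - intros y Hy Hn. specialize (Hle y ltac:(lra)). rewrite Rabs_left in Hle by assumption. lra. }
  apply Rlt_le_trans with (D a * exp (- C * (b - a))).
  - apply Rmult_lt_0_compat; [exact Ha|apply exp_pos].
  - apply (gronwall_ge D dD (- C) a b Hab Hc Hd).
    intros x Hx. specialize (Hle x Hx). rewrite Rabs_right in Hle; [exact Hle|].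
    apply Rle_ge, Hnn. lra.
Qed.

(** * The equation as a Lipschitz system *)

(* The nonlinearity b; [cof] is b' / 2. *)
Definition bpl (y : R) : R := 2 * y - Rmax y 0.

Definition cof (y : R) : R := if Rlt_dec y 0 then 1 else / 2.

Lemma bpl_cof (y : R) : bpl y = 2 * cof y * y.
Proof. unfold bpl, cof, Rmax. destruct (Rlt_dec y 0), (Rle_dec y 0); lra. Qed.

Lemma cof_bounds (y : R) : / 2 <= cof y <= 1.
Proof. unfold cof. destruct (Rlt_dec y 0); lra. Qed.

Lemma bpl_lipschitz (x y : R) : Rabs (bpl x - bpl y) <= 2 * Rabs (x - y).
Proof.
  unfold bpl, Rmax. destruct (Rle_dec x 0), (Rle_dec y 0);
    unfold Rabs; repeat destruct Rcase_abs; lra.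
Qed.

Lemma bpl_0 : bpl 0 = 0.
Proof. unfold bpl. rewrite Rmax_left; lra. Qed.

Lemma bpl_abs (x : R) : Rabs (bpl x) <= 2 * Rabs x.
Proof. pose proof (bpl_lipschitz x 0). rewrite bpl_0, !Rminus_0_r in H. exact H. Qed.

Lemma bpl_scale (k y : R) : 0 <= k -> bpl (k * y) = k * bpl y.
Proof.
  intros Hk. unfold bpl.
  assert (Rmax (k * y) 0 = k * Rmax y 0); [|lra].
  rewrite <- RmaxRmult by exact Hk. f_equal. ring.
Qed.

Lemma lipschitz_continuity (f : R -> R) (K : R) :
  (forall x y, Rabs (f x - f y) <= K * Rabs (x - y)) -> forall x, continuity_pt f x.
Proof.
  intros H x eps He.
  assert (HK : 0 < Rabs K + 1) by (pose proof (Rabs_pos K); lra).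
  exists (eps / (Rabs K + 1)). split; [apply Rdiv_lt_0_compat; assumption|].
  intros y [_ Hy]. unfold dist in *; simpl in *; unfold R_dist in *.
  apply Rle_lt_trans with (1 := H y x).
  apply Rle_lt_trans with ((Rabs K + 1) * Rabs (y - x)).
  - apply Rmult_le_compat_r; [apply Rabs_pos|]. pose proof (Rle_abs K); lra.
  - apply Rmult_lt_compat_l with (r := Rabs K + 1) in Hy; [|assumption].
    replace ((Rabs K + 1) * (eps / (Rabs K + 1))) with eps in Hy by (field; lra). exact Hy.
Qed.

Lemma continuity_const (c r : R) : continuity_pt (fun _ => c) r.
Proof. apply continuity_pt_const; intros ? ?; reflexivity. Qed.

Lemma continuity_id (r : R) : continuity_pt (fun x => x) r.
Proof. apply derivable_continuous_pt, derivable_pt_id. Qed.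

Lemma continuity_pow (y : R -> R) (k : nat) (r : R) :
  continuity_pt y r -> continuity_pt (fun z => y z ^ k) r.
Proof.
  intros H. apply (continuity_pt_comp y (fun z => z ^ k)); [exact H|].
  apply derivable_continuous_pt, derivable_pt_pow.
Qed.

Lemma continuity_bpl (y : R -> R) (r : R) :
  continuity_pt y r -> continuity_pt (fun z => bpl (y z)) r.
Proof.
  intros H. apply (continuity_pt_comp y bpl); [exact H|].
  apply lipschitz_continuity with 2. exact bpl_lipschitz.
Qed.

Lemma continuity_exp (y : R -> R) (r : R) :
  continuity_pt y r -> continuity_pt (fun z => exp (y z)) r.
Proof.
  intros H. apply (continuity_pt_comp y exp); [exact H|].
  apply derivable_continuous_pt, derivable_pt_exp.
Qed.

Lemma continuity_atan (y : R -> R) (r : R) :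
  continuity_pt y r -> continuity_pt (fun z => atan (y z)) r.
Proof.
  intros H. apply (continuity_pt_comp y atan); [exact H|].
  apply derivable_continuous_pt, derivable_pt_atan.
Qed.

Lemma continuity_comp_cos (y : R -> R) (r : R) :
  continuity_pt y r -> continuity_pt (fun z => cos (y z)) r.
Proof. intros H. apply (continuity_pt_comp y cos); [exact H|apply continuity_cos]. Qed.

Lemma continuity_comp_sin (y : R -> R) (r : R) :
  continuity_pt y r -> continuity_pt (fun z => sin (y z)) r.
Proof. intros H. apply (continuity_pt_comp y sin); [exact H|apply continuity_sin]. Qed.

(** A hook for [cont], redefined further on when the continuity of solutions and phases becomes
    available. *)
Ltac cont_leaf := fail.

Ltac cont :=
  repeat first
    [ assumption | cont_leaf
    | match goal with H : forall x, continuity_pt ?f x |- continuity_pt ?f _ => apply H end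
    | apply continuity_const | apply continuity_id | apply continuity_pow
    | apply continuity_bpl | apply continuity_exp | apply continuity_atan
    | apply continuity_comp_cos | apply continuity_comp_sin
    | apply continuity_pt_minus | apply continuity_pt_plus | apply continuity_pt_div
    | apply continuity_pt_mult | apply continuity_pt_opp ].

Lemma Rmax0_continuity (x : R) : continuity_pt (Rmax 0) x.
Proof.
  apply lipschitz_continuity with 1. intros u v. unfold Rmax.
  destruct (Rle_dec 0 u), (Rle_dec 0 v); unfold Rabs; repeat destruct Rcase_abs; lra.
Qed.

Lemma continuity_nonzero_local (f : R -> R) (x : R) :
  continuity_pt f x -> f x <> 0 ->
  exists d, 0 < d /\ forall y, x - d < y < x + d -> 0 < f x * f y.
Proof.
  intros Hc Hn.
  apply (continuity_pos_local (fun y => f x * f y) x); [cont|nra].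
Qed.

Lemma cof_same_sign (x y : R) : 0 < x * y -> cof x = cof y.
Proof. intros H. unfold cof. destruct (Rlt_dec x 0), (Rlt_dec y 0); nra. Qed.

Lemma is_derive_bpl (y : R -> R) (x l : R) :
  is_derive y x l -> y x <> 0 -> is_derive (fun z => bpl (y z)) x (2 * cof (y x) * l).
Proof.
  intros Hd Hn.
  destruct (continuity_nonzero_local y x) as [d [Hd0 H]];
    [eapply is_derive_continuity, Hd|exact Hn|].
  apply is_derive_ext_loc with (fun z => 2 * cof (y x) * y z).
  - apply locally_interval with d; [exact Hd0|]. intros z Hz.
    rewrite bpl_cof, (cof_same_sign (y x) (y z)); [reflexivity|apply H, Hz].
  - apply (is_derive_scal y x (2 * cof (y x)) l Hd).
Qed.

Lemma is_derive_pow_div (n : nat) (x : R) :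
  0 < x -> is_derive (fun z => z ^ n) x (INR n * x ^ n / x).
Proof.
  intros Hx. auto_derive; [exact I|]. destruct n as [|n].
  - simpl. field. lra.
  - rewrite Nat.pred_succ. simpl pow. field. lra.
Qed.

(* With N = n + 1, the second-order equation [y'' + n/r y' = sigma c(y) (r y' + m y)]
   is, in divergence form, this Lipschitz first-order system, with [mu = m - N]. *)
Definition sys_at (n : nat) (sigma mu : R) (y W : R -> R) (r : R) : Prop :=
  is_derive y r (sigma / 2 * (r * bpl (y r) + W r)) /\
  is_derive W r (mu * bpl (y r) - INR n / r * W r).

Definition sqdist (y1 W1 y2 W2 : R -> R) (r : R) : R :=
  (y1 r - y2 r) ^ 2 + (W1 r - W2 r) ^ 2.

Lemma is_derive_sqdist n sigma mu y1 W1 y2 W2 r :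
  sys_at n sigma mu y1 W1 r -> sys_at n sigma mu y2 W2 r ->
  is_derive (sqdist y1 W1 y2 W2) r
    (2 * (y1 r - y2 r) * (sigma / 2 * (r * (bpl (y1 r) - bpl (y2 r)) + (W1 r - W2 r))) +
     2 * (W1 r - W2 r) *
       (mu * (bpl (y1 r) - bpl (y2 r)) - INR n / r * (W1 r - W2 r))).
Proof.
  intros [Hy1 HW1] [Hy2 HW2]. unfold sqdist.
  assert (S : forall f l, is_derive f r l -> is_derive (fun z => f z ^ 2) r (2 * f r * l)).
  { intros f l Hf. apply is_derive_eq with (l * (2 * f r)); [|ring].
    apply (is_derive_comp_R (fun z => z ^ 2) f); [|exact Hf].
    auto_derive; [exact I|ring]. }
  eapply is_derive_eq.
  - apply is_derive_plus_R; apply S; apply is_derive_minus_R; eassumption.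
  - cbv beta. ring.
Qed.

(** The singular contribution - 2 n/r w^2 is kept apart because of its sign: forwards in r it only
    helps, so estimates may start at r = 0; backwards it costs 2 n/a on [a, b], so there a must be
    positive. *)
Lemma sqdist_deriv_bound n sigma mu r M d b w :
  Rabs sigma <= 1 -> 0 < r <= M -> Rabs b <= 2 * Rabs d ->
  Rabs (2 * d * (sigma / 2 * (r * b + w)) + 2 * w * (mu * b))
    <= (2 * M + 1 + 4 * Rabs mu) * (d ^ 2 + w ^ 2) /\
  0 <= INR n / r * w ^ 2.
Proof.
  intros Hs Hr Hb. split.
  - replace (2 * d * (sigma / 2 * (r * b + w)) + 2 * w * (mu * b))
      with (sigma * (d * (r * b) + d * w) + 2 * (mu * (w * b))) by field.
    assert (Hwb : Rabs (w * b) <= d ^ 2 + w ^ 2).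
    { rewrite Rabs_mult. rewrite <- (pow2_abs d), <- (pow2_abs w).
      pose proof (Rabs_pos w). pose proof (Rabs_pos d).
      pose proof (pow2_ge_0 (Rabs w - Rabs d)).
      assert (Rabs w * Rabs b <= Rabs w * (2 * Rabs d)) by (apply Rmult_le_compat_l; lra). nra. }
    assert (Hdb : Rabs (d * (r * b)) <= 2 * M * d ^ 2).
    { rewrite !Rabs_mult, (Rabs_right r) by lra. rewrite <- (pow2_abs d).
      pose proof (Rabs_pos b). pose proof (Rabs_pos d).
      assert (r * Rabs b <= M * (2 * Rabs d)) by (apply Rmult_le_compat; lra). nra. }
    assert (Hdw : Rabs (d * w) <= d ^ 2 + w ^ 2).
    { pose proof (pow2_ge_0 (d + w)). pose proof (pow2_ge_0 (d - w)).
      apply Rabs_le. split; nra. }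
    pose proof (Rabs_pos mu). pose proof (pow2_ge_0 d). pose proof (pow2_ge_0 w).
    eapply Rle_trans; [apply Rabs_triang|].
    rewrite (Rabs_mult sigma), (Rabs_mult 2), (Rabs_mult mu), (Rabs_right 2) by lra.
    assert (Rabs (d * (r * b) + d * w) <= 2 * M * d ^ 2 + (d ^ 2 + w ^ 2)).
    { eapply Rle_trans; [apply Rabs_triang|]. lra. }
    assert (Rabs sigma * Rabs (d * (r * b) + d * w) <= 2 * M * d ^ 2 + (d ^ 2 + w ^ 2)).
    { pose proof (Rabs_pos sigma). pose proof (Rabs_pos (d * (r * b) + d * w)). nra. }
    assert (Rabs mu * Rabs (w * b) <= Rabs mu * (d ^ 2 + w ^ 2)) by
      (apply Rmult_le_compat_l; assumption).
    assert (0 <= M * w ^ 2) by (apply Rmult_le_pos; lra).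
    assert (0 <= Rabs mu * (d ^ 2 + w ^ 2)) by (apply Rmult_le_pos; lra).
    lra.
  - apply Rmult_le_pos; [|apply pow2_ge_0].
    apply Rmult_le_pos; [apply pos_INR|]. left. apply Rinv_0_lt_compat. lra.
Qed.

Lemma sqdist_forward n sigma mu y1 W1 y2 W2 a b :
  Rabs sigma <= 1 -> 0 <= a <= b ->
  (forall r, a <= r <= b -> continuity_pt (sqdist y1 W1 y2 W2) r) ->
  (forall r, a < r < b -> sys_at n sigma mu y1 W1 r /\ sys_at n sigma mu y2 W2 r) ->
  sqdist y1 W1 y2 W2 b <=
    sqdist y1 W1 y2 W2 a * exp ((2 * b + 1 + 4 * Rabs mu) * (b - a)).
Proof.
  intros Hs Hab Hc Hsys. eapply gronwall; [lra|exact Hc| |].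
  - intros r Hr. destruct (Hsys r Hr) as [H1 H2]. exact (is_derive_sqdist _ _ _ _ _ _ _ _ H1 H2).
  - intros r Hr.
    destruct (sqdist_deriv_bound n sigma mu r b (y1 r - y2 r) (bpl (y1 r) - bpl (y2 r))
                (W1 r - W2 r)) as [H1 H2]; [assumption|lra|apply bpl_lipschitz|].
    apply Rabs_le_between in H1. unfold sqdist. cbv beta. lra.
Qed.

Lemma sqdist_backward n sigma mu y1 W1 y2 W2 a b :
  Rabs sigma <= 1 -> 0 < a <= b ->
  (forall r, a <= r <= b -> continuity_pt (sqdist y1 W1 y2 W2) r) ->
  (forall r, a < r < b -> sys_at n sigma mu y1 W1 r /\ sys_at n sigma mu y2 W2 r) ->
  sqdist y1 W1 y2 W2 a <=
    sqdist y1 W1 y2 W2 b *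
      exp ((2 * b + 1 + 4 * Rabs mu + 2 * (INR n / a)) * (b - a)).
Proof.
  intros Hs Hab Hc Hsys.
  set (C := 2 * b + 1 + 4 * Rabs mu + 2 * (INR n / a)).
  assert (H : sqdist y1 W1 y2 W2 a * exp (- C * (b - a)) <= sqdist y1 W1 y2 W2 b).
  { eapply gronwall_ge; [lra|exact Hc| |].
    - intros r Hr. destruct (Hsys r Hr) as [H1 H2]. exact (is_derive_sqdist _ _ _ _ _ _ _ _ H1 H2).
    - intros r Hr.
      destruct (sqdist_deriv_bound n sigma mu r b (y1 r - y2 r) (bpl (y1 r) - bpl (y2 r))
                  (W1 r - W2 r)) as [H1 H2]; [assumption|lra|apply bpl_lipschitz|].
      apply Rabs_le_between in H1. unfold sqdist, C. cbv beta.
      assert (INR n / r <= INR n / a).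
      { apply Rmult_le_compat_l; [apply pos_INR|]. apply Rinv_le_contravar; lra. }
      assert (INR n / r * (W1 r - W2 r) ^ 2 <=
              INR n / a * ((y1 r - y2 r) ^ 2 + (W1 r - W2 r) ^ 2)).
      { pose proof (pow2_ge_0 (W1 r - W2 r)). pose proof (pow2_ge_0 (y1 r - y2 r)).
        apply Rmult_le_compat; try lra.
        apply Rmult_le_pos; [apply pos_INR|]. left; apply Rinv_0_lt_compat; lra. }
      lra. }
  apply Rmult_le_compat_r with (r := exp (C * (b - a))) in H; [|left; apply exp_pos].
  rewrite Rmult_assoc, <- exp_plus in H.
  replace (- C * (b - a) + C * (b - a)) with 0 in H by ring.
  rewrite exp_0, Rmult_1_r in H. exact H.
Qed.

(** * Solutions in the sense of the definitions *)

(** A common form of the two equations, with n = N - 1: [sigma = 1], [m = - alpha] for the equation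
    that defines the numbers alpha_k, and [sigma = - 1], [m = - beta] for the profile. *)
Definition sol_def (n : nat) (sigma m : R) (y dy : R -> R) : Prop :=
  C11_halfline y dy /\ y 0 <> 0 /\ dy 0 = 0 /\
  forall r, 0 < r -> y r <> 0 ->
    ode_at y dy (INR n / r - sigma * cof (y r) * r) (- sigma * cof (y r) * m) r.

(* Freezing a function at [f 0] on the negative axis turns one-sided continuity at 0
   into continuity. *)
Definition clamp (f : R -> R) (r : R) : R := f (Rmax 0 r).

Lemma clamp_pos (f : R -> R) (r : R) : 0 <= r -> clamp f r = f r.
Proof. intros H. unfold clamp. rewrite Rmax_right; [reflexivity|exact H]. Qed.

Lemma locally_pos (P : R -> Prop) (x : R) :
  0 < x -> (forall y, 0 < y -> P y) -> locally x P.
Proof.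
  intros Hx H. apply locally_interval with x; [exact Hx|]. intros y Hy. apply H. lra.
Qed.

Lemma clamp_derive (f : R -> R) (r l : R) :
  0 < r -> is_derive f r l <-> is_derive (clamp f) r l.
Proof.
  intros Hr. split; apply is_derive_ext_loc; apply locally_pos; try exact Hr;
    intros y Hy; rewrite clamp_pos; (reflexivity || lra).
Qed.

Lemma clamp_continuity (f : R -> R) :
  (forall r, 0 < r -> continuity_pt f r) ->
  (forall eps, 0 < eps -> exists d, 0 < d /\ forall r, 0 <= r < d -> Rabs (f r - f 0) < eps) ->
  forall r, continuity_pt (clamp f) r.
Proof.
  intros Hp H0 r. destruct (Rtotal_order r 0) as [Hr|[->|Hr]].
  - apply continuity_pt_ext_loc with (fun _ => f 0).
    + apply locally_interval with (- r); [lra|]. intros y Hy.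
      unfold clamp. rewrite Rmax_left; [reflexivity|lra].
    + apply continuity_const.
  - intros eps He. destruct (H0 eps He) as [d [Hd H]]. exists d. split; [exact Hd|].
    intros y [_ Hy]. unfold dist in *; simpl in *; unfold R_dist in *.
    rewrite (clamp_pos f 0) by lra. unfold clamp. apply H. apply Rabs_def2 in Hy. minmax.
  - apply continuity_pt_ext_loc with f.
    + apply locally_pos; [exact Hr|]. intros y Hy. rewrite clamp_pos; [reflexivity|lra].
    + apply Hp, Hr.
Qed.

Definition lip (M : R) (f : R -> R) : Prop :=
  exists L, forall s s', 0 <= s <= M -> 0 <= s' <= M ->
    Rabs (f s - f s') <= L * Rabs (s - s').

Lemma lip_clamp_continuity (f : R -> R) :
  (forall M, lip M f) -> forall r, continuity_pt (clamp f) r.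
Proof.
  intros Hf r eps He. destruct (Hf (Rabs r + 1)) as [L HL].
  set (K := Rabs L + 1).
  assert (HK : 0 < K) by (unfold K; pose proof (Rabs_pos L); lra).
  assert (HeK : 0 < eps / K) by (apply Rdiv_lt_0_compat; assumption).
  exists (Rmin 1 (eps / K)). split; [apply Rmin_pos; lra|].
  intros z [_ Hz]. unfold dist in *; simpl in *; unfold R_dist, clamp in *.
  assert (Hz1 : Rabs (z - r) < 1 /\ Rabs (z - r) < eps / K) by minmax.
  destruct Hz1 as [Hz1 Hz2]. apply Rabs_def2 in Hz1.
  pose proof (Rle_abs r). pose proof (Rabs_pos r).
  apply Rle_lt_trans with (L * Rabs (Rmax 0 z - Rmax 0 r)); [apply HL; minmax|].
  assert (Hm : Rabs (Rmax 0 z - Rmax 0 r) <= Rabs (z - r)).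
  { unfold Rabs; repeat destruct Rcase_abs; minmax. }
  pose proof (Rabs_pos (Rmax 0 z - Rmax 0 r)). pose proof (Rle_abs L).
  apply Rle_lt_trans with (K * Rabs (z - r)); [unfold K in *; nra|].
  replace eps with (K * (eps / K)) by (field; lra). apply Rmult_lt_compat_l; assumption.
Qed.

Lemma C11_clamp_continuity (f df : R -> R) :
  C11_halfline f df ->
  (forall r, continuity_pt (clamp f) r) /\ (forall r, continuity_pt (clamp df) r).
Proof.
  intros [Hd [H0 HL]]. split; [apply clamp_continuity|apply lip_clamp_continuity, HL].
  - intros r Hr. apply is_derive_continuity with (df r), Hd, Hr.
  - intros eps He.
    destruct (H0 (fun z => Rabs (z - df 0) < 1)) as [d Hd'].
    { exists (mkposreal 1 Rlt_0_1). intros z Hz. exact Hz. }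
    set (K := Rabs (df 0) + 1).
    assert (HK : 0 < K) by (unfold K; pose proof (Rabs_pos (df 0)); lra).
    exists (Rmin d (eps / K)). split.
    { apply Rmin_pos; [apply cond_pos|]. apply Rdiv_lt_0_compat; assumption. }
    intros r Hr. pose proof (Rmin_l d (eps / K)). pose proof (Rmin_r d (eps / K)).
    destruct (Req_dec r 0) as [->|Hne].
    { rewrite Rminus_diag, Rabs_R0. exact He. }
    assert (A : Rabs ((f r - f 0) / r - df 0) < 1).
    { apply Hd'; [|lra]. unfold ball; simpl; unfold AbsRing_ball, abs, minus, plus, opp; simpl.
      rewrite Rabs_right; lra. }
    assert (B : Rabs ((f r - f 0) / r) < K).
    { unfold K. replace ((f r - f 0) / r) with (((f r - f 0) / r - df 0) + df 0) by ring.
      eapply Rle_lt_trans; [apply Rabs_triang|]. lra. }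
    replace (f r - f 0) with ((f r - f 0) / r * r) by (field; lra).
    rewrite Rabs_mult, (Rabs_right r) by lra.
    apply Rlt_le_trans with (K * r); [apply Rmult_lt_compat_r; lra|].
    replace eps with (K * (eps / K)) by (field; lra). apply Rmult_le_compat_l; lra.
Qed.

Lemma eq_of_zero_deriv (G : R -> R) (a b : R) :
  a <= b -> (forall x, a <= x <= b -> continuity_pt G x) ->
  (forall x, a < x < b -> is_derive G x 0) -> G b = G a.
Proof.
  intros Hab Hc Hd. apply Rle_antisym.
  - assert (- G a <= - G b); [|lra].
    apply (nondecreasing_deriv (fun x => - G x) (fun _ => - 0) a b Hab).
    + intros x Hx. apply continuity_pt_opp, Hc, Hx.
    + intros x Hx. apply is_derive_opp_R, Hd, Hx.
    + intros; lra.
  - apply (nondecreasing_deriv G (fun _ => 0) a b Hab Hc Hd). intros; lra.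
Qed.

Lemma continuity_eq_limit (G : R -> R) (a b c : R) :
  a < b -> continuity_pt G b -> (forall y, a < y < b -> G y = c) -> G b = c.
Proof.
  intros Hab Hc H. apply Rle_antisym.
  - assert (0 <= c - G b); [|lra].
    apply (continuity_ge_limit (fun x => c - G x) a b).
    + cont.
    + exact Hab.
    + intros y Hy. rewrite H by exact Hy. lra.
  - assert (0 <= G b - c); [|lra].
    apply (continuity_ge_limit (fun x => G x - c) a b).
    + cont.
    + exact Hab.
    + intros y Hy. rewrite H by exact Hy. lra.
Qed.

Definition punctured_zero_deriv (G : R -> R) (x : R) : Prop :=
  exists d, 0 < d /\ forall y, x - d < y < x + d -> y <> x -> is_derive G y 0.

Lemma is_derive_RInt_continuity (f : R -> R) (a r : R) :
  (forall x, continuity_pt f x) -> is_derive (fun z => RInt f a z) r (f r).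
Proof.
  intros H. apply is_derive_RInt with a.
  - apply filter_forall. intros z. apply RInt_correct, ex_RInt_continuous.
    intros x _. apply continuity_pt_filterlim, H.
  - apply continuity_pt_filterlim, H.
Qed.

Lemma constant_right (G : R -> R) (a b : R) :
  a <= b -> (forall x, a <= x <= b -> continuity_pt G x) ->
  (forall x, a <= x < b -> punctured_zero_deriv G x) -> G b = G a.
Proof.
  intros Hab Hc Hd.
  apply (real_induction (fun x => G x = G a) a b); try lra.
  - intros x Hx HQ. destruct (Hd x Hx) as [d [Hd0 H]]. exists d. split; [exact Hd0|].
    intros y Hy Hyb. rewrite <- HQ. apply eq_of_zero_deriv; [lra| |].
    + intros z Hz. apply Hc. lra.
    + intros z Hz. apply H; lra.
  - intros x Hx HQ. apply continuity_eq_limit with a; [lra|apply Hc; lra|].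
    intros y Hy. apply HQ. lra.
Qed.

(** From the midpoint [constant_right] reaches b and, applied to x -> G (- x), also a. The
    endpoints, one of which will be the singular point 0, thus enter by continuity alone. *)
Lemma constant_of_punctured (G : R -> R) (a b : R) :
  a < b -> (forall x, a <= x <= b -> continuity_pt G x) ->
  (forall x, a < x < b -> punctured_zero_deriv G x) -> G b = G a.
Proof.
  intros Hab Hc Hd. transitivity (G ((a + b) / 2)).
  - apply constant_right; [lra| |]; intros x Hx; [apply Hc|apply Hd]; lra.
  - set (c := (a + b) / 2). assert (Hac : a < c < b) by (unfold c; lra).
    pose proof (constant_right (fun x => G (- x)) (- c) (- a)) as H. cbv beta in H.
    rewrite !Ropp_involutive in H. symmetry. apply H; [lra| |].
    + intros x Hx. apply (continuity_pt_comp Ropp G); [|apply Hc; lra].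
      apply continuity_pt_opp, derivable_continuous_pt, derivable_pt_id.
    + intros x Hx. destruct (Hd (- x)) as [d [Hd0 H']]; [lra|]. exists d. split; [exact Hd0|].
      intros y Hy Hne.
      apply is_derive_eq with (- (1) * 0); [|ring].
      apply (is_derive_comp_R G Ropp); [apply H'; lra|].
      apply (is_derive_opp_R (fun t => t) y 1). apply (is_derive_id y).
Qed.

Section FromDefinition.

Variables (n : nat) (sigma m : R) (y dy : R -> R).
Hypothesis Hsigma : sigma * sigma = 1.
Hypothesis Hsol : sol_def n sigma m y dy.

Let mu := m - INR n - 1.
Let yc := clamp y.
Let dyc := clamp dy.
Let W := fun r => 2 * sigma * dyc r - r * bpl (yc r).
Let U := fun r => RInt (fun s => s ^ n * bpl (yc s)) 0 r.
(** A first integral. As sigma^2 = 1, [W] satisfies the first equation of [sys_at] by construction;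
    the second one says that [G] is constant. The definition yields G' = 0 off the zeros of y, and
    continuity of [G] extends this across isolated zeros. *)
Let G := fun r => r ^ n * W r - mu * U r.

Lemma yc_continuity r : continuity_pt yc r.
Proof. apply (C11_clamp_continuity y dy), Hsol. Qed.

Lemma dyc_continuity r : continuity_pt dyc r.
Proof. apply (C11_clamp_continuity y dy), Hsol. Qed.

Lemma W_continuity r : continuity_pt W r.
Proof.
  pose proof (yc_continuity r). pose proof (dyc_continuity r). unfold W. cont.
Qed.

Lemma U_derive r : is_derive U r (r ^ n * bpl (yc r)).
Proof.
  apply (is_derive_RInt_continuity (fun s => s ^ n * bpl (yc s))). intros x.
  pose proof (yc_continuity x). cont.
Qed.

Lemma G_continuity r : continuity_pt G r.
Proof.
  pose proof (W_continuity r). pose proof (is_derive_continuity _ _ _ (U_derive r)). unfold G. cont.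
Qed.

Lemma W_0 : W 0 = 0.
Proof.
  unfold W, dyc. rewrite clamp_pos by lra. destruct Hsol as [_ [_ [-> _]]]. ring.
Qed.

Lemma G_0 : G 0 = 0.
Proof. unfold G, U. rewrite RInt_point, W_0. unfold zero; simpl. ring. Qed.

Lemma G_derive r : 0 < r -> y r <> 0 -> is_derive G r 0.
Proof.
  intros Hr Hn. destruct Hsol as [[Hd _] [_ [_ Ho]]].
  destruct (Ho r Hr Hn) as [d2 [Hd2 E]].
  assert (Hyc : is_derive yc r (dy r)) by (apply (proj1 (clamp_derive y r (dy r) Hr)), Hd, Hr).
  assert (Ey : yc r = y r) by (apply clamp_pos; lra).
  assert (Edy : dyc r = dy r) by (apply clamp_pos; lra).
  assert (Hdyc : is_derive dyc r d2) by (apply (proj1 (clamp_derive dy r d2 Hr)), Hd2).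
  eapply is_derive_eq.
  - apply is_derive_minus_R.
    + apply is_derive_mult_R; [apply is_derive_pow_div, Hr|].
      apply is_derive_minus_R.
      * apply (is_derive_scal dyc r (2 * sigma)). exact Hdyc.
      * apply is_derive_mult_R; [apply (is_derive_id r)|].
        apply is_derive_bpl; [exact Hyc|]. rewrite Ey; exact Hn.
    + apply (is_derive_scal U r mu). apply U_derive.
  - unfold W, one, mult; simpl. cbv beta. rewrite Ey, Edy, bpl_cof.
    assert (E2 : d2 = - (INR n / r - sigma * cof (y r) * r) * dy r + sigma * cof (y r) * m * y r) by lra.
    rewrite E2. unfold mu.
    transitivity (r ^ n * (cof (y r) * (sigma * sigma - 1) * (2 * r * dy r + 2 * m * y r)));
      [field; lra|]. rewrite Hsigma. ring.
Qed.

Lemma punctured_nonzero r :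
  0 < r -> y r <> 0 \/ dy r <> 0 ->
  exists d, 0 < d /\ forall z, r - d < z < r + d -> z <> r -> 0 < z /\ y z <> 0.
Proof.
  intros Hr Hn.
  assert (H : exists d, 0 < d /\ forall z, r - d < z < r + d -> z <> r -> y z <> 0).
  { destruct (Req_dec (y r) 0) as [E|Hy].
    - destruct Hn as [Hn|Hn]; [contradiction|].
      destruct Hsol as [[Hd _] _]. specialize (Hd r Hr).
      destruct (Rdichotomy _ _ Hn) as [Hneg|Hpos].
      + destruct (deriv_pos_local (fun z => - y z) r (- dy r)) as [d [Hd0 [H1 H2]]];
          [apply is_derive_opp_R, Hd|lra|].
        exists d. split; [exact Hd0|]. intros z Hz Hne.
        destruct (Rdichotomy _ _ Hne) as [Hlt|Hgt];
          [specialize (H2 z)|specialize (H1 z)]; lra.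
      + destruct (deriv_pos_local y r (dy r)) as [d [Hd0 [H1 H2]]]; [exact Hd|lra|].
        exists d. split; [exact Hd0|]. intros z Hz Hne.
        destruct (Rdichotomy _ _ Hne) as [Hlt|Hgt];
          [specialize (H2 z)|specialize (H1 z)]; lra.
    - destruct (continuity_nonzero_local y r) as [d [Hd0 H]].
      + eapply is_derive_continuity. apply Hsol, Hr.
      + exact Hy.
      + exists d. split; [exact Hd0|]. intros z Hz _ E. specialize (H z Hz). rewrite E in H. lra. }
  destruct H as [d [Hd H]]. exists (Rmin d r). split; [minmax|].
  intros z Hz Hne. split; [minmax|apply H; [minmax|exact Hne]].
Qed.

Lemma G_zero_upto x :
  0 < x -> (forall z, 0 < z < x -> y z <> 0 \/ dy z <> 0) -> G x = 0.
Proof.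
  intros Hx H. rewrite <- G_0. apply constant_of_punctured; [exact Hx| |].
  - intros; apply G_continuity.
  - intros z Hz. destruct (punctured_nonzero z) as [d [Hd Hp]]; [lra|apply H, Hz|].
    exists d. split; [exact Hd|]. intros w Hw Hne. apply G_derive; apply (Hp w Hw Hne).
Qed.

Lemma sys_of_G_zero r :
  0 < r -> (exists d, 0 < d /\ forall z, r - d < z < r + d -> G z = 0) ->
  sys_at n sigma mu yc W r.
Proof.
  intros Hr [d [Hd HG]].
  assert (Ey : yc r = y r) by (apply clamp_pos; lra).
  assert (Edy : dyc r = dy r) by (apply clamp_pos; lra).
  split.
  - apply (proj1 (clamp_derive y r _ Hr)). eapply is_derive_eq; [apply Hsol, Hr|].
    unfold W. rewrite Ey, Edy.
    transitivity (sigma * sigma * dy r); [rewrite Hsigma; ring|field].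
  - assert (EW : forall z, 0 < z -> r - d < z < r + d -> W z = mu * U z / z ^ n).
    { intros z Hz Hzd. specialize (HG z Hzd). unfold G in HG.
      assert (z ^ n <> 0) by (apply pow_nonzero; lra).
      apply Rmult_eq_reg_l with (z ^ n); [|assumption]. field_simplify_eq; [lra|assumption]. }
    apply is_derive_ext_loc with (fun z => mu * U z / z ^ n).
    + apply locally_interval with (Rmin d r); [minmax|]. intros z Hz. symmetry. apply EW; minmax.
    + rewrite (EW r) by lra.
      assert (Hpn : r ^ n <> 0) by (apply pow_nonzero; lra).
      eapply is_derive_eq.
      * apply is_derive_div; [apply (is_derive_scal U r mu), U_derive|
          apply is_derive_pow_div, Hr|exact Hpn].
      * unfold mult; simpl. field. lra.
Qed.

Lemma nonzero_near_0 : exists d, 0 < d /\ forall z, 0 <= z < d -> y z <> 0.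
Proof.
  destruct (continuity_nonzero_local yc 0) as [d [Hd H]]; [apply yc_continuity| |].
  { unfold yc. rewrite clamp_pos by lra. apply Hsol. }
  exists d. split; [exact Hd|]. intros z Hz E. specialize (H z ltac:(lra)).
  unfold yc in H. rewrite (clamp_pos y z), E in H; lra.
Qed.

(** Up to a first double zero all zeros are simple, hence isolated, so the system holds. At the
    double zero its data are (0, 0), and the backward estimate against the zero solution makes y
    vanish down to the origin, contradicting y 0 <> 0. *)
Lemma no_double_zero T :
  0 < T -> forall x, 0 <= x <= T -> x = 0 \/ (y x <> 0 \/ dy x <> 0).
Proof.
  intros HT. apply real_induction; [lra|left; reflexivity| |].
  - intros x Hx HQ. destruct (Req_dec x 0) as [->|Hne].
    + destruct nonzero_near_0 as [d [Hd H]]. exists d. split; [exact Hd|].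
      intros z Hz _. right; left. apply H. lra.
    + destruct (punctured_nonzero x) as [d [Hd H]]; [lra|tauto|].
      exists d. split; [exact Hd|]. intros z Hz _. right; left. apply (H z); lra.
  - intros x Hx HQ. right. apply NNPP. intros Hn.
    assert (Ey : y x = 0) by (apply NNPP; tauto).
    assert (Edy : dy x = 0) by (apply NNPP; tauto).
    assert (Hnd : forall z, 0 < z < x -> y z <> 0 \/ dy z <> 0).
    { intros z Hz. destruct (HQ z); [lra|lra|assumption]. }
    assert (HW : W x = 0).
    { unfold W, dyc, yc. rewrite !clamp_pos, Ey, Edy, bpl_0 by lra. ring. }
    assert (Hsq : forall a, 0 < a < x -> y a = 0).
    { intros a Ha.
      assert (H : sqdist yc W (fun _ => 0) (fun _ => 0) a <=
        sqdist yc W (fun _ => 0) (fun _ => 0) x *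
        exp ((2 * x + 1 + 4 * Rabs mu + 2 * (INR n / a)) * (x - a))).
      { apply sqdist_backward with sigma; [|lra| |].
        - apply Rabs_le. nra.
        - intros r Hr. pose proof (yc_continuity r). pose proof (W_continuity r).
          unfold sqdist. cont.
        - intros r Hr. split.
          + apply sys_of_G_zero; [lra|]. exists (Rmin r (x - r)). split; [minmax|].
            intros z Hz. apply G_zero_upto; [minmax|]. intros w Hw. apply Hnd. minmax.
          + split; eapply is_derive_eq; try apply (is_derive_const 0);
              rewrite bpl_0; unfold zero; simpl; ring. }
      assert (E : sqdist yc W (fun _ => 0) (fun _ => 0) x = 0).
      { unfold sqdist, yc. rewrite clamp_pos, Ey, HW by lra. ring. }
      rewrite E in H. unfold sqdist, yc in H. rewrite clamp_pos in H by lra.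
      pose proof (pow2_ge_0 (W a - 0)). assert (y a ^ 2 = 0) by nra.
      apply NNPP. intros Hne. apply (pow_nonzero _ 2) in Hne. contradiction. }
    destruct nonzero_near_0 as [d [Hd H]].
    destruct (point_between_right 0 x d) as [z [Hz Hzd]]; [lra|exact Hd|].
    apply (H z); [lra|apply Hsq, Hz].
Qed.

Lemma sol_def_system r : 0 < r -> sys_at n sigma mu yc W r.
Proof.
  intros Hr. apply sys_of_G_zero; [exact Hr|]. exists r. split; [exact Hr|].
  intros z Hz. apply G_zero_upto; [lra|]. intros w Hw.
  destruct (no_double_zero z ltac:(lra) w); [lra|lra|assumption].
Qed.

End FromDefinition.

(** Both [W1] and [W2] vanish at 0, where the derivatives do, so the forward estimate starts from
    distance 0. *)
Lemma sol_def_unique n sigma m y1 dy1 y2 dy2 :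
  sigma * sigma = 1 -> sol_def n sigma m y1 dy1 -> sol_def n sigma m y2 dy2 ->
  y1 0 = y2 0 -> forall r, 0 <= r -> y1 r = y2 r.
Proof.
  intros Hs H1 H2 E r Hr.
  destruct (Req_dec r 0) as [->|Hne]; [exact E|].
  set (W1 := fun r => 2 * sigma * clamp dy1 r - r * bpl (clamp y1 r)).
  set (W2 := fun r => 2 * sigma * clamp dy2 r - r * bpl (clamp y2 r)).
  assert (H : sqdist (clamp y1) W1 (clamp y2) W2 r <=
    sqdist (clamp y1) W1 (clamp y2) W2 0 *
      exp ((2 * r + 1 + 4 * Rabs (m - INR n - 1)) * (r - 0))).
  { apply sqdist_forward with (n := n) (sigma := sigma); [|lra| |].
    - apply Rabs_le. nra.
    - intros x _. pose proof (yc_continuity _ _ _ _ _ H1 x). pose proof (yc_continuity _ _ _ _ _ H2 x).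
      pose proof (W_continuity _ _ _ _ _ H1 x). pose proof (W_continuity _ _ _ _ _ H2 x).
      unfold sqdist. cont.
    - intros x Hx. split.
      + apply (sol_def_system _ _ _ _ _ Hs H1); lra.
      + apply (sol_def_system _ _ _ _ _ Hs H2); lra. }
  assert (E0 : sqdist (clamp y1) W1 (clamp y2) W2 0 = 0).
  { unfold sqdist, W1, W2. rewrite (W_0 _ _ _ _ _ H1), (W_0 _ _ _ _ _ H2).
    rewrite !clamp_pos, E by lra. ring. }
  rewrite E0 in H. unfold sqdist in H. rewrite !(clamp_pos _ r) in H by exact Hr.
  pose proof (pow2_ge_0 (W1 r - W2 r)). pose proof (pow2_ge_0 (y1 r - y2 r)).
  assert (E2 : (y1 r - y2 r) ^ 2 = 0) by lra.
  apply NNPP. intros Hn. apply (pow_nonzero (y1 r - y2 r) 2); [lra|exact E2].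
Qed.

(** * Existence by Picard iteration *)

Lemma exp_nondecreasing (x y : R) : x <= y -> exp x <= exp y.
Proof.
  intros [H| ->]; [left; apply exp_increasing, H|right; reflexivity].
Qed.

Lemma exp_ge_1 (x : R) : 0 <= x -> 1 <= exp x.
Proof. intros H. pose proof (exp_ineq1_le x). lra. Qed.

Lemma ex_RInt_continuity (f : R -> R) (a b : R) :
  (forall x, continuity_pt f x) -> ex_RInt f a b.
Proof.
  intros H. apply (ex_RInt_continuous (V := R_CompleteNormedModule)).
  intros x _. apply continuity_pt_filterlim, H.
Qed.

(* The substitution t = s tau makes s^(-n-1) int_0^s t^n h(t) dt regular at s = 0. *)
Definition avg (n : nat) (h : R -> R) (s : R) : R :=
  RInt (fun tau => tau ^ n * h (s * tau)) 0 1.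

Lemma avg_integrand_continuity n h s :
  (forall x, continuity_pt h x) -> forall x, continuity_pt (fun tau => tau ^ n * h (s * tau)) x.
Proof.
  intros H x. pose proof (continuity_pt_comp (fun tau => s * tau) h x) as Hc.
  unfold comp in Hc. cont. apply Hc; cont.
Qed.

Lemma avg_diff n h1 h2 s1 s2 e :
  (forall x, continuity_pt h1 x) -> (forall x, continuity_pt h2 x) ->
  (forall tau, 0 <= tau <= 1 -> Rabs (h1 (s1 * tau) - h2 (s2 * tau)) <= e) ->
  Rabs (avg n h1 s1 - avg n h2 s2) <= e.
Proof.
  intros H1 H2 He.
  assert (C1 := avg_integrand_continuity n h1 s1 H1).
  assert (C2 := avg_integrand_continuity n h2 s2 H2).
  unfold avg.
  assert (E : RInt (fun tau => tau ^ n * h1 (s1 * tau)) 0 1 -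
              RInt (fun tau => tau ^ n * h2 (s2 * tau)) 0 1 =
              RInt (fun tau => tau ^ n * h1 (s1 * tau) - tau ^ n * h2 (s2 * tau)) 0 1).
  { symmetry. apply (RInt_minus (V := R_CompleteNormedModule)); apply ex_RInt_continuity; assumption. }
  rewrite E. replace e with ((1 - 0) * e) by ring.
  apply abs_RInt_le_const; [lra| |].
  - apply ex_RInt_continuity. intros x. cont.
  - intros tau Ht. rewrite <- Rmult_minus_distr_l, Rabs_mult.
    assert (0 <= tau ^ n <= 1).
    { split; [apply pow_le; lra|]. rewrite <- (pow1 n). apply pow_incr. lra. }
    rewrite Rabs_right by lra. specialize (He tau Ht).
    pose proof (Rabs_pos (h1 (s1 * tau) - h2 (s2 * tau))). nra.
Qed.

Lemma avg_continuity n h :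
  (forall x, continuity_pt h x) -> forall s, continuity_pt (avg n h) s.
Proof.
  intros H s eps He. set (M := Rabs s + 1).
  assert (HM : 0 < M) by (unfold M; pose proof (Rabs_pos s); lra).
  destruct (Heine_cor2 (f := h) (a := - M) (b := M) (fun x _ => H x)
              (mkposreal (eps / 2) ltac:(lra))) as [d Hd]. simpl in Hd.
  exists (Rmin 1 d). split; [apply Rmin_pos; [lra|apply cond_pos]|].
  intros z [_ Hz]. unfold dist in *; simpl in *; unfold R_dist in *.
  apply Rle_lt_trans with (eps / 2); [|lra].
  pose proof (Rmin_l 1 d). pose proof (Rmin_r 1 d).
  apply avg_diff; [exact H|exact H|]. intros tau Ht. left.
  assert (B : forall u, Rabs u <= M -> - M <= u * tau <= M).
  { intros u Hu. apply Rabs_le_between. rewrite Rabs_mult, (Rabs_right tau) by lra.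
    pose proof (Rabs_pos u). nra. }
  apply Hd.
  - apply B. unfold M. replace z with ((z - s) + s) by ring.
    eapply Rle_trans; [apply Rabs_triang|]. lra.
  - apply B. unfold M. lra.
  - rewrite <- Rmult_minus_distr_r, Rabs_mult, (Rabs_right tau) by lra.
    pose proof (Rabs_pos (z - s)). nra.
Qed.

Lemma avg_RInt n h s :
  (forall x, continuity_pt h x) ->
  s ^ S n * avg n h s = RInt (fun t => t ^ n * h t) 0 s.
Proof.
  intros H. pose proof (RInt_comp_lin (fun t => t ^ n * h t) s 0 0 1) as E.
  replace (s * 0 + 0) with 0 in E by ring. replace (s * 1 + 0) with s in E by ring.
  rewrite <- E.
  - transitivity (RInt (fun tau => scal (s ^ S n) (tau ^ n * h (s * tau))) 0 1).
    + symmetry. apply (RInt_scal (V := R_CompleteNormedModule)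
                  (fun tau => tau ^ n * h (s * tau)) 0 1 (s ^ S n)).
      apply ex_RInt_continuity, avg_integrand_continuity, H.
    + apply RInt_ext. intros x _. unfold scal; simpl; unfold mult; simpl.
      rewrite Rplus_0_r, Rpow_mult_distr. ring.
  - apply ex_RInt_continuity. intros x. cont.
Qed.

Lemma avg_derive n h s :
  (forall x, continuity_pt h x) -> 0 < s ->
  is_derive (fun r => r * avg n h r) s (h s - INR n / s * (s * avg n h s)).
Proof.
  intros H Hs.
  assert (E : forall r, 0 < r -> r * avg n h r = RInt (fun t => t ^ n * h t) 0 r / r ^ n).
  { intros r Hr. rewrite <- avg_RInt by exact H. simpl. field. apply pow_nonzero. lra. }
  apply is_derive_ext_loc with (fun r => RInt (fun t => t ^ n * h t) 0 r / r ^ n).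
  - apply locally_pos; [exact Hs|]. intros y Hy. symmetry. apply E, Hy.
  - rewrite (E s Hs). eapply is_derive_eq.
    + apply is_derive_div.
      * apply (is_derive_RInt_continuity (fun t => t ^ n * h t)). intros x. cont.
      * apply is_derive_pow_div, Hs.
      * apply pow_nonzero; lra.
    + simpl. field. split; [apply pow_nonzero|]; lra.
Qed.

(** This is - 2 g' as a functional of g alone: the second equation of the system integrates to w =
    al * s * avg (b(g)), which is regular at s = 0. *)
Definition kern (n : nat) (al : R) (h : R -> R) (s : R) : R :=
  s * (bpl (h s) + al * avg n (fun t => bpl (h t)) s).

Definition picard_map (n : nat) (al y0 : R) (h : R -> R) (r : R) : R :=
  y0 - / 2 * RInt (kern n al h) 0 (Rmax 0 r).

Lemma kern_continuity n al h :
  (forall x, continuity_pt h x) -> forall x, continuity_pt (kern n al h) x.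
Proof.
  intros H x. assert (Ha := avg_continuity n _ (fun z => continuity_bpl h z (H z))).
  unfold kern. cont.
Qed.

Lemma picard_map_continuity n al y0 h :
  (forall x, continuity_pt h x) -> forall x, continuity_pt (picard_map n al y0 h) x.
Proof.
  intros H x. apply continuity_pt_minus; [cont|]. apply continuity_pt_mult; [cont|].
  apply (continuity_pt_comp (Rmax 0) (fun r => RInt (kern n al h) 0 r)); [apply Rmax0_continuity|].
  eapply is_derive_continuity, is_derive_RInt_continuity, kern_continuity, H.
Qed.

Lemma picard_map_derive n al y0 h r :
  (forall x, continuity_pt h x) -> 0 < r ->
  is_derive (picard_map n al y0 h) r (- / 2 * kern n al h r).
Proof.
  intros H Hr.
  apply is_derive_ext_loc with (fun r => y0 - / 2 * RInt (kern n al h) 0 r).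
  - apply locally_pos; [exact Hr|]. intros y Hy. unfold picard_map.
    rewrite Rmax_right by lra. reflexivity.
  - eapply is_derive_eq.
    + apply is_derive_minus_R; [apply (is_derive_const y0)|].
      apply (is_derive_scal (fun z => RInt (kern n al h) 0 z) r (/ 2)).
      apply is_derive_RInt_continuity, kern_continuity, H.
    + unfold zero, mult; simpl. ring.
Qed.

Lemma picard_map_nonpos n al y0 h r : r <= 0 -> picard_map n al y0 h r = y0.
Proof.
  intros Hr. unfold picard_map. rewrite Rmax_left, RInt_point by exact Hr.
  unfold zero; simpl. ring.
Qed.

(** With the weight exp (- rate al * t^2) the Picard map contracts by 1/2 on the whole half-line at
    once, so solutions are global without gluing local ones. *)
Definition rate (al : R) : R := 2 * (1 + Rabs al).

Lemma picard_map_contraction n al y0 h1 h2 D :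
  (forall x, continuity_pt h1 x) -> (forall x, continuity_pt h2 x) -> 0 <= D ->
  (forall t, 0 <= t -> Rabs (h1 t - h2 t) <= D * exp (rate al * t ^ 2)) ->
  forall r, 0 <= r ->
    Rabs (picard_map n al y0 h1 r - picard_map n al y0 h2 r) <= D / 2 * exp (rate al * r ^ 2).
Proof.
  intros H1 H2 HD Hh r Hr. set (k := rate al).
  assert (Hk : 0 < k) by (unfold k, rate; pose proof (Rabs_pos al); lra).
  assert (Hkern : forall s, 0 < s -> Rabs (kern n al h1 s - kern n al h2 s) <=
            s * k * D * exp (k * s ^ 2)).
  { intros s Hs. unfold kern. rewrite <- Rmult_minus_distr_l, Rabs_mult, (Rabs_right s) by lra.
    rewrite !Rmult_assoc. apply Rmult_le_compat_l; [lra|].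
    set (e := D * exp (k * s ^ 2)).
    assert (A1 : Rabs (bpl (h1 s) - bpl (h2 s)) <= 2 * e).
    { eapply Rle_trans; [apply bpl_lipschitz|]. specialize (Hh s ltac:(lra)). unfold e, k. lra. }
    assert (A2 : Rabs (avg n (fun t => bpl (h1 t)) s - avg n (fun t => bpl (h2 t)) s) <= 2 * e).
    { apply avg_diff; try (intros x; apply continuity_bpl; auto).
      intros tau Ht. eapply Rle_trans; [apply bpl_lipschitz|].
      assert (0 <= s * tau) by (apply Rmult_le_pos; lra).
      specialize (Hh (s * tau) H). apply Rmult_le_compat_l; [lra|].
      eapply Rle_trans; [exact Hh|]. unfold e. apply Rmult_le_compat_l; [exact HD|].
      apply exp_nondecreasing. apply Rmult_le_compat_l; [lra|]. apply pow_incr. nra. }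
    replace (bpl (h1 s) + al * avg n (fun t => bpl (h1 t)) s -
             (bpl (h2 s) + al * avg n (fun t => bpl (h2 t)) s))
      with ((bpl (h1 s) - bpl (h2 s)) +
            al * (avg n (fun t => bpl (h1 t)) s - avg n (fun t => bpl (h2 t)) s)) by ring.
    eapply Rle_trans; [apply Rabs_triang|]. rewrite Rabs_mult.
    pose proof (Rabs_pos al).
    assert (Rabs al * Rabs (avg n (fun t => bpl (h1 t)) s - avg n (fun t => bpl (h2 t)) s)
              <= Rabs al * (2 * e)) by (apply Rmult_le_compat_l; assumption).
    unfold k, rate in *. lra. }
  assert (He1 : 1 <= exp (k * r ^ 2)).
  { apply exp_ge_1, Rmult_le_pos; [lra|apply pow2_ge_0]. }
  set (B := fun z => D / 4 * exp (k * z ^ 2)).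
  assert (Bd : forall z, is_derive B z (D / 2 * k * z * exp (k * z ^ 2))).
  { intros z. unfold B. auto_derive; [exact I|]. simpl. field. }
  assert (Main : forall s1 s2 : R -> R,
    (forall x, continuity_pt s1 x) -> (forall x, continuity_pt s2 x) ->
    (forall s, 0 < s -> Rabs (kern n al s1 s - kern n al s2 s) <= s * k * D * exp (k * s ^ 2)) ->
    picard_map n al y0 s1 r - picard_map n al y0 s2 r <= D / 2 * exp (k * r ^ 2)).
  { intros s1 s2 C1 C2 Hs.
    assert (A : B 0 - (picard_map n al y0 s1 0 - picard_map n al y0 s2 0) <=
                B r - (picard_map n al y0 s1 r - picard_map n al y0 s2 r)).
    { apply (nondecreasing_deriv
        (fun z => B z - (picard_map n al y0 s1 z - picard_map n al y0 s2 z))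
        (fun z => D / 2 * k * z * exp (k * z ^ 2) -
          (- / 2 * kern n al s1 z - - / 2 * kern n al s2 z))); [exact Hr| | |].
      - intros z _. apply continuity_pt_minus; [eapply is_derive_continuity, Bd|].
        apply continuity_pt_minus; apply picard_map_continuity; assumption.
      - intros z Hz. apply is_derive_minus_R; [apply Bd|].
        apply is_derive_minus_R; apply picard_map_derive; try assumption; lra.
      - intros z Hz. specialize (Hs z ltac:(lra)). apply Rabs_le_between in Hs. lra. }
    rewrite !picard_map_nonpos in A by lra. unfold B in A.
    replace (k * 0 ^ 2) with 0 in A by ring. rewrite exp_0 in A.
    assert (D * 1 <= D * exp (k * r ^ 2)) by (apply Rmult_le_compat_l; lra). lra. }
  apply Rabs_le. split.
  - assert (picard_map n al y0 h2 r - picard_map n al y0 h1 r <= D / 2 * exp (k * r ^ 2)); [|lra].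
    apply Main; try assumption. intros s Hs. rewrite Rabs_minus_sym. apply Hkern, Hs.
  - apply Main; assumption.
Qed.

Fixpoint picard (n : nat) (al y0 : R) (j : nat) : R -> R :=
  match j with
  | O => fun _ => 0
  | S j => picard_map n al y0 (picard n al y0 j)
  end.

Lemma picard_continuity n al y0 j x : continuity_pt (picard n al y0 j) x.
Proof.
  revert x. induction j as [|j IH]; intros x; simpl.
  - apply continuity_const.
  - apply picard_map_continuity, IH.
Qed.

Lemma picard_step n al y0 j r :
  0 <= r ->
  Rabs (picard n al y0 (S j) r - picard n al y0 j r) <=
    Rabs y0 / 2 ^ j * exp (rate al * r ^ 2).
Proof.
  revert r. induction j as [|j IH]; intros r Hr.
  - simpl picard. unfold picard_map.
    assert (E : forall z, kern n al (fun _ => 0) z = 0).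
    { intros z. unfold kern, avg. rewrite bpl_0.
      rewrite (RInt_ext _ (fun _ => 0)) by (intros; apply Rmult_0_r).
      rewrite RInt_const. unfold scal; simpl; unfold mult; simpl. ring. }
    rewrite (RInt_ext _ (fun _ => 0)) by (intros; apply E).
    rewrite RInt_const. unfold scal; simpl; unfold mult; simpl.
    replace (y0 - / 2 * ((Rmax 0 r - 0) * 0) - 0) with y0 by ring.
    assert (1 <= exp (rate al * (r * (r * 1)))).
    { apply exp_ge_1. unfold rate. pose proof (Rabs_pos al).
      apply Rmult_le_pos; [lra|]. rewrite Rmult_1_r. apply Rmult_le_pos; lra. }
    pose proof (Rabs_pos y0).
    assert (Rabs y0 * 1 <= Rabs y0 * exp (rate al * (r * (r * 1))))
      by (apply Rmult_le_compat_l; lra). lra.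
  - replace (Rabs y0 / 2 ^ S j) with (Rabs y0 / 2 ^ j / 2)
      by (simpl; field; apply pow_nonzero; lra).
    apply (picard_map_contraction n al y0 (picard n al y0 (S j)) (picard n al y0 j));
      try (intros; apply picard_continuity).
    + apply Rdiv_le_0_compat; [apply Rabs_pos|apply pow_lt; lra].
    + exact IH.
    + exact Hr.
Qed.

Lemma picard_cauchy n al y0 i j r :
  0 <= r ->
  Rabs (picard n al y0 (j + i) r - picard n al y0 j r) <=
    2 * Rabs y0 / 2 ^ j * exp (rate al * r ^ 2).
Proof.
  intros Hr. set (e := exp (rate al * r ^ 2)).
  assert (He : 0 < e) by apply exp_pos. pose proof (Rabs_pos y0).
  assert (H2 : forall j, 0 < 2 ^ j) by (intros; apply pow_lt; lra).
  assert (A : Rabs (picard n al y0 (j + i) r - picard n al y0 j r) <=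
    (2 * Rabs y0 / 2 ^ j - 2 * Rabs y0 / 2 ^ (j + i)) * e).
  { induction i as [|i IH].
    - rewrite Nat.add_0_r, !Rminus_diag, Rabs_R0. lra.
    - rewrite Nat.add_succ_r.
      pose proof (picard_step n al y0 (j + i) r Hr) as Hs. fold e in Hs.
      replace (picard n al y0 (S (j + i)) r - picard n al y0 j r) with
        ((picard n al y0 (S (j + i)) r - picard n al y0 (j + i) r) +
         (picard n al y0 (j + i) r - picard n al y0 j r)) by ring.
      eapply Rle_trans; [apply Rabs_triang|].
      replace (2 * Rabs y0 / 2 ^ S (j + i)) with (Rabs y0 / 2 ^ (j + i)).
      + specialize (H2 (j + i)%nat). lra.
      + simpl. field. apply pow_nonzero. lra. }
  eapply Rle_trans; [exact A|]. apply Rmult_le_compat_r; [lra|].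
  assert (0 <= 2 * Rabs y0 / 2 ^ (j + i)); [|lra].
  apply Rdiv_le_0_compat; [lra|apply H2].
Qed.

Definition prof (n : nat) (al y0 r : R) : R :=
  real (Lim_seq (fun j => picard n al y0 j (Rmax 0 r))).

Lemma small_pow2 (A eps : R) : 0 <= A -> 0 < eps -> exists j, A / 2 ^ j < eps.
Proof.
  intros HA He.
  destruct (pow_lt_1_zero (/ 2)) with (y := eps / (A + 1)) as [j Hj].
  - rewrite Rabs_right; lra.
  - apply Rdiv_lt_0_compat; lra.
  - exists j. specialize (Hj j (le_n j)). rewrite Rabs_right in Hj by (apply Rle_ge, pow_le; lra).
    rewrite pow_inv in Hj.
    assert (0 < 2 ^ j) by (apply pow_lt; lra).
    assert (0 < / 2 ^ j) by (apply Rinv_0_lt_compat; assumption).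
    apply Rle_lt_trans with ((A + 1) * / 2 ^ j); [unfold Rdiv; nra|].
    apply Rmult_lt_compat_l with (r := A + 1) in Hj; [|lra].
    replace ((A + 1) * (eps / (A + 1))) with eps in Hj by (field; lra). exact Hj.
Qed.

Lemma prof_approx n al y0 j r :
  0 <= r ->
  Rabs (prof n al y0 r - picard n al y0 j r) <=
    2 * Rabs y0 / 2 ^ j * exp (rate al * r ^ 2).
Proof.
  intros Hr. unfold prof. rewrite Rmax_right by exact Hr.
  set (u := fun j => picard n al y0 j r).
  assert (Hu : ex_finite_lim_seq u).
  { apply ex_lim_seq_cauchy_corr. intros eps.
    destruct (small_pow2 (2 * (2 * Rabs y0) * exp (rate al * r ^ 2)) eps) as [N HN].
    - pose proof (Rabs_pos y0). pose proof (exp_pos (rate al * r ^ 2)). nra.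
    - apply cond_pos.
    - exists N. intros p q Hp Hq.
      pose proof (picard_cauchy n al y0 (p - N) N r Hr) as Ap.
      pose proof (picard_cauchy n al y0 (q - N) N r Hr) as Aq.
      replace (N + (p - N))%nat with p in Ap by lia.
      replace (N + (q - N))%nat with q in Aq by lia.
      eapply Rle_lt_trans; [|exact HN]. unfold u.
      replace (picard n al y0 p r - picard n al y0 q r) with
        ((picard n al y0 p r - picard n al y0 N r) - (picard n al y0 q r - picard n al y0 N r))
        by ring.
      eapply Rle_trans; [apply Rabs_triang|]. rewrite Rabs_Ropp.
      eapply Rle_trans; [apply Rplus_le_compat; [exact Ap|exact Aq]|].
      right. field. apply pow_nonzero. lra. }
  apply Lim_seq_correct' in Hu.
  assert (Hv : is_lim_seq (fun i => Rabs (u (i + j)%nat - picard n al y0 j r))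
                 (Rabs (real (Lim_seq u) - picard n al y0 j r))).
  { apply (is_lim_seq_abs _ (Finite _)). apply is_lim_seq_minus'.
    - apply (is_lim_seq_incr_n u j). exact Hu.
    - apply is_lim_seq_const. }
  apply (is_lim_seq_le _ (fun _ => 2 * Rabs y0 / 2 ^ j * exp (rate al * r ^ 2)) _
           (Finite (2 * Rabs y0 / 2 ^ j * exp (rate al * r ^ 2)))) in Hv; [exact Hv| |].
  - intros i. unfold u. rewrite (Nat.add_comm i j). apply picard_cauchy, Hr.
  - apply is_lim_seq_const.
Qed.

Lemma prof_continuity n al y0 r : continuity_pt (prof n al y0) r.
Proof.
  set (M := Rabs r + 1).
  assert (HM : 0 < M) by (unfold M; pose proof (Rabs_pos r); lra).
  apply (CVU_continuity (fun j z => picard n al y0 j (Rmax 0 z)) _ 0 (mkposreal M HM)).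
  - intros eps He. pose proof (Rabs_pos y0). pose proof (exp_pos (rate al * M ^ 2)).
    destruct (small_pow2 (2 * Rabs y0 * exp (rate al * M ^ 2)) eps) as [N HN]; [nra|exact He|].
    exists N. intros j z Hj Hz. unfold Boule in Hz. rewrite Rminus_0_r in Hz. simpl in Hz.
    assert (E : prof n al y0 z = prof n al y0 (Rmax 0 z))
      by (unfold prof; rewrite (Rmax_right 0 (Rmax 0 z)); [reflexivity|apply Rmax_l]).
    rewrite E. eapply Rle_lt_trans; [apply prof_approx, Rmax_l|].
    eapply Rle_lt_trans; [|exact HN].
    assert (H2 : / 2 ^ j <= / 2 ^ N)
      by (apply Rinv_le_contravar; [apply pow_lt; lra|apply Rle_pow; [lra|exact Hj]]).
    assert (H3 : exp (rate al * Rmax 0 z ^ 2) <= exp (rate al * M ^ 2)).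
    { apply exp_nondecreasing, Rmult_le_compat_l.
      - unfold rate; pose proof (Rabs_pos al); lra.
      - apply pow_incr. split; [apply Rmax_l|]. pose proof (Rle_abs z). apply Rmax_lub; lra. }
    assert (0 < / 2 ^ j) by (apply Rinv_0_lt_compat, pow_lt; lra).
    unfold Rdiv. rewrite !Rmult_assoc, (Rmult_comm (exp _) (/ _)), <- !Rmult_assoc.
    pose proof (exp_pos (rate al * Rmax 0 z ^ 2)).
    apply Rmult_le_compat; try lra; [nra|]. apply Rmult_le_compat_l; lra.
  - intros j z _. apply (continuity_pt_comp (Rmax 0) (picard n al y0 j));
      [apply Rmax0_continuity|apply picard_continuity].
  - unfold Boule. simpl. rewrite Rminus_0_r. unfold M. lra.
Qed.

Lemma prof_fixed n al y0 r :
  0 <= r -> prof n al y0 r = picard_map n al y0 (prof n al y0) r.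
Proof.
  intros Hr. apply cond_eq. intros eps He.
  set (e := exp (rate al * r ^ 2)). assert (0 < e) by apply exp_pos.
  pose proof (Rabs_pos y0).
  destruct (small_pow2 (2 * (2 * Rabs y0) * e) eps) as [j Hj]; [nra|exact He|].
  assert (H2j : 0 < 2 ^ j) by (apply pow_lt; lra).
  pose proof (prof_approx n al y0 (S j) r Hr) as A. fold e in A. simpl picard in A.
  assert (B : Rabs (picard_map n al y0 (prof n al y0) r -
                    picard_map n al y0 (picard n al y0 j) r) <= 2 * Rabs y0 / 2 ^ j / 2 * e).
  { apply picard_map_contraction.
    - apply prof_continuity.
    - apply picard_continuity.
    - apply Rdiv_le_0_compat; lra.
    - intros t Ht. apply prof_approx, Ht.
    - exact Hr. }
  replace (2 * Rabs y0 / 2 ^ S j) with (2 * Rabs y0 / 2 ^ j / 2) in A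
    by (simpl; field; lra).
  eapply Rle_lt_trans; [|exact Hj].
  replace (prof n al y0 r - picard_map n al y0 (prof n al y0) r) with
    ((prof n al y0 r - picard_map n al y0 (picard n al y0 j) r) -
     (picard_map n al y0 (prof n al y0) r - picard_map n al y0 (picard n al y0 j) r)) by ring.
  eapply Rle_trans; [apply Rabs_triang|]. rewrite Rabs_Ropp.
  eapply Rle_trans; [apply Rplus_le_compat; [exact A|exact B]|].
  assert (0 <= 2 * Rabs y0 / 2 ^ j * e) by
    (apply Rmult_le_pos; [apply Rdiv_le_0_compat; lra|lra]).
  replace (2 * (2 * Rabs y0) * e / 2 ^ j) with (2 * (2 * Rabs y0 / 2 ^ j * e)) by (field; lra).
  lra.
Qed.

(** The quotient w / r, continuous up to r = 0; the singular term n w / r of the system is expressed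
    through it. *)
Definition momega (n : nat) (al y0 r : R) : R :=
  al * avg n (fun t => bpl (prof n al y0 t)) r.

Definition flux (n : nat) (al y0 r : R) : R := r * momega n al y0 r.

Lemma prof_0 n al y0 : prof n al y0 0 = y0.
Proof. rewrite prof_fixed by lra. apply picard_map_nonpos. lra. Qed.

Lemma momega_continuity n al y0 r : continuity_pt (momega n al y0) r.
Proof.
  apply continuity_pt_mult; [cont|].
  apply avg_continuity. intros x. apply continuity_bpl, prof_continuity.
Qed.

Lemma flux_continuity n al y0 r : continuity_pt (flux n al y0) r.
Proof. apply continuity_pt_mult; [cont|apply momega_continuity]. Qed.

Ltac cont_leaf ::=
  first [apply prof_continuity | apply momega_continuity | apply flux_continuity].

Lemma prof_sys n al y0 r :
  0 < r -> sys_at n (-1) al (prof n al y0) (flux n al y0) r.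
Proof.
  intros Hr. split.
  - apply is_derive_ext_loc with (picard_map n al y0 (prof n al y0)).
    + apply locally_pos; [exact Hr|]. intros y Hy. symmetry. apply prof_fixed. lra.
    + eapply is_derive_eq.
      * apply picard_map_derive; [apply prof_continuity|exact Hr].
      * unfold kern, flux, momega. field.
  - apply is_derive_ext with (fun z => al * (z * avg n (fun t => bpl (prof n al y0 t)) z)).
    + intros t. unfold flux, momega. match goal with |- ?x = ?y => change (@eq R x y) end. ring.
    + eapply is_derive_eq.
      * apply (is_derive_scal (fun z => z * avg n (fun t => bpl (prof n al y0 t)) z) r al).
        apply avg_derive; [|exact Hr]. intros x. apply continuity_bpl, prof_continuity.
      * unfold flux, momega. match goal with |- ?x = ?y => change (@eq R x y) end.
        unfold mult; simpl. ring.
Qed.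

(** * From the profile to the alpha-solution *)

Lemma lip_const M c : lip M (fun _ => c).
Proof. exists 0. intros. rewrite Rminus_diag, Rabs_R0. lra. Qed.

Lemma lip_id M : lip M (fun x => x).
Proof. exists 1. intros. lra. Qed.

Lemma lip_plus M f g : lip M f -> lip M g -> lip M (fun x => f x + g x).
Proof.
  intros [L1 H1] [L2 H2]. exists (L1 + L2). intros s s' Hs Hs'.
  replace (f s + g s - (f s' + g s')) with ((f s - f s') + (g s - g s')) by ring.
  eapply Rle_trans; [apply Rabs_triang|].
  specialize (H1 s s' Hs Hs'). specialize (H2 s s' Hs Hs'). lra.
Qed.

Lemma lip_bounded M f : 0 <= M -> lip M f -> exists B, 0 <= B /\ forall s, 0 <= s <= M -> Rabs (f s) <= B.
Proof.
  intros HM [L H]. exists (Rabs (f 0) + Rabs L * M). split.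
  - pose proof (Rabs_pos (f 0)). pose proof (Rabs_pos L). nra.
  - intros s Hs. specialize (H s 0 Hs ltac:(lra)).
    replace (f s) with (f 0 + (f s - f 0)) by ring.
    eapply Rle_trans; [apply Rabs_triang|]. apply Rplus_le_compat_l.
    eapply Rle_trans; [exact H|]. rewrite Rminus_0_r, (Rabs_right s) by lra.
    pose proof (Rle_abs L). pose proof (Rabs_pos L). nra.
Qed.

Lemma lip_mult M f g : lip M f -> lip M g -> lip M (fun x => f x * g x).
Proof.
  intros Hf Hg. destruct (Rle_lt_dec 0 M) as [HM|HM]; [|exists 0; intros; lra].
  destruct (lip_bounded M f HM Hf) as [Bf [Bf0 HBf]].
  destruct (lip_bounded M g HM Hg) as [Bg [Bg0 HBg]].
  destruct Hf as [L1 H1]. destruct Hg as [L2 H2].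
  exists (L1 * Bg + Bf * L2). intros s s' Hs Hs'.
  replace (f s * g s - f s' * g s') with ((f s - f s') * g s + f s' * (g s - g s')) by ring.
  eapply Rle_trans; [apply Rabs_triang|]. rewrite !Rabs_mult.
  specialize (H1 s s' Hs Hs'). specialize (H2 s s' Hs Hs').
  specialize (HBf s' Hs'). specialize (HBg s Hs).
  pose proof (Rabs_pos (f s - f s')). pose proof (Rabs_pos (g s - g s')).
  pose proof (Rabs_pos (g s)). pose proof (Rabs_pos (f s')).
  assert (Rabs (f s - f s') * Rabs (g s) <= L1 * Rabs (s - s') * Bg)
    by (apply Rmult_le_compat; assumption).
  assert (Rabs (f s') * Rabs (g s - g s') <= Bf * (L2 * Rabs (s - s')))
    by (apply Rmult_le_compat; assumption).
  lra.
Qed.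

Lemma lip_comp M f phi K :
  (forall x y, Rabs (phi x - phi y) <= K * Rabs (x - y)) -> 0 <= K ->
  lip M f -> lip M (fun x => phi (f x)).
Proof.
  intros Hphi HK [L H]. exists (K * L). intros s s' Hs Hs'.
  eapply Rle_trans; [apply Hphi|]. rewrite Rmult_assoc.
  apply Rmult_le_compat_l; [exact HK|]. apply H; assumption.
Qed.

Lemma lip_of_derive (f df : R -> R) :
  (forall x, continuity_pt f x) -> (forall x, continuity_pt df x) ->
  (forall x, 0 < x -> is_derive f x (df x)) -> forall M, lip M f.
Proof.
  intros Hf Hdf Hd M. destruct (Rle_lt_dec 0 M) as [HM|HM]; [|exists 0; intros; lra].
  destruct (continuity_ab_maj (fun x => Rabs (df x)) 0 M HM) as [m [Hm _]].
  { intros c _. apply (continuity_pt_comp df Rabs); [apply Hdf|apply Rcontinuity_abs]. }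
  exists (Rabs (df m)). intros s s' Hs Hs'.
  destruct (MVT_gen f s' s df) as [c [Hc E]].
  - intros x Hx. apply Hd. unfold Rmin in Hx. destruct (Rle_dec s' s); lra.
  - intros x _. apply Hf.
  - rewrite E, Rabs_mult. apply Rmult_le_compat_r; [apply Rabs_pos|]. apply Hm.
    unfold Rmin, Rmax in Hc. destruct (Rle_dec s' s); lra.
Qed.

Lemma C11_of_lip (f df : R -> R) :
  (forall r, continuity_pt f r) -> (forall r, 0 < r -> is_derive f r (df r)) ->
  (forall M, lip M df) -> C11_halfline f df.
Proof.
  intros Hf Hd Hl. split; [exact Hd|]. split; [|exact Hl].
  intros P [eps He].
  destruct (Hl 1) as [L HL]. set (K := Rabs L + 1).
  assert (HK : 0 < K) by (unfold K; pose proof (Rabs_pos L); lra).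
  assert (Hd0 : 0 < Rmin 1 (eps / K)).
  { apply Rmin_pos; [lra|]. apply Rdiv_lt_0_compat; [apply cond_pos|exact HK]. }
  apply locally_interval with (Rmin 1 (eps / K)); [exact Hd0|]. intros s Hs Hs0. apply He.
  pose proof (Rmin_l 1 (eps / K)). pose proof (Rmin_r 1 (eps / K)).
  destruct (MVT_gen f 0 s df) as [c [Hc E]].
  - rewrite Rmin_left by lra. intros x Hx. apply Hd; lra.
  - intros x _. apply Hf.
  - rewrite Rmin_left, Rmax_right in Hc by lra.
    unfold ball; simpl; unfold AbsRing_ball, abs, minus, plus, opp; simpl.
    replace ((f s - f 0) / s + - df 0) with (df c - df 0) by (rewrite E; field; lra).
    eapply Rle_lt_trans; [apply HL; lra|]. rewrite Rminus_0_r, (Rabs_right c) by lra.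
    apply Rle_lt_trans with (K * c).
    { apply Rmult_le_compat_r; [lra|]. unfold K. pose proof (Rle_abs L). lra. }
    replace (pos eps) with (K * (eps / K)) by (field; lra). apply Rmult_lt_compat_l; lra.
Qed.

Lemma nonzero_same_sign (f : R -> R) (a b : R) :
  continuity f -> a <= b -> (forall x, a <= x <= b -> f x <> 0) -> 0 < f a * f b.
Proof.
  intros Hc Hab Hn.
  destruct (Rlt_le_dec 0 (f a * f b)) as [|Hneg]; [assumption|exfalso].
  assert (f a <> 0) by (apply Hn; lra). assert (f b <> 0) by (apply Hn; lra).
  destruct (IVT_gen f a b 0 Hc) as [x [Hx E]].
  - unfold Rmin, Rmax. destruct (Rle_dec (f a) (f b)); nra.
  - rewrite Rmin_left, Rmax_right in Hx by exact Hab. exact (Hn x Hx E).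
Qed.

Definition dprof (n : nat) (al y0 r : R) : R :=
  - / 2 * (r * bpl (prof n al y0 r) + flux n al y0 r).

Lemma flux_lip n al y0 M : lip M (flux n al y0).
Proof.
  apply lip_of_derive with (fun r => al * bpl (prof n al y0 r) - INR n * momega n al y0 r).
  - intros x. cont.
  - intros x. cont.
  - intros x Hx. eapply is_derive_eq; [exact (proj2 (prof_sys n al y0 x Hx))|].
    unfold flux. field. lra.
Qed.

Lemma dprof_continuity n al y0 r : continuity_pt (dprof n al y0) r.
Proof. unfold dprof. cont. Qed.

Lemma prof_derive n al y0 r : 0 < r -> is_derive (prof n al y0) r (dprof n al y0 r).
Proof.
  intros Hr. eapply is_derive_eq; [exact (proj1 (prof_sys n al y0 r Hr))|]. unfold dprof. field.
Qed.

Lemma prof_lip n al y0 M : lip M (prof n al y0).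
Proof.
  apply lip_of_derive with (dprof n al y0).
  - apply prof_continuity.
  - apply dprof_continuity.
  - apply prof_derive.
Qed.

Lemma prof_sol_def n al y0 :
  y0 <> 0 -> sol_def n (-1) (INR n + 1 + al) (prof n al y0) (dprof n al y0).
Proof.
  intros Hy0. split; [|split; [|split]].
  - apply C11_of_lip.
    + apply prof_continuity.
    + apply prof_derive.
    + intros M. apply lip_mult; [apply lip_const|]. apply lip_plus; [|apply flux_lip].
      apply lip_mult; [apply lip_id|].
      apply (lip_comp M _ bpl 2 bpl_lipschitz); [lra|apply prof_lip].
  - rewrite prof_0. exact Hy0.
  - unfold dprof, flux. ring.
  - intros r Hr Hn.
    exists (- / 2 * ((bpl (prof n al y0 r) + r * (2 * cof (prof n al y0 r) * dprof n al y0 r)) +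
              (al * bpl (prof n al y0 r) - INR n / r * flux n al y0 r))). split.
    + apply (is_derive_scal _ r (- / 2)). apply is_derive_plus_R; [|exact (proj2 (prof_sys n al y0 r Hr))].
      eapply is_derive_eq.
      * apply is_derive_mult_R; [apply (is_derive_id r)|].
        apply is_derive_bpl; [apply prof_derive, Hr|exact Hn].
      * unfold one; simpl. ring.
    + unfold dprof. rewrite bpl_cof. field. lra.
Qed.

Lemma is_derive_exp_comp (f : R -> R) (r l : R) :
  is_derive f r l -> is_derive (fun z => exp (f z)) r (l * exp (f r)).
Proof. intros H. apply (is_derive_comp_R exp f); [apply is_derive_exp|exact H]. Qed.

(** The difference quotient is f (r + t) / t * h (r + t), so a merely continuous h suffices at a
    zero of f. It serves at the zeros of g, with h = e^E. *)
Lemma is_derive_mult_at_zero (f h : R -> R) (r l : R) :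
  is_derive f r l -> f r = 0 -> continuity_pt h r -> is_derive (fun z => f z * h z) r (l * h r).
Proof.
  intros Hf E Hh. apply is_derive_Reals. apply is_derive_Reals in Hf.
  assert (L : limit1_in (fun t => f (r + t) / t * h (r + t)) (fun t => t <> 0) (l * h r) 0).
  { apply limit_mul; intros eps He.
    - destruct (Hf eps He) as [d Hd]. exists d. split; [apply cond_pos|].
      intros t [Ht Htd]. simpl in Htd. unfold Rdist in Htd. rewrite Rminus_0_r in Htd.
      specialize (Hd t Ht Htd). rewrite E, Rminus_0_r in Hd. exact Hd.
    - destruct (Hh eps He) as [d [Hd H]]. exists d. split; [exact Hd|].
      intros t [Ht Htd]. apply H. split; [split; [exact I|lra]|].
      simpl in *. unfold Rdist in *. replace (r + t - r) with (t - 0) by ring. exact Htd. }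
  intros eps He. destruct (L eps He) as [d [Hd H]]. exists (mkposreal d Hd). intros t Ht Htd.
  rewrite E. replace ((f (r + t) * h (r + t) - 0 * h r) / t) with (f (r + t) / t * h (r + t))
    by (field; exact Ht).
  apply (H t). split; [exact Ht|]. simpl. unfold Rdist. rewrite Rminus_0_r. exact Htd.
Qed.

Section Growth.

Variables (n : nat) (al y0 : R).
Hypothesis Hy0 : y0 <> 0.

Let g := prof n al y0.
Let dg := dprof n al y0.
Let w := flux n al y0.

Lemma prof_nondegenerate r : 0 <= r -> g r <> 0 \/ dg r <> 0.
Proof.
  intros Hr. destruct (Req_dec r 0) as [->|Hne].
  - left. unfold g. rewrite prof_0. exact Hy0.
  - destruct (no_double_zero n (-1) (INR n + 1 + al) g dg ltac:(ring)
      (prof_sol_def n al y0 Hy0) r ltac:(lra) r); [lra|lra|assumption].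
Qed.

Lemma prof_punctured r :
  0 <= r -> exists d, 0 < d /\
    forall z, 0 <= z -> r - d < z < r + d -> z <> r -> g z <> 0.
Proof.
  intros Hr. destruct (Req_dec r 0) as [->|Hne].
  - destruct (nonzero_near_0 n (-1) (INR n + 1 + al) g dg (prof_sol_def n al y0 Hy0)) as [d [Hd H]].
    exists d. split; [exact Hd|]. intros z Hz Hzd _. apply H. lra.
  - destruct (punctured_nonzero n (-1) (INR n + 1 + al) g dg
      (prof_sol_def n al y0 Hy0) r) as [d [Hd H]]; [lra|apply prof_nondegenerate, Hr|].
    exists d. split; [exact Hd|]. intros z _ Hz Hzn. apply (H z Hz Hzn).
Qed.

Let k := fun s => s * cof (g s).

Lemma k_ex_RInt_cell a b :
  a <= b -> (forall z, a < z < b -> g z <> 0) -> ex_RInt k a b.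
Proof.
  intros Hab Hz. set (c := cof (g ((a + b) / 2))).
  apply ex_RInt_ext with (fun s => s * c).
  - rewrite Rmin_left, Rmax_right by exact Hab. intros x Hx. unfold k, c. f_equal.
    apply cof_same_sign.
    destruct (Rle_lt_dec ((a + b) / 2) x).
    + apply (nonzero_same_sign g); [intros t; apply prof_continuity|lra|].
      intros t Ht. apply Hz. lra.
    + rewrite Rmult_comm. apply (nonzero_same_sign g); [intros t; apply prof_continuity|lra|].
      intros t Ht. apply Hz. lra.
  - apply ex_RInt_continuity. intros x. cont.
Qed.

(** The integrand jumps at zeros of g; real induction adds one interval free of zeros at a time. *)
Lemma k_ex_RInt_0 T : 0 <= T -> ex_RInt k 0 T.
Proof.
  intros HT. apply (real_induction (fun x => ex_RInt k 0 x) 0 T); try lra.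
  - apply ex_RInt_point.
  - intros x Hx HQ. destruct (prof_punctured x ltac:(lra)) as [d [Hd H]].
    exists d. split; [exact Hd|]. intros y Hy _. apply ex_RInt_Chasles with x; [exact HQ|].
    apply k_ex_RInt_cell; [lra|]. intros z Hz. apply H; lra.
  - intros x Hx HQ. destruct (prof_punctured x ltac:(lra)) as [d [Hd H]].
    destruct (point_between_left 0 x d) as [a [Ha Had]]; [lra|exact Hd|].
    apply ex_RInt_Chasles with a; [apply HQ; lra|].
    apply k_ex_RInt_cell; [lra|]. intros z Hz. apply H; lra.
Qed.

Lemma k_ex_RInt a b : 0 <= a -> 0 <= b -> ex_RInt k a b.
Proof.
  intros Ha Hb. apply ex_RInt_Chasles with 0; [apply (ex_RInt_swap k)|]; apply k_ex_RInt_0; assumption.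
Qed.

(* The function E of the header. Its kinks sit at zeros of [g], so [e^E g] is still
   differentiable there. *)
Definition expo (r : R) : R := RInt k 0 (Rmax 0 r).

Lemma expo_diff a b : 0 <= a -> 0 <= b -> expo b - expo a = RInt k a b.
Proof.
  intros Ha Hb. unfold expo. rewrite !Rmax_right by assumption.
  pose proof (RInt_Chasles k 0 a b (k_ex_RInt 0 a ltac:(lra) Ha) (k_ex_RInt a b Ha Hb)) as E.
  unfold plus in E; simpl in E. lra.
Qed.

Lemma expo_lip M : lip M expo.
Proof.
  exists M.
  assert (H : forall s s', 0 <= s <= M -> 0 <= s' <= M -> s <= s' ->
    Rabs (expo s' - expo s) <= M * Rabs (s' - s)).
  { intros s s' Hs Hs' Hss. rewrite expo_diff by lra.
    rewrite (Rabs_right (s' - s)), Rmult_comm by lra.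
    apply abs_RInt_le_const; [exact Hss|apply k_ex_RInt; lra|].
    intros t Ht. unfold k. rewrite Rabs_mult. pose proof (cof_bounds (g t)).
    rewrite (Rabs_right t), (Rabs_right (cof (g t))) by lra. nra. }
  intros s s' Hs Hs'. destruct (Rle_lt_dec s s').
  - rewrite Rabs_minus_sym, (Rabs_minus_sym s s'). apply H; assumption.
  - apply H; lra.
Qed.

Lemma expo_continuity r : continuity_pt expo r.
Proof.
  apply continuity_pt_ext with (clamp expo).
  - intros t. unfold clamp, expo. rewrite (Rmax_right 0 (Rmax 0 t)); [reflexivity|apply Rmax_l].
  - apply lip_clamp_continuity, expo_lip.
Qed.

Lemma expo_cell a r :
  0 <= a <= r -> (forall z, a < z < r -> cof (g z) = cof (g r)) ->
  expo r = expo a + cof (g r) * (r ^ 2 - a ^ 2) / 2.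
Proof.
  intros Har H. pose proof (expo_diff a r ltac:(lra) ltac:(lra)) as E.
  assert (A : RInt k a r = cof (g r) * (r ^ 2 - a ^ 2) / 2).
  { apply is_RInt_unique. apply is_RInt_ext with (fun s => s * cof (g r)).
    - rewrite Rmin_left, Rmax_right by lra. intros x Hx. unfold k. rewrite (H x) by lra. reflexivity.
    - replace (cof (g r) * (r ^ 2 - a ^ 2) / 2) with
        (minus (cof (g r) * r ^ 2 / 2) (cof (g r) * a ^ 2 / 2)).
      + apply (is_RInt_derive (fun s => cof (g r) * s ^ 2 / 2) (fun s => s * cof (g r))).
        * intros x _. auto_derive; [exact I|]. simpl. field.
        * intros x _. apply continuity_pt_filterlim. cont.
      + unfold minus, plus, opp; simpl. field. }
  lra.
Qed.

Lemma expo_derive r : 0 < r -> g r <> 0 -> is_derive expo r (cof (g r) * r).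
Proof.
  intros Hr Hn.
  destruct (continuity_nonzero_local g r (prof_continuity n al y0 r) Hn) as [d [Hd H]].
  destruct (point_between_left 0 r d) as [a [Ha Had]]; [lra|exact Hd|].
  apply is_derive_ext_loc with (fun z => expo a + cof (g r) * (z ^ 2 - a ^ 2) / 2).
  - apply locally_interval with (r - a); [lra|]. intros z Hz.
    assert (S : forall t, a < t < r + d -> cof (g r) = cof (g t))
      by (intros t Ht; apply cof_same_sign, H; lra).
    rewrite (S z) by lra. symmetry. apply expo_cell; [lra|].
    intros t Ht. transitivity (cof (g r)); [symmetry|]; apply S; lra.
  - auto_derive; [exact I|]. simpl. field.
Qed.

Definition asol (r : R) : R := g r * exp (expo r).
Definition dasol (r : R) : R := - / 2 * (exp (expo r) * w r).

Lemma asol_derive r : 0 < r -> is_derive asol r (dasol r).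
Proof.
  intros Hr. pose proof (prof_derive n al y0 r Hr) as Hg. fold g in Hg.
  destruct (Req_dec (g r) 0) as [E|Hn].
  - eapply is_derive_eq.
    + apply is_derive_mult_at_zero; [exact Hg|exact E|].
      apply continuity_exp, expo_continuity.
    + unfold dasol, dprof, w. fold g. rewrite E, bpl_0. ring.
  - eapply is_derive_eq.
    + apply is_derive_mult_R; [exact Hg|].
      apply is_derive_exp_comp, expo_derive; assumption.
    + unfold dasol, dprof, w. fold g. rewrite bpl_cof. field.
Qed.

Lemma exp_expo_lip M : lip M (fun r => exp (expo r)).
Proof.
  destruct (Rle_lt_dec 0 M) as [HM|HM]; [|exists 0; intros; lra].
  destruct (lip_bounded M expo HM (expo_lip M)) as [B [HB HbB]].
  destruct (expo_lip M) as [L HL].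
  assert (H : forall x y, y <= B -> x <= y -> exp y - exp x <= exp B * (y - x)).
  { intros x y Hy Hxy.
    assert (exp y * (1 + (x - y)) <= exp y * exp (x - y))
      by (apply Rmult_le_compat_l; [left; apply exp_pos|apply exp_ineq1_le]).
    rewrite <- exp_plus in H. replace (y + (x - y)) with x in H by ring.
    assert (exp y * (y - x) <= exp B * (y - x))
      by (apply Rmult_le_compat_r; [lra|apply exp_nondecreasing, Hy]). lra. }
  exists (exp B * L). intros s s' Hs Hs'. pose proof (exp_pos B).
  specialize (HL s s' Hs Hs').
  pose proof (HbB s Hs) as B1. pose proof (HbB s' Hs') as B2.
  apply Rabs_le_between in B1. apply Rabs_le_between in B2.
  apply Rle_trans with (exp B * Rabs (expo s - expo s')).
  - destruct (Rle_lt_dec (expo s) (expo s')).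
    + rewrite Rabs_minus_sym, (Rabs_minus_sym (expo s)).
      pose proof (exp_nondecreasing _ _ r).
      rewrite !Rabs_right by lra. apply H; lra.
    + pose proof (exp_nondecreasing (expo s') (expo s) ltac:(lra)).
      rewrite !Rabs_right by lra. apply H; lra.
  - rewrite Rmult_assoc. apply Rmult_le_compat_l; lra.
Qed.

(** Since - 2 f' = e^E w, the derivative f' is Lipschitz on bounded intervals even across zeros, and
    off the zeros f'' is read off from E' and the equation of w. *)
Lemma asol_sol_def : sol_def n 1 (- al) asol dasol.
Proof.
  split; [|split; [|split]].
  - apply C11_of_lip.
    + intros r. pose proof (expo_continuity r). unfold asol, g. cont.
    + apply asol_derive.
    + intros M. apply lip_mult; [apply lip_const|].
      apply lip_mult; [apply exp_expo_lip|apply flux_lip].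
  - unfold asol, g. rewrite prof_0. pose proof (exp_pos (expo 0)).
    apply Rmult_integral_contrapositive_currified; lra.
  - unfold dasol, w, flux. ring.
  - intros r Hr Hn.
    assert (Hgn : g r <> 0) by (intros E; apply Hn; unfold asol; rewrite E; ring).
    assert (Ec : cof (asol r) = cof (g r)).
    { apply cof_same_sign. unfold asol. pose proof (exp_pos (expo r)).
      replace (g r * exp (expo r) * g r) with (exp (expo r) * (g r) ^ 2) by ring.
      apply Rmult_lt_0_compat; [assumption|]. apply pow2_gt_0, Hgn. }
    rewrite Ec.
    exists (- / 2 * ((cof (g r) * r * exp (expo r)) * w r +
              exp (expo r) * (al * bpl (g r) - INR n / r * w r))). split.
    + apply (is_derive_scal (fun z => exp (expo z) * w z) r (- / 2)).
      apply (is_derive_mult_R (fun z => exp (expo z)) w).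
      * apply is_derive_exp_comp, expo_derive; assumption.
      * exact (proj2 (prof_sys n al y0 r Hr)).
    + unfold dasol, asol. rewrite bpl_cof. field. lra.
Qed.

Lemma asol_0 : asol 0 = y0.
Proof.
  unfold asol, expo, g. rewrite prof_0, Rmax_left, RInt_point by lra.
  unfold zero; simpl. rewrite exp_0. ring.
Qed.

End Growth.

(** * The phase *)

(* The equation of the polar angle of (g, w). *)
Definition phase_rhs (n : nat) (al r t : R) : R :=
  al * (cos t * bpl (cos t)) - INR n / r * (cos t * sin t) +
  r / 2 * (sin t * bpl (cos t)) + / 2 * sin t ^ 2.

Definition phase_at (n : nat) (al : R) (th : R -> R) (r : R) : Prop :=
  is_derive th r (phase_rhs n al r (th r)).

Definition th0 (s : bool) : R := if s then 0 else PI.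

Lemma cos_th0 s : cos (th0 s) = sgn_val s.
Proof. destruct s; [apply cos_0|apply cos_PI]. Qed.

Lemma sin_th0 s : sin (th0 s) = 0.
Proof. destruct s; [apply sin_0|apply sin_PI]. Qed.

Lemma sgn_val_neq_0 s : sgn_val s <> 0.
Proof. destruct s; simpl; lra. Qed.

Lemma sgn_val_sqr s : sgn_val s * sgn_val s = 1.
Proof. destruct s; simpl; ring. Qed.

Section Phase.

Variables (n : nat) (al : R) (s : bool).

Let g := prof n al (sgn_val s).
Let dg := dprof n al (sgn_val s).
Let w := flux n al (sgn_val s).
Let dw := fun r => al * bpl (g r) - INR n * momega n al (sgn_val s) r.
Let rate2 := fun r => g r ^ 2 + w r ^ 2.

(** The angle is obtained by integrating (g w' - w g') / (g^2 + w^2) rather than by following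
    branches of an arctangent; [momega] inside [dw] keeps the integrand continuous at 0. *)
Definition phase_speed (r : R) : R := (g r * dw r - w r * dg r) / rate2 r.

Definition phase (r : R) : R := th0 s + RInt phase_speed 0 r.

Lemma prof_neg r : r <= 0 -> g r = sgn_val s.
Proof.
  intros Hr. unfold g, prof. rewrite Rmax_left by exact Hr.
  transitivity (prof n al (sgn_val s) 0); [|apply prof_0].
  unfold prof. rewrite Rmax_left by lra. reflexivity.
Qed.

Lemma rate2_pos r : 0 < rate2 r.
Proof.
  unfold rate2. pose proof (pow2_ge_0 (g r)). pose proof (pow2_ge_0 (w r)).
  destruct (Req_dec (g r) 0) as [E|Hn]; [|pose proof (pow2_gt_0 _ Hn); lra].
  destruct (Req_dec (w r) 0) as [E'|Hn]; [|pose proof (pow2_gt_0 _ Hn); lra].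
  exfalso. destruct (Rle_lt_dec r 0) as [Hr|Hr].
  - rewrite prof_neg in E by exact Hr. exact (sgn_val_neq_0 s E).
  - destruct (prof_nondegenerate n al (sgn_val s) (sgn_val_neq_0 s) r) as [H1|H1];
      [lra|exact (H1 E)|]. apply H1.
    unfold dprof. fold g w. rewrite E, E', bpl_0. ring.
Qed.

Lemma rate2_continuity r : continuity_pt rate2 r.
Proof. unfold rate2, g, w. cont. Qed.

Lemma dw_continuity r : continuity_pt dw r.
Proof. unfold dw, g. cont. Qed.

Lemma w_derive r : 0 < r -> is_derive w r (dw r).
Proof.
  intros Hr. eapply is_derive_eq; [exact (proj2 (prof_sys n al _ r Hr))|].
  unfold dw, flux. fold g. field. lra.
Qed.

Lemma phase_speed_continuity r : continuity_pt phase_speed r.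
Proof.
  pose proof (rate2_pos r). pose proof (rate2_continuity r). pose proof (dw_continuity r).
  pose proof (dprof_continuity n al (sgn_val s) r : continuity_pt dg r).
  unfold phase_speed, g, w. cont. lra.
Qed.

Lemma phase_derive_speed r : is_derive phase r (phase_speed r).
Proof.
  eapply is_derive_eq.
  - apply is_derive_plus_R; [apply (is_derive_const (th0 s))|].
    apply is_derive_RInt_continuity, phase_speed_continuity.
  - apply Rplus_0_l.
Qed.

Lemma phase_continuity r : continuity_pt phase r.
Proof. eapply is_derive_continuity, phase_derive_speed. Qed.

Lemma phase_0 : phase 0 = th0 s.
Proof. unfold phase. rewrite RInt_point. apply Rplus_0_r. Qed.

(** Coordinates of (g, w) in the frame rotated by [phase], which is the polar angle exactly when Y =
    0 and X > 0. *)
Let X := fun r => g r * cos (phase r) + w r * sin (phase r).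
Let Y := fun r => w r * cos (phase r) - g r * sin (phase r).

Lemma XY_identities r :
  g r = X r * cos (phase r) - Y r * sin (phase r) /\
  w r = X r * sin (phase r) + Y r * cos (phase r) /\
  X r ^ 2 + Y r ^ 2 = rate2 r.
Proof.
  unfold X, Y, rate2. pose proof (sin2_cos2 (phase r)) as E. unfold Rsqr in E.
  set (c := cos (phase r)) in *. set (d := sin (phase r)) in *.
  repeat split.
  - transitivity (g r * (d * d + c * c)); [rewrite E; ring|ring].
  - transitivity (w r * (d * d + c * c)); [rewrite E; ring|ring].
  - transitivity ((g r ^ 2 + w r ^ 2) * (d * d + c * c)); [ring|rewrite E; ring].
Qed.

(** In complex notation X + i Y = (g + i w) exp (- i phase) has derivative m (X + i Y), where m is
    the logarithmic derivative of the radius. As Y starts at 0, Gronwall for Y^2 keeps it there. *)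
Lemma Y_zero r : 0 <= r -> Y r = 0.
Proof.
  intros Hr.
  set (m := fun x => (g x * dg x + w x * dw x) / rate2 x).
  assert (Hm : forall x, continuity_pt m x).
  { intros x. pose proof (rate2_pos x). pose proof (rate2_continuity x).
    pose proof (dw_continuity x). pose proof (dprof_continuity n al (sgn_val s) x : continuity_pt dg x).
    unfold m, g, w. cont. lra. }
  destruct (continuity_ab_maj m 0 r Hr) as [c [Hc _]]; [intros; apply Hm|].
  assert (HY0 : Y 0 = 0).
  { unfold Y. rewrite phase_0, sin_th0. unfold w, flux. ring. }
  assert (Hd : forall x, 0 < x -> is_derive (fun z => Y z ^ 2) x (2 * m x * Y x ^ 2)).
  { intros x Hx.
    assert (D : is_derive Y x (m x * Y x)).
    { eapply is_derive_eq.
      - apply is_derive_minus_R.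
        + apply (is_derive_mult_R w (fun z => cos (phase z))); [apply w_derive, Hx|].
          apply (is_derive_comp_R cos phase); [apply is_derive_cos|apply phase_derive_speed].
        + apply (is_derive_mult_R g (fun z => sin (phase z))); [apply prof_derive, Hx|].
          apply (is_derive_comp_R sin phase); [apply is_derive_sin|apply phase_derive_speed].
      - fold dg. unfold phase_speed, m, Y. pose proof (rate2_pos x) as Hp.
        unfold rate2 in Hp |- *. cbv beta. fold g. fold w. field. lra. }
    eapply is_derive_eq.
    - apply (is_derive_comp_R (fun t => t ^ 2) Y); [|exact D].
      apply is_derive_Reals, derivable_pt_lim_pow.
    - simpl. ring. }
  assert (A : Y r ^ 2 <= Y 0 ^ 2 * exp (2 * m c * (r - 0))).
  { apply (gronwall (fun z => Y z ^ 2) (fun x => 2 * m x * Y x ^ 2)); [exact Hr| | |].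
    - intros x _. pose proof (phase_continuity x). unfold Y, g, w. cont.
    - intros x Hx. apply Hd; lra.
    - intros x Hx. specialize (Hc x ltac:(lra)). pose proof (pow2_ge_0 (Y x)).
      apply Rmult_le_compat_r; lra. }
  rewrite HY0 in A. pose proof (pow2_ge_0 (Y r)).
  apply NNPP. intros Hn. apply (pow_nonzero _ 2) in Hn. lra.
Qed.

Lemma phase_polar r :
  0 <= r -> exists X, 0 < X /\ g r = X * cos (phase r) /\ w r = X * sin (phase r).
Proof.
  intros Hr.
  assert (HX : 0 < X r).
  { assert (H : 0 < X 0 * X r).
    { apply (nonzero_same_sign X); [|exact Hr|].
      - intros x. pose proof (phase_continuity x). unfold X, g, w. cont.
      - intros x Hx E. destruct (XY_identities x) as [_ [_ H]].
        rewrite Y_zero, E in H by lra. pose proof (rate2_pos x). lra. }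
    assert (E : X 0 = 1).
    { unfold X. rewrite phase_0, cos_th0, sin_th0, prof_neg, sgn_val_sqr by lra. ring. }
    rewrite E in H. lra. }
  exists (X r). split; [exact HX|].
  destruct (XY_identities r) as [E1 [E2 _]]. rewrite Y_zero in E1, E2 by exact Hr. lra.
Qed.

Lemma phase_ode r : 0 < r -> phase_at n al phase r.
Proof.
  intros Hr. eapply is_derive_eq; [apply phase_derive_speed|].
  destruct (phase_polar r ltac:(lra)) as [x [Hx [Eg Ew]]].
  assert (Em : momega n al (sgn_val s) r = w r / r) by (unfold w, flux; field; lra).
  unfold phase_speed, dw, dg, dprof, rate2, phase_rhs. fold g. fold w.
  rewrite Em, Eg, Ew, bpl_scale by lra.
  set (c := cos (phase r)). set (d := sin (phase r)).
  assert (E : d * d + c * c = 1) by apply sin2_cos2.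
  replace ((x * c) ^ 2 + (x * d) ^ 2) with (x ^ 2 * (d * d + c * c)) by ring. rewrite E.
  field. lra.
Qed.

Lemma prof_sign r : 0 <= r -> exists X, 0 < X /\ g r = X * cos (phase r).
Proof. intros Hr. destruct (phase_polar r Hr) as [x [Hx [E _]]]. exists x. split; assumption. Qed.

End Phase.

Ltac cont_leaf ::=
  first [apply prof_continuity | apply momega_continuity | apply flux_continuity
        | apply phase_continuity].

(** * Comparison of phases *)

(** The part of the equation that is Lipschitz in t uniformly down to r = 0; the singular remainder
    is controlled by monotonicity instead. *)
Definition phase_reg (al r t : R) : R :=
  al * (cos t * bpl (cos t)) + r / 2 * (sin t * bpl (cos t)) + / 2 * sin t ^ 2.

Lemma phase_rhs_split n al r t :
  phase_rhs n al r t = phase_reg al r t - INR n / r * (cos t * sin t).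
Proof. unfold phase_rhs, phase_reg. ring. Qed.

Lemma lipschitz_mult (x1 x2 y1 y2 p q d : R) :
  Rabs x2 <= 1 -> Rabs y1 <= 1 -> Rabs (x1 - x2) <= p * d -> Rabs (y1 - y2) <= q * d ->
  Rabs (x1 * y1 - x2 * y2) <= (p + q) * d.
Proof.
  intros H2 H1 Hx Hy.
  replace (x1 * y1 - x2 * y2) with ((x1 - x2) * y1 + x2 * (y1 - y2)) by ring.
  eapply Rle_trans; [apply Rabs_triang|]. rewrite !Rabs_mult.
  pose proof (Rabs_pos (x1 - x2)). pose proof (Rabs_pos (y1 - y2)).
  pose proof (Rabs_pos x2). pose proof (Rabs_pos y1). nra.
Qed.

Lemma lipschitz_of_bounded_deriv (f df : R -> R) :
  (forall x, is_derive f x (df x)) -> (forall x, Rabs (df x) <= 1) ->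
  forall x y, Rabs (f x - f y) <= 1 * Rabs (x - y).
Proof.
  intros Hd Hb x y. destruct (MVT_gen f y x df) as [c [_ E]].
  - intros; apply Hd.
  - intros; eapply is_derive_continuity, Hd.
  - rewrite E, Rabs_mult. apply Rmult_le_compat_r; [apply Rabs_pos|apply Hb].
Qed.

Lemma Rabs_sin_le_1 x : Rabs (sin x) <= 1.
Proof. apply Rabs_le, SIN_bound. Qed.

Lemma Rabs_cos_le_1 x : Rabs (cos x) <= 1.
Proof. apply Rabs_le, COS_bound. Qed.

Lemma cos_lipschitz x y : Rabs (cos x - cos y) <= 1 * Rabs (x - y).
Proof.
  apply (lipschitz_of_bounded_deriv cos (fun x => - sin x)).
  - apply is_derive_cos.
  - intros z. rewrite Rabs_Ropp. apply Rabs_sin_le_1.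
Qed.

Lemma sin_lipschitz x y : Rabs (sin x - sin y) <= 1 * Rabs (x - y).
Proof.
  apply (lipschitz_of_bounded_deriv sin cos); [apply is_derive_sin|apply Rabs_cos_le_1].
Qed.

Lemma half_bpl_cos_le_1 x : Rabs (/ 2 * bpl (cos x)) <= 1.
Proof.
  rewrite Rabs_mult, Rabs_right by lra.
  pose proof (bpl_abs (cos x)). pose proof (Rabs_cos_le_1 x). lra.
Qed.

Lemma half_bpl_cos_lipschitz x y :
  Rabs (/ 2 * bpl (cos x) - / 2 * bpl (cos y)) <= 1 * Rabs (x - y).
Proof.
  rewrite <- Rmult_minus_distr_l, Rabs_mult, Rabs_right by lra.
  pose proof (bpl_lipschitz (cos x) (cos y)). pose proof (cos_lipschitz x y). lra.
Qed.

Lemma phase_reg_lipschitz al r R t1 t2 :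
  0 <= r <= R ->
  Rabs (phase_reg al r t1 - phase_reg al r t2) <= (4 * Rabs al + 2 * R + 1) * Rabs (t1 - t2).
Proof.
  intros Hr. set (d := Rabs (t1 - t2)). assert (Hd : 0 <= d) by apply Rabs_pos.
  assert (A1 := lipschitz_mult (cos t1) (cos t2) (/ 2 * bpl (cos t1)) (/ 2 * bpl (cos t2)) 1 1 d
    (Rabs_cos_le_1 t2) (half_bpl_cos_le_1 t1) (cos_lipschitz t1 t2) (half_bpl_cos_lipschitz t1 t2)).
  assert (A2 := lipschitz_mult (sin t1) (sin t2) (/ 2 * bpl (cos t1)) (/ 2 * bpl (cos t2)) 1 1 d
    (Rabs_sin_le_1 t2) (half_bpl_cos_le_1 t1) (sin_lipschitz t1 t2) (half_bpl_cos_lipschitz t1 t2)).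
  assert (A3 := lipschitz_mult (sin t1) (sin t2) (sin t1) (sin t2) 1 1 d
    (Rabs_sin_le_1 t2) (Rabs_sin_le_1 t1) (sin_lipschitz t1 t2) (sin_lipschitz t1 t2)).
  set (X1 := cos t1 * (/ 2 * bpl (cos t1)) - cos t2 * (/ 2 * bpl (cos t2))) in *.
  set (X2 := sin t1 * (/ 2 * bpl (cos t1)) - sin t2 * (/ 2 * bpl (cos t2))) in *.
  set (X3 := sin t1 * sin t1 - sin t2 * sin t2) in *.
  replace (phase_reg al r t1 - phase_reg al r t2) with (al * (2 * X1) + r * X2 + / 2 * X3)
    by (unfold phase_reg, X1, X2, X3; field).
  eapply Rle_trans; [apply Rabs_triang|].
  eapply Rle_trans; [apply Rplus_le_compat_r, Rabs_triang|].
  rewrite !Rabs_mult, (Rabs_right 2), (Rabs_right r), (Rabs_right (/ 2)) by lra.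
  pose proof (Rabs_pos al). pose proof (Rabs_pos X2).
  assert (Rabs al * (2 * Rabs X1) <= Rabs al * (2 * ((1 + 1) * d)))
    by (apply Rmult_le_compat_l; lra).
  assert (r * Rabs X2 <= R * ((1 + 1) * d)) by (apply Rmult_le_compat; lra).
  lra.
Qed.

Lemma phase_rhs_lipschitz n al r r0 R t1 t2 :
  0 < r0 -> r0 <= r <= R ->
  Rabs (phase_rhs n al r t1 - phase_rhs n al r t2)
    <= (4 * Rabs al + 2 * R + 1 + 2 * (INR n / r0)) * Rabs (t1 - t2).
Proof.
  intros Hr0 Hr. rewrite !phase_rhs_split.
  pose proof (phase_reg_lipschitz al r R t1 t2 ltac:(lra)) as A.
  set (d := Rabs (t1 - t2)) in *. assert (Hd : 0 <= d) by apply Rabs_pos.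
  assert (B := lipschitz_mult (cos t1) (cos t2) (sin t1) (sin t2) 1 1 d
    (Rabs_cos_le_1 t2) (Rabs_sin_le_1 t1) (cos_lipschitz t1 t2) (sin_lipschitz t1 t2)).
  set (X := cos t1 * sin t1 - cos t2 * sin t2) in *.
  replace (phase_reg al r t1 - INR n / r * (cos t1 * sin t1) -
    (phase_reg al r t2 - INR n / r * (cos t2 * sin t2))) with
    ((phase_reg al r t1 - phase_reg al r t2) + - (INR n / r * X)) by (unfold X; ring).
  eapply Rle_trans; [apply Rabs_triang|]. rewrite Rabs_Ropp, Rabs_mult.
  assert (0 <= INR n / r) by (apply Rdiv_le_0_compat; [apply pos_INR|lra]).
  rewrite (Rabs_right (INR n / r)) by lra.
  assert (INR n / r <= INR n / r0)
    by (apply Rmult_le_compat_l; [apply pos_INR|apply Rinv_le_contravar; lra]).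
  assert (INR n / r * Rabs X <= INR n / r0 * ((1 + 1) * d))
    by (apply Rmult_le_compat; try lra; apply Rabs_pos).
  lra.
Qed.

Lemma cos_bpl_bounds t : 0 <= cos t * bpl (cos t) <= 2.
Proof.
  rewrite bpl_cof. pose proof (cof_bounds (cos t)). pose proof (COS_bound t).
  assert (0 <= cos t * cos t <= 1) by nra.
  replace (cos t * (2 * cof (cos t) * cos t)) with (2 * cof (cos t) * (cos t * cos t)) by ring.
  split; nra.
Qed.

Lemma phase_rhs_al n al1 al2 r t :
  phase_rhs n al2 r t = phase_rhs n al1 r t + (al2 - al1) * (cos t * bpl (cos t)).
Proof. unfold phase_rhs. ring. Qed.

Lemma phase_rhs_incr n al1 al2 r t :
  al1 <= al2 ->
  phase_rhs n al1 r t <= phase_rhs n al2 r t <= phase_rhs n al1 r t + 2 * (al2 - al1).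
Proof.
  intros H. rewrite (phase_rhs_al n al1 al2). pose proof (cos_bpl_bounds t). nra.
Qed.

Lemma phase_le n al1 al2 th1 th2 a b :
  0 < a <= b -> al1 <= al2 ->
  (forall r, a <= r <= b -> continuity_pt th1 r /\ continuity_pt th2 r) ->
  (forall r, a < r < b -> phase_at n al1 th1 r /\ phase_at n al2 th2 r) ->
  th1 a <= th2 a -> th1 b <= th2 b.
Proof.
  intros Hab Hal Hc Hp Ha.
  assert (0 <= th2 b - th1 b); [|lra].
  apply (nonneg_of_deriv_ge (fun r => th2 r - th1 r)
    (fun r => phase_rhs n al2 r (th2 r) - phase_rhs n al1 r (th1 r))
    (4 * Rabs al1 + 2 * b + 1 + 2 * (INR n / a)) a b); [lra|lra| | |].
  - intros r Hr. apply continuity_pt_minus; apply Hc, Hr.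
  - intros r Hr. apply is_derive_minus_R; apply Hp, Hr.
  - intros r Hr Hn. pose proof (phase_rhs_incr n al1 al2 r (th2 r) Hal).
    pose proof (phase_rhs_lipschitz n al1 r a b (th2 r) (th1 r) ltac:(lra) ltac:(lra)) as L.
    rewrite (Rabs_left (th2 r - th1 r)) in L by exact Hn. apply Rabs_le_between in L. lra.
Qed.

Lemma phase_lt n al1 al2 th1 th2 a b :
  0 < a <= b -> al1 <= al2 ->
  (forall r, a <= r <= b -> continuity_pt th1 r /\ continuity_pt th2 r) ->
  (forall r, a < r < b -> phase_at n al1 th1 r /\ phase_at n al2 th2 r) ->
  th1 a < th2 a -> th1 b < th2 b.
Proof.
  intros Hab Hal Hc Hp Ha.
  assert (0 < th2 b - th1 b); [|lra].
  apply (pos_of_deriv_ge (fun r => th2 r - th1 r)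
    (fun r => phase_rhs n al2 r (th2 r) - phase_rhs n al1 r (th1 r))
    (4 * Rabs al1 + 2 * b + 1 + 2 * (INR n / a)) a b); [lra|lra| | |].
  - intros r Hr. apply continuity_pt_minus; apply Hc, Hr.
  - intros r Hr. apply is_derive_minus_R; apply Hp, Hr.
  - intros r Hr. pose proof (phase_rhs_incr n al1 al2 r (th2 r) Hal).
    pose proof (phase_rhs_lipschitz n al1 r a b (th2 r) (th1 r) ltac:(lra) ltac:(lra)) as L.
    apply Rabs_le_between in L. lra.
Qed.

(* The singular term is dissipative near the multiples of pi, where phases start. *)
Lemma cos_sin_monotone t0 t1 t2 :
  sin t0 = 0 -> t0 - PI / 4 <= t1 -> t1 <= t2 -> t2 <= t0 + PI / 4 ->
  cos t1 * sin t1 <= cos t2 * sin t2.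
Proof.
  intros H0 H1 H12 H2.
  assert (E : forall t, cos t * sin t = / 2 * sin (2 * (t - t0))).
  { intros t. replace t with ((t - t0) + t0) at 1 2 by ring.
    rewrite cos_plus, sin_plus, sin_2a, H0.
    pose proof (sin2_cos2 t0) as E. rewrite H0 in E. unfold Rsqr in E.
    transitivity (cos (t - t0) * sin (t - t0) * (0 * 0 + cos t0 * cos t0)); [ring|rewrite E; field]. }
  rewrite !E. apply Rmult_le_compat_l; [lra|]. pose proof PI_RGT_0. apply sin_incr_1; lra.
Qed.

(** The number pi / 4 is the half-width of the interval around a multiple of pi on which cos * sin
    increases. *)
Definition near_start (t0 r0 : R) (th : R -> R) : Prop :=
  forall r, 0 <= r <= r0 -> t0 - PI / 4 <= th r <= t0 + PI / 4.

Lemma near_start_exists t0 th :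
  continuity_pt th 0 -> th 0 = t0 -> exists r0, 0 < r0 /\ near_start t0 r0 th.
Proof.
  intros Hc E. pose proof PI_RGT_0 as Hpi.
  destruct (Hc (PI / 4)) as [d [Hd H]]; [lra|].
  exists (d / 2). split; [lra|]. intros r Hr.
  destruct (Req_dec r 0) as [->|Hne]; [lra|].
  assert (A : Rabs (th r - th 0) < PI / 4).
  { apply H. split; [split; [exact I|lra]|].
    unfold dist; simpl; unfold R_dist. rewrite Rabs_right; lra. }
  apply Rabs_def2 in A. lra.
Qed.

(** Close to 0 the singular terms of the two equations differ with the favourable sign, so the
    Lipschitz constant of [phase_reg] is enough; from [r0] on the coefficients are bounded and
    [phase_le] takes over. *)
Lemma phase_le_from_0 n al1 al2 th1 th2 t0 b :
  0 <= b -> al1 <= al2 -> sin t0 = 0 ->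
  (forall r, 0 <= r <= b -> continuity_pt th1 r /\ continuity_pt th2 r) ->
  (forall r, 0 < r < b -> phase_at n al1 th1 r /\ phase_at n al2 th2 r) ->
  th1 0 = t0 -> th2 0 = t0 -> th1 b <= th2 b.
Proof.
  intros Hb Hal Hs Hc Hp E1 E2.
  destruct (near_start_exists t0 th1) as [r1 [Hr1 N1]]; [apply Hc; lra|exact E1|].
  destruct (near_start_exists t0 th2) as [r2 [Hr2 N2]]; [apply Hc; lra|exact E2|].
  set (r0 := Rmin (Rmin r1 r2) b).
  assert (Hr0 : 0 <= r0 /\ r0 <= r1 /\ r0 <= r2 /\ r0 <= b) by (unfold r0; minmax).
  assert (A : th1 r0 <= th2 r0).
  { assert (0 <= th2 r0 - th1 r0); [|lra].
    apply (nonneg_of_deriv_ge (fun r => th2 r - th1 r)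
      (fun r => phase_rhs n al2 r (th2 r) - phase_rhs n al1 r (th1 r))
      (4 * Rabs al1 + 2 * r0 + 1) 0 r0); [lra|lra| | |].
    - intros r Hr. apply continuity_pt_minus; apply Hc; lra.
    - intros r Hr. apply is_derive_minus_R; apply Hp; lra.
    - intros r Hr Hn. pose proof (phase_rhs_incr n al1 al2 r (th2 r) Hal) as I.
      pose proof (phase_reg_lipschitz al1 r r0 (th2 r) (th1 r) ltac:(lra)) as L.
      rewrite (Rabs_left (th2 r - th1 r)) in L by exact Hn. apply Rabs_le_between in L.
      rewrite !(phase_rhs_split n al1) in *.
      assert (M : cos (th2 r) * sin (th2 r) <= cos (th1 r) * sin (th1 r)).
      { apply (cos_sin_monotone t0); try lra; [apply N2; lra|apply N1; lra]. }
      assert (0 <= INR n / r) by (apply Rdiv_le_0_compat; [apply pos_INR|lra]).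
      assert (INR n / r * (cos (th2 r) * sin (th2 r)) <= INR n / r * (cos (th1 r) * sin (th1 r)))
        by (apply Rmult_le_compat_l; assumption).
      lra. }
  destruct (Req_dec b 0) as [->|Hne]; [lra|].
  apply (phase_le n al1 al2 th1 th2 r0 b); [|exact Hal| | |exact A].
  - unfold r0; minmax.
  - intros r Hr. apply Hc. lra.
  - intros r Hr. apply Hp. lra.
Qed.

(** Gronwall for the difference increased by 2 (al2 - al1); since C >= 1 this shift absorbs the
    inhomogeneous term. The radius [r0] can be chosen common to all nearby alpha, so the bound
    yields continuity in alpha. *)
Lemma phase_upper_bound n al1 al2 th1 th2 t0 r0 R :
  0 < r0 <= R -> al1 <= al2 -> sin t0 = 0 ->
  (forall r, 0 <= r <= R -> continuity_pt th1 r /\ continuity_pt th2 r) ->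
  (forall r, 0 < r < R -> phase_at n al1 th1 r /\ phase_at n al2 th2 r) ->
  (forall r, 0 <= r <= R -> th1 r <= th2 r) ->
  near_start t0 r0 th1 -> near_start t0 r0 th2 -> th1 0 = th2 0 ->
  th2 R - th1 R <=
    2 * (al2 - al1) * exp ((4 * Rabs al1 + 2 * R + 1 + 2 * (INR n / r0)) * (R - 0)).
Proof.
  intros Hr0 Hal Hs Hc Hp Hle N1 N2 E0.
  set (C := 4 * Rabs al1 + 2 * R + 1 + 2 * (INR n / r0)).
  assert (HN : 0 <= INR n / r0) by (apply Rdiv_le_0_compat; [apply pos_INR|lra]).
  assert (HC : 1 <= C) by (unfold C; pose proof (Rabs_pos al1); lra).
  assert (A : (th2 R - th1 R) + 2 * (al2 - al1) <=
    ((th2 0 - th1 0) + 2 * (al2 - al1)) * exp (C * (R - 0))).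
  { apply (gronwall (fun r => (th2 r - th1 r) + 2 * (al2 - al1))
      (fun r => (phase_rhs n al2 r (th2 r) - phase_rhs n al1 r (th1 r)) + 0)); [lra| | |].
    - intros r Hr. destruct (Hc r Hr). cont.
    - intros r Hr. apply is_derive_plus_R; [|apply (is_derive_const (2 * (al2 - al1)))].
      apply is_derive_minus_R; apply Hp, Hr.
    - intros r Hr. pose proof (phase_rhs_incr n al1 al2 r (th2 r) Hal) as I.
      specialize (Hle r ltac:(lra)).
      assert (K : phase_rhs n al1 r (th2 r) - phase_rhs n al1 r (th1 r) <= C * (th2 r - th1 r)).
      { destruct (Rle_lt_dec r r0) as [Hrr|Hrr].
        - pose proof (phase_reg_lipschitz al1 r R (th2 r) (th1 r) ltac:(lra)) as L.
          rewrite (Rabs_right (th2 r - th1 r)) in L by lra. apply Rabs_le_between in L.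
          rewrite !(phase_rhs_split n al1).
          assert (M : cos (th1 r) * sin (th1 r) <= cos (th2 r) * sin (th2 r)).
          { apply (cos_sin_monotone t0); try lra; [apply N1; lra|apply N2; lra]. }
          assert (0 <= INR n / r) by (apply Rdiv_le_0_compat; [apply pos_INR|lra]).
          assert (INR n / r * (cos (th1 r) * sin (th1 r)) <=
                  INR n / r * (cos (th2 r) * sin (th2 r)))
            by (apply Rmult_le_compat_l; assumption).
          assert ((4 * Rabs al1 + 2 * R + 1) * (th2 r - th1 r) <= C * (th2 r - th1 r))
            by (apply Rmult_le_compat_r; unfold C; lra).
          lra.
        - pose proof (phase_rhs_lipschitz n al1 r r0 R (th2 r) (th1 r) ltac:(lra) ltac:(lra)) as L.
          rewrite (Rabs_right (th2 r - th1 r)) in L by lra. apply Rabs_le_between in L.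
          unfold C. lra. }
      assert (2 * (al2 - al1) <= C * (2 * (al2 - al1))) by nra. lra. }
  rewrite E0, Rminus_diag in A. lra.
Qed.

(** The zeros of cos are numbered so that cell j, between [lev j] and [lev (S j)], is centred at j
    pi; there cos, and with it the profile, has the sign [par j]. *)
Definition lev (j : nat) : R := INR j * PI - PI / 2.

Lemma lev_S j : lev (S j) = lev j + PI.
Proof. unfold lev. rewrite S_INR. ring. Qed.

Definition par (j : nat) : R := if Nat.even j then 1 else -1.

Lemma par_S j : par (S j) = - par j.
Proof.
  unfold par. rewrite Nat.even_succ, <- Nat.negb_even. destruct (Nat.even j); simpl; ring.
Qed.

Lemma cos_sin_cell j u :
  cos (INR j * PI + u) = par j * cos u /\ sin (INR j * PI + u) = par j * sin u.
Proof.
  induction j as [|j [IHc IHs]].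
  - unfold par; simpl. replace (0 * PI + u) with u by ring. split; ring.
  - rewrite S_INR, par_S. replace ((INR j + 1) * PI + u) with ((INR j * PI + u) + PI) by ring.
    rewrite neg_cos, neg_sin, IHc, IHs. split; ring.
Qed.

Lemma cos_lev j : cos (lev j) = 0.
Proof.
  unfold lev. replace (INR j * PI - PI / 2) with (INR j * PI + - (PI / 2)) by ring.
  rewrite (proj1 (cos_sin_cell j _)), cos_neg, cos_PI2. ring.
Qed.

Lemma phase_rhs_lev n al r j : phase_rhs n al r (lev j) = / 2.
Proof.
  unfold phase_rhs. rewrite cos_lev, bpl_0.
  pose proof (sin2_cos2 (lev j)) as E. rewrite cos_lev in E. unfold Rsqr in E.
  assert (E' : sin (lev j) ^ 2 = 1) by (simpl; lra). rewrite E'. ring.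
Qed.

(** On a level cos vanishes and the phase equation reduces to theta' = 1/2, whatever al and r are;
    [barrier] applies. *)
Lemma no_return n al th j x y :
  0 < x < y -> (forall r, x <= r <= y -> phase_at n al th r) -> lev j <= th x -> lev j < th y.
Proof.
  intros Hxy Hp Hx.
  assert (0 < th y - lev j); [|lra].
  apply (barrier (fun r => th r - lev j) (fun r => phase_rhs n al r (th r) - 0) x y); try lra.
  - intros r Hr. apply is_derive_minus_R; [apply Hp, Hr|apply (is_derive_const (lev j))].
  - intros r Hr E. replace (th r) with (lev j) by lra. rewrite phase_rhs_lev. lra.
Qed.

Definition ccell (j : nat) : R := cof (par j).

Lemma ccell_bounds j : / 2 <= ccell j <= 1.
Proof. apply cof_bounds. Qed.

Lemma par_sqr j : par j * par j = 1.
Proof. unfold par. destruct (Nat.even j); ring. Qed.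

Lemma bpl_par j x : 0 <= x -> bpl (par j * x) = 2 * ccell j * (par j * x).
Proof.
  intros Hx. rewrite bpl_cof. unfold ccell, cof, par.
  destruct (Nat.even j).
  - destruct (Rlt_dec (1 * x) 0), (Rlt_dec 1 0); lra.
  - destruct (Rlt_dec (-1 * x) 0), (Rlt_dec (-1) 0); nra.
Qed.

Lemma phase_rhs_cell n al r j u :
  - (PI / 2) <= u <= PI / 2 ->
  phase_rhs n al r (INR j * PI + u) =
    2 * ccell j * al * cos u ^ 2 + (ccell j * r - INR n / r) * (sin u * cos u) + / 2 * sin u ^ 2.
Proof.
  intros Hu. destruct (cos_sin_cell j u) as [Ec Es].
  assert (Hc : 0 <= cos u) by (apply cos_ge_0; lra).
  unfold phase_rhs. rewrite Ec, Es, bpl_par by exact Hc.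
  pose proof (par_sqr j) as Ep. set (q := INR n / r).
  transitivity ((par j * par j) * (2 * ccell j * al * cos u ^ 2 +
    (ccell j * r - q) * (sin u * cos u) + / 2 * sin u ^ 2)); [field|].
  rewrite Ep. ring.
Qed.

(** * Trapped and critical phases *)

Definition in_cell (j : nat) (t : R) : Prop := lev j < t < lev (S j).

Lemma in_cell_shift j t : in_cell j t <-> - (PI / 2) < t - INR j * PI < PI / 2.
Proof. unfold in_cell, lev. rewrite S_INR. split; intros; lra. Qed.

(* In cell [j] this is r f'/f, where f is the solution of the alpha-equation
   with phase [th]. *)
Definition mom (th : R -> R) (j : nat) (r : R) : R := - (r / 2) * tan (th r - INR j * PI).

Lemma cos_tan_sqr u : cos u <> 0 -> cos u ^ 2 * (tan u ^ 2 + 1) = 1 /\ sin u = tan u * cos u.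
Proof.
  intros Hc. unfold tan. pose proof (sin2_cos2 u) as E. unfold Rsqr in E. split.
  - transitivity (sin u * sin u + cos u * cos u); [field; exact Hc|exact E].
  - field. exact Hc.
Qed.

Lemma mom_derive n al th j r :
  0 < r -> phase_at n al th r -> in_cell j (th r) ->
  is_derive (mom th j) r
    ((ccell j * r ^ 2 * (mom th j r - al) + (1 - INR n) * mom th j r - mom th j r ^ 2) / r).
Proof.
  intros Hr Hp Hcell. apply in_cell_shift in Hcell. set (u := th r - INR j * PI) in *.
  assert (Hc : cos u <> 0) by (apply Rgt_not_eq, cos_gt_0; lra).
  destruct (cos_tan_sqr u Hc) as [E1 E2].
  assert (Ht : is_derive (fun z => tan (th z - INR j * PI)) r
                 ((phase_rhs n al r (th r) - 0) * (tan u ^ 2 + 1))).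
  { apply (is_derive_comp_R tan (fun z => th z - INR j * PI)).
    - apply is_derive_tan. exact Hc.
    - apply is_derive_minus_R; [exact Hp|apply (is_derive_const (INR j * PI))]. }
  assert (Hlin : is_derive (fun z => - (z / 2)) r (- / 2)) by (auto_derive; [exact I|field]).
  eapply is_derive_eq; [apply (is_derive_mult_R _ _ _ _ _ Hlin Ht)|].
  cbv beta. unfold mom. fold u.
  replace (th r) with (INR j * PI + u) by (unfold u; ring).
  rewrite phase_rhs_cell by lra. rewrite E2. set (T := tan u) in *. set (c := cos u) in *.
  transitivity (- / 2 * T - r / 2 * ((c ^ 2 * (T ^ 2 + 1)) *
    (2 * ccell j * al + (ccell j * r - INR n / r) * T + / 2 * T ^ 2))); [field; lra|].
  rewrite E1. field. lra.
Qed.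

(* For r >= [rcut n A] and all al <= A, the curve p = 2 al is a barrier. *)
Definition rcut (n : nat) (A : R) : R := 4 * (INR n + 1) + 8 * A + 1.

Lemma rcut_sqr n A r :
  0 <= A -> rcut n A <= r -> 1 <= r /\ 4 * (INR n + 1) + 8 * A < r ^ 2 /\ 4 * (INR n + 1) <= r.
Proof. unfold rcut. intros HA Hr. pose proof (pos_INR n). repeat split; nra. Qed.

Lemma phase_rhs_atan n al r j T :
  phase_rhs n al r (INR j * PI + atan T) * (1 + T ^ 2) =
    2 * ccell j * al + (ccell j * r - INR n / r) * T + / 2 * T ^ 2.
Proof.
  pose proof (atan_bound T). rewrite phase_rhs_cell by lra.
  assert (Hc : cos (atan T) <> 0) by (apply Rgt_not_eq, cos_gt_0; lra).
  destruct (cos_tan_sqr (atan T) Hc) as [E1 E2]. rewrite tan_atan in E1, E2. rewrite E2.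
  set (c := cos (atan T)) in *. set (q := INR n / r).
  transitivity (c ^ 2 * (T ^ 2 + 1) * (2 * ccell j * al + (ccell j * r - q) * T + / 2 * T ^ 2));
    [ring|rewrite E1; ring].
Qed.

(** In terms of T = tan (theta - j pi) the curve p = 2 al is T = - 4 al / r, and a smaller phase
    means a larger p. Along the curve the derivative tested by [barrier] has the sign of c r^2 + 2 -
    2 n - 4 al, positive beyond [rcut] because c >= 1/2. *)
Lemma trap n al A th j r1 :
  0 < al <= A -> rcut n A <= r1 -> (forall r, r1 <= r -> phase_at n al th r) ->
  th r1 <= INR j * PI - atan (4 * al / r1) ->
  forall r, r1 < r -> th r < INR j * PI - atan (4 * al / r).
Proof.
  intros Hal Hr1 Hp H1 r Hr.
  assert (Hb : forall z, r1 <= z -> 0 < z).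
  { intros z Hz. destruct (rcut_sqr n A z); lra. }
  assert (0 < INR j * PI - atan (4 * al / r) - th r); [|lra].
  apply (barrier (fun z => INR j * PI - atan (4 * al / z) - th z)
    (fun z => 0 - (- (4 * al / z ^ 2)) * / (1 + (4 * al / z)²) - phase_rhs n al z (th z)) r1 r);
    [lra|lra| | |lra].
  - intros z Hz. specialize (Hb z ltac:(lra)). apply is_derive_minus_R; [|apply Hp; lra].
    apply is_derive_minus_R; [apply (is_derive_const (INR j * PI))|].
    apply (is_derive_comp_R atan (fun z => 4 * al / z)).
    + apply is_derive_atan.
    + auto_derive; [lra|]. field. lra.
  - intros z Hz E. specialize (Hb z ltac:(lra)).
    destruct (rcut_sqr n A z ltac:(lra) ltac:(lra)) as [_ [Hz2 _]].
    set (T := - (4 * al / z)).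
    replace (th z) with (INR j * PI + atan T) by (unfold T; rewrite atan_opp; lra).
    pose proof (phase_rhs_atan n al z j T) as ET.
    pose proof (pow2_ge_0 T) as HT. unfold Rsqr.
    replace (1 + 4 * al / z * (4 * al / z)) with (1 + T ^ 2) by (unfold T; ring).
    apply Rmult_lt_reg_r with (1 + T ^ 2); [lra|]. rewrite Rmult_0_l.
    replace ((0 - - (4 * al / z ^ 2) * / (1 + T ^ 2) -
      phase_rhs n al z (INR j * PI + atan T)) * (1 + T ^ 2)) with
      (4 * al / z ^ 2 - phase_rhs n al z (INR j * PI + atan T) * (1 + T ^ 2)) by (field; lra).
    rewrite ET. unfold T.
    replace (4 * al / z ^ 2 - (2 * ccell j * al + (ccell j * z - INR n / z) * - (4 * al / z) +
      / 2 * (- (4 * al / z)) ^ 2)) with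
      (2 * al / z ^ 2 * (ccell j * z ^ 2 + 2 - 2 * INR n - 4 * al)) by (field; lra).
    pose proof (ccell_bounds j).
    apply Rmult_lt_0_compat; [apply Rdiv_lt_0_compat; [lra|apply pow_lt, Hb]|].
    pose proof (pos_INR n). nra.
Qed.

(** In the upper half of a cell the phase moves at speed at least d = min (al, 1/2): beyond [rcut]
    the mixed term is nonnegative, 2 c al >= al, and the squares of cos and sin add up to 1. The
    half cell is therefore left within length pi / d; its lower end cannot be recrossed, since there
    theta' = 2 c al > 0. *)
Lemma push n al A th j r1 :
  0 < al <= A -> rcut n A <= r1 -> (forall r, r1 <= r -> phase_at n al th r) ->
  INR j * PI <= th r1 -> exists r, r1 <= r /\ lev (S j) <= th r.
Proof.
  intros Hal Hr1 Hp H1. apply NNPP. intros Hn.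
  assert (Hup : forall r, r1 <= r -> th r < lev (S j)).
  { intros r Hr. apply Rnot_le_lt. intros H. apply Hn. exists r. split; assumption. }
  clear Hn.
  assert (Hlow : forall r, r1 <= r -> INR j * PI <= th r).
  { intros r Hr. destruct (Req_dec r r1) as [->|Hne]; [exact H1|].
    assert (0 < th r - INR j * PI); [|lra].
    apply (barrier (fun z => th z - INR j * PI) (fun z => phase_rhs n al z (th z) - 0) r1 r);
      [lra|lra| | |lra].
    - intros z Hz. apply is_derive_minus_R; [apply Hp; lra|apply (is_derive_const (INR j * PI))].
    - intros z Hz E. replace (th z) with (INR j * PI + 0) by lra. pose proof PI_RGT_0.
      rewrite phase_rhs_cell, cos_0, sin_0 by lra. pose proof (ccell_bounds j). nra. }
  set (d := Rmin al (/ 2)). assert (Hd : 0 < d) by (unfold d; apply Rmin_pos; lra).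
  assert (Hd1 : d <= al) by apply Rmin_l. assert (Hd2 : d <= / 2) by apply Rmin_r.
  pose proof PI_RGT_0 as Hpi.
  set (r2 := r1 + PI / d).
  assert (Hr2 : r1 < r2) by (unfold r2; assert (0 < PI / d) by (apply Rdiv_lt_0_compat; lra); lra).
  assert (A1 : th r1 - d * r1 <= th r2 - d * r2).
  { apply (nondecreasing_deriv (fun z => th z - d * z)
      (fun z => phase_rhs n al z (th z) - d)); [lra| | |].
    - intros z Hz. apply is_derive_continuity with (phase_rhs n al z (th z) - d).
      apply is_derive_minus_R; [apply Hp; lra|]. auto_derive; [exact I|ring].
    - intros z Hz. apply is_derive_minus_R; [apply Hp; lra|]. auto_derive; [exact I|ring].
    - intros z Hz. specialize (Hlow z ltac:(lra)). specialize (Hup z ltac:(lra)).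
      unfold lev in Hup. rewrite S_INR in Hup.
      replace (th z) with (INR j * PI + (th z - INR j * PI)) by ring.
      set (u := th z - INR j * PI) in *.
      assert (Hu : 0 <= u <= PI / 2) by (unfold u; lra).
      rewrite phase_rhs_cell by lra.
      assert (Hc : 0 <= cos u) by (apply cos_ge_0; lra).
      assert (Hs : 0 <= sin u) by (apply sin_ge_0; lra).
      pose proof (sin2_cos2 u) as E. unfold Rsqr in E.
      pose proof (ccell_bounds j).
      destruct (rcut_sqr n A z ltac:(lra) ltac:(lra)) as [Hz1 [Hz2 _]].
      assert (Hq : 0 <= ccell j * z - INR n / z).
      { replace (ccell j * z - INR n / z) with ((ccell j * z ^ 2 - INR n) / z) by (field; lra).
        apply Rdiv_le_0_compat; [|lra]. pose proof (pos_INR n). nra. }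
      assert (0 <= (ccell j * z - INR n / z) * (sin u * cos u)).
      { apply Rmult_le_pos; [exact Hq|]. apply Rmult_le_pos; assumption. }
      assert (0 <= cos u ^ 2) by apply pow2_ge_0. assert (0 <= sin u ^ 2) by apply pow2_ge_0.
      assert (d * cos u ^ 2 <= 2 * ccell j * al * cos u ^ 2)
        by (apply Rmult_le_compat_r; nra).
      assert (d * sin u ^ 2 <= / 2 * sin u ^ 2) by (apply Rmult_le_compat_r; lra).
      assert (d = d * cos u ^ 2 + d * sin u ^ 2).
      { transitivity (d * (sin u * sin u + cos u * cos u)); [rewrite E; ring|ring]. }
      lra. }
  assert (E : d * r2 = d * r1 + PI) by (unfold r2; field; lra).
  specialize (Hlow r1 ltac:(lra)). specialize (Hup r2 ltac:(lra)).
  unfold lev in Hup. rewrite S_INR in Hup. lra.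
Qed.

(** In terms of p = [mom], from r1 on and within cell j: [trapped] means p >= 2 al, while [critical]
    below means 0 < p < 2 al. *)
Definition trapped (al : R) (th : R -> R) (j : nat) (r1 : R) : Prop :=
  forall r, r1 <= r -> lev j < th r <= INR j * PI - atan (4 * al / r).

Definition critical (al : R) (th : R -> R) (j : nat) (r1 : R) : Prop :=
  forall r, r1 <= r -> INR j * PI - atan (4 * al / r) < th r < INR j * PI.

(** Just after a zero p is arbitrarily large, that is, [lev j] lies below the trap curve; so any
    zero beyond [rcut] is followed by the trap. The shift by 1 is due to the strict lower bound in
    [trapped], which fails at r1 itself. *)
Lemma zero_trap n al A th j r1 :
  0 < al <= A -> rcut n A <= r1 -> (forall r, r1 <= r -> phase_at n al th r) ->
  th r1 = lev j -> trapped al th j (r1 + 1).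
Proof.
  intros Hal Hr1 Hp E r Hr.
  destruct (rcut_sqr n A r1 ltac:(lra) ltac:(lra)) as [Hb _]. split.
  - apply (no_return n al th j r1); [lra| |lra]. intros z Hz. apply Hp; lra.
  - left. apply (trap n al A th j r1); try assumption; [|lra].
    rewrite E. unfold lev. pose proof (atan_bound (4 * al / r1)). lra.
Qed.

Lemma IVT_between (f : R -> R) (a b y : R) :
  continuity f -> a <= b -> f a <= y <= f b -> exists x, a <= x <= b /\ f x = y.
Proof.
  intros Hc Hab Hy. destruct (IVT_gen f a b y Hc) as [x [Hx E]].
  - rewrite Rmin_left, Rmax_right by lra. exact Hy.
  - rewrite Rmin_left, Rmax_right in Hx by exact Hab. exists x. split; assumption.
Qed.

Lemma level_reached_trapped n al A th j r1 r2 :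
  0 < al <= A -> rcut n A <= r1 <= r2 -> continuity th ->
  (forall r, 0 < r -> phase_at n al th r) ->
  th r1 <= lev j <= th r2 -> trapped al th j (r2 + 1).
Proof.
  intros Hal Hr Hc Hp Hl.
  destruct (IVT_between th r1 r2 (lev j) Hc) as [x [Hx E]]; [lra|exact Hl|].
  intros r Hr'. apply (zero_trap n al A th j x); [exact Hal|lra| |exact E|lra].
  intros z Hz. apply Hp. destruct (rcut_sqr n A z); lra.
Qed.

Lemma cell_exists t : lev 0 < t -> exists j, lev j < t <= lev (S j).
Proof.
  intros H0. pose proof PI_RGT_0 as Hpi.
  assert (H : forall k, t <= lev (S k) -> exists j, lev j < t <= lev (S j)).
  { induction k as [|k IH]; intros Hk; [exists 0%nat; split; assumption|].
    destruct (Rle_lt_dec t (lev (S k))) as [Hle|Hlt]; [apply IH, Hle|].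
    exists (S k). split; assumption. }
  destruct (INR_unbounded (Rabs t / PI + 1)) as [k Hk].
  apply (H k). unfold lev. rewrite S_INR.
  assert (Rabs t <= INR k * PI).
  { replace (Rabs t) with (Rabs t / PI * PI) by (field; lra).
    apply Rmult_le_compat_r; lra. }
  pose proof (Rle_abs t). lra.
Qed.

(** Beyond the cut, crossing one more level leads into the trap. Otherwise the phase stays in its
    cell: if it ever meets the trap curve it is trapped, and if not it also stays below j pi,
    because from there [push] would lead to a further level. *)
Lemma final_state n al A th :
  0 < al <= A -> continuity th -> (forall r, 0 < r -> phase_at n al th r) ->
  lev 0 < th (rcut n A) ->
  exists j, (exists r1, rcut n A <= r1 /\ trapped al th j r1) \/ critical al th j (rcut n A).
Proof.
  intros Hal Hc Hp H0. set (R0 := rcut n A) in *.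
  assert (Hpos : 1 <= R0) by (destruct (rcut_sqr n A R0); [lra|unfold R0; lra|lra]).
  assert (Hp' : forall r, R0 <= r -> phase_at n al th r) by (intros; apply Hp; lra).
  destruct (cell_exists _ H0) as [j [Hj1 Hj2]].
  destruct (classic (exists r, R0 <= r /\ lev (S j) <= th r)) as [[r [Hr Hl]]|Hn].
  - exists (S j). left. exists (r + 1). split; [lra|].
    apply (level_reached_trapped n al A th (S j) R0 r); try assumption; [unfold R0 in *; lra|lra].
  - assert (Hup : forall r, R0 <= r -> th r < lev (S j)).
    { intros r Hr. apply Rnot_le_lt. intros H. apply Hn. exists r. split; assumption. }
    assert (Hlow : forall r, R0 <= r -> lev j < th r).
    { intros r Hr. destruct (Req_dec r R0) as [->|Hne]; [exact Hj1|].
      apply (no_return n al th j R0); [lra| |lra]. intros z Hz; apply Hp; lra. }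
    exists j.
    destruct (classic (exists r, R0 <= r /\ th r <= INR j * PI - atan (4 * al / r)))
      as [[r1 [Hr1 Hl]]|Hn2].
    + left. exists r1. split; [exact Hr1|]. intros r Hr. split; [apply Hlow; lra|].
      destruct (Req_dec r r1) as [->|Hne]; [exact Hl|].
      left. apply (trap n al A th j r1); try assumption; [|lra].
      intros z Hz; apply Hp'; lra.
    + right. intros r Hr. split.
      * apply Rnot_le_lt. intros H. apply Hn2. exists r. split; assumption.
      * apply Rnot_le_lt. intros H.
        destruct (push n al A th j r) as [r2 [Hr2 Hl]]; try assumption.
        -- intros z Hz. apply Hp'; lra.
        -- apply Hn. exists r2. split; [lra|exact Hl].
Qed.

Lemma tan_cell_le u x : - (PI / 2) < u -> u <= atan x -> tan u <= x.
Proof.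
  intros Hu H. pose proof (atan_bound x). rewrite <- (tan_atan x).
  destruct H as [H|H]; [left; apply tan_increasing; lra|right; f_equal; exact H].
Qed.

Lemma atan_lt_tan u x : u < PI / 2 -> atan x < u -> x < tan u.
Proof.
  intros Hu H. pose proof (atan_bound x). rewrite <- (tan_atan x).
  apply tan_increasing; lra.
Qed.

Lemma atan_nonneg x : 0 <= x -> 0 <= atan x.
Proof.
  intros [H|<-]; [left|right; symmetry; apply atan_0].
  rewrite <- atan_0. apply atan_increasing, H.
Qed.

Lemma trapped_mom al th j r1 :
  0 < al -> 0 < r1 -> trapped al th j r1 ->
  forall r, r1 <= r -> in_cell j (th r) /\ 2 * al <= mom th j r.
Proof.
  intros Hal Hr1 H r Hr. destruct (H r Hr) as [Hl Hu].
  assert (0 <= 4 * al / r) by (apply Rdiv_le_0_compat; lra).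
  pose proof (atan_nonneg _ H0). pose proof PI_RGT_0.
  assert (Hc : in_cell j (th r)).
  { apply in_cell_shift. unfold lev in Hl. split; lra. }
  split; [exact Hc|]. apply in_cell_shift in Hc.
  assert (tan (th r - INR j * PI) <= - (4 * al / r)).
  { apply tan_cell_le; [lra|]. rewrite atan_opp. lra. }
  unfold mom. replace (2 * al) with (- (r / 2) * - (4 * al / r)) by (field; lra).
  rewrite <- !Ropp_mult_distr_l. apply Ropp_le_contravar.
  apply Rmult_le_compat_l; lra.
Qed.

Lemma critical_mom al th j r1 :
  0 < al -> 0 < r1 -> critical al th j r1 ->
  forall r, r1 <= r -> in_cell j (th r) /\ 0 < mom th j r < 2 * al.
Proof.
  intros Hal Hr1 H r Hr. destruct (H r Hr) as [Hl Hu].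
  pose proof (atan_bound (4 * al / r)). pose proof PI_RGT_0.
  assert (Hc : in_cell j (th r)) by (apply in_cell_shift; split; lra).
  split; [exact Hc|]. apply in_cell_shift in Hc.
  assert (A1 : - (4 * al / r) < tan (th r - INR j * PI)).
  { apply atan_lt_tan; [lra|]. rewrite atan_opp. lra. }
  assert (A2 : tan (th r - INR j * PI) < 0).
  { rewrite <- tan_0. apply tan_increasing; lra. }
  unfold mom. split.
  - rewrite <- Ropp_mult_distr_l, Ropp_mult_distr_r. apply Rmult_lt_0_compat; lra.
  - replace (2 * al) with (r / 2 * (4 * al / r)) by (field; lra).
    rewrite <- Ropp_mult_distr_l, Ropp_mult_distr_r. apply Rmult_lt_compat_l; lra.
Qed.

(** * Growth of trapped and critical solutions *)

Lemma linear_growth (f df : R -> R) (c a B : R) :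
  0 < c -> (forall r, a <= r -> is_derive f r (df r)) -> (forall r, a <= r -> c <= df r) ->
  exists r, a <= r /\ B < f r.
Proof.
  intros Hc Hd Hp. set (b := a + (Rabs (B - f a) + 1) / c).
  assert (Hpos : 0 < (Rabs (B - f a) + 1) / c).
  { apply Rdiv_lt_0_compat; [|exact Hc]. pose proof (Rabs_pos (B - f a)). lra. }
  exists b. split; [unfold b; lra|].
  assert (Hcx : forall x, a <= x -> is_derive (fun z => f z - c * z) x (df x - c)).
  { intros x Hx. apply is_derive_minus_R; [apply Hd, Hx|]. auto_derive; [exact I|ring]. }
  assert (A : f a - c * a <= f b - c * b).
  { apply (nondecreasing_deriv (fun x => f x - c * x) (fun x => df x - c)).
    - unfold b; lra.
    - intros x Hx. eapply is_derive_continuity, Hcx; lra.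
    - intros x Hx. apply Hcx; lra.
    - intros x Hx. specialize (Hp x ltac:(lra)). lra. }
  assert (E : c * b = c * a + Rabs (B - f a) + 1) by (unfold b; field; lra).
  pose proof (Rle_abs (B - f a)). lra.
Qed.

Lemma mom_antitone th1 th2 j r :
  0 < r -> in_cell j (th1 r) -> in_cell j (th2 r) ->
  (th1 r <= th2 r -> mom th2 j r <= mom th1 j r) /\
  (th1 r < th2 r -> mom th2 j r < mom th1 j r).
Proof.
  intros Hr H1 H2. apply in_cell_shift in H1, H2.
  assert (S : th1 r < th2 r -> mom th2 j r < mom th1 j r).
  { intros H. unfold mom. rewrite <- !Ropp_mult_distr_l.
    apply Ropp_lt_contravar, Rmult_lt_compat_l; [lra|]. apply tan_increasing; lra. }
  split; [|exact S]. intros [H|H]; [left; apply S, H|]. unfold mom. rewrite H. right; reflexivity.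
Qed.

Lemma critical_weaken al th j r1 r2 : r1 <= r2 -> critical al th j r1 -> critical al th j r2.
Proof. intros H C r Hr. apply C. lra. Qed.

(* The difference of the two bounded logarithmic derivatives would grow at least linearly. *)
Lemma critical_unique n al1 al2 th1 th2 j R0 R1 R2 :
  0 < al1 <= al2 -> 0 < R0 ->
  (forall r, R0 <= r -> phase_at n al1 th1 r) -> (forall r, R0 <= r -> phase_at n al2 th2 r) ->
  critical al1 th1 j R1 -> critical al2 th2 j R2 ->
  (forall r, R0 <= r -> th1 r <= th2 r) ->
  (al1 < al2 \/ forall r, R0 <= r -> th1 r < th2 r) -> False.
Proof.
  intros Hal HR0 Hp1 Hp2 C1 C2 Hle Hor.
  set (r1 := Rmax R0 (Rmax R1 R2)).
  assert (HR : R0 <= r1 /\ R1 <= r1 /\ R2 <= r1) by (unfold r1; minmax).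
  destruct HR as [HR [HR1 HR2]]. assert (Hr1 : 0 < r1) by lra.
  assert (Hge : forall r, r1 <= r -> R0 <= r) by (intros; lra).
  apply (critical_weaken _ _ _ _ _ HR1) in C1. apply (critical_weaken _ _ _ _ _ HR2) in C2.
  (* The argument 2 al2 makes r^2 exceed 16 al2 + 4 (n + 1): the sum of the two logarithmic
     derivatives, bounded only by 4 al2, must be beaten by r^2 / 4. *)
  set (r2 := r1 + rcut n (2 * al2)).
  assert (Hr2 : forall r, r2 <= r -> r1 <= r /\ 1 <= r /\ 4 * (INR n + 1) + 16 * al2 < r ^ 2).
  { intros r Hr. unfold r2 in Hr. destruct (rcut_sqr n (2 * al2) r); [lra|lra|].
    assert (0 < rcut n (2 * al2)) by (unfold rcut; pose proof (pos_INR n); lra). lra. }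
  set (D := fun r => mom th1 j r - mom th2 j r).
  set (rhs := fun al P r => (ccell j * r ^ 2 * (P - al) + (1 - INR n) * P - P ^ 2) / r).
  set (dD := fun r => rhs al1 (mom th1 j r) r - rhs al2 (mom th2 j r) r).
  assert (HD : forall r, r2 <= r -> is_derive D r (dD r)).
  { intros r Hr. destruct (Hr2 r Hr) as [Hr' [Hr1' _]].
    destruct (critical_mom al1 th1 j r1 ltac:(lra) Hr1 C1 r Hr') as [In1 _].
    destruct (critical_mom al2 th2 j r1 ltac:(lra) Hr1 C2 r Hr') as [In2 _].
    apply is_derive_minus_R; apply mom_derive; try assumption; auto; lra. }
  assert (HD0 : forall r, r1 <= r -> 0 <= D r).
  { intros r Hr.
    destruct (critical_mom al1 th1 j r1 ltac:(lra) Hr1 C1 r Hr) as [In1 _].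
    destruct (critical_mom al2 th2 j r1 ltac:(lra) Hr1 C2 r Hr) as [In2 _].
    destruct (mom_antitone th1 th2 j r) as [A _]; [lra|assumption|assumption|].
    unfold D. specialize (A (Hle r (Hge r Hr))). lra. }
  assert (HdD : forall r, r2 <= r -> / 4 * D r + / 2 * (al2 - al1) <= dD r).
  { intros r Hr. destruct (Hr2 r Hr) as [Hr' [Hr1' Hsq]].
    destruct (critical_mom al1 th1 j r1 ltac:(lra) Hr1 C1 r Hr') as [_ M1].
    destruct (critical_mom al2 th2 j r1 ltac:(lra) Hr1 C2 r Hr') as [_ M2].
    specialize (HD0 r Hr'). pose proof (ccell_bounds j). pose proof (pos_INR n).
    unfold dD, rhs. set (P1 := mom th1 j r) in *. set (P2 := mom th2 j r) in *.
    assert (HDe : D r = P1 - P2) by reflexivity. rewrite HDe in *.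
    replace ((ccell j * r ^ 2 * (P1 - al1) + (1 - INR n) * P1 - P1 ^ 2) / r -
      (ccell j * r ^ 2 * (P2 - al2) + (1 - INR n) * P2 - P2 ^ 2) / r) with
      ((ccell j * r ^ 2 * (al2 - al1) + (ccell j * r ^ 2 + 1 - INR n - P1 - P2) * (P1 - P2)) / r)
      by (field; lra).
    apply Rmult_le_reg_r with r; [lra|].
    replace ((ccell j * r ^ 2 * (al2 - al1) + (ccell j * r ^ 2 + 1 - INR n - P1 - P2) *
      (P1 - P2)) / r * r) with (ccell j * r ^ 2 * (al2 - al1) +
      (ccell j * r ^ 2 + 1 - INR n - P1 - P2) * (P1 - P2)) by (field; lra).
    assert (Hrr : r <= r ^ 2) by nra.
    assert (Hc1 : / 2 * r <= ccell j * r ^ 2) by nra.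
    assert (Hc2 : / 4 * r <= ccell j * r ^ 2 + 1 - INR n - P1 - P2) by nra.
    assert (/ 2 * r * (al2 - al1) <= ccell j * r ^ 2 * (al2 - al1))
      by (apply Rmult_le_compat_r; lra).
    assert (/ 4 * r * (P1 - P2) <= (ccell j * r ^ 2 + 1 - INR n - P1 - P2) * (P1 - P2))
      by (apply Rmult_le_compat_r; lra).
    lra. }
  assert (Hr22 : r2 <= r2) by lra. destruct (Hr2 r2 Hr22) as [Hr12 [H1r2 _]].
  assert (Hmono : forall r, r2 <= r -> D r2 <= D r).
  { intros r Hr. apply (nondecreasing_deriv D dD r2 r Hr).
    - intros x Hx. eapply is_derive_continuity, HD; lra.
    - intros x Hx. apply HD; lra.
    - intros x Hx. specialize (HdD x ltac:(lra)).
      destruct (Hr2 x ltac:(lra)) as [Hx1 _]. specialize (HD0 x Hx1). lra. }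
  (* A lower bound for D' on the whole of [r2, oo), positive through al2 - al1 in one case of the
     hypothesis and through D r2 in the other. *)
  set (c := / 4 * D r2 + / 2 * (al2 - al1)).
  assert (Hc : 0 < c).
  { unfold c. specialize (HD0 r2 Hr12) as Hd0. destruct Hor as [Hlt|Hlt]; [lra|].
    assert (0 < D r2); [|lra].
    destruct (critical_mom al1 th1 j r1 ltac:(lra) Hr1 C1 r2 Hr12) as [In1 _].
    destruct (critical_mom al2 th2 j r1 ltac:(lra) Hr1 C2 r2 Hr12) as [In2 _].
    destruct (mom_antitone th1 th2 j r2) as [_ A]; [lra|assumption|assumption|].
    specialize (A (Hlt r2 (Hge r2 Hr12))). unfold D. lra. }
  destruct (linear_growth D dD c r2 (2 * al1) Hc HD) as [r [Hr HB]].
  { intros r Hr. specialize (HdD r Hr). specialize (Hmono r Hr). unfold c. lra. }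
  destruct (Hr2 r Hr) as [Hr' _].
  destruct (critical_mom al1 th1 j r1 ltac:(lra) Hr1 C1 r Hr') as [_ M1].
  destruct (critical_mom al2 th2 j r1 ltac:(lra) Hr1 C2 r Hr') as [_ M2].
  unfold D in HB. lra.
Qed.

Lemma is_derive_Rpower_mult (G dG : R -> R) (p r : R) :
  0 < r -> is_derive G r (dG r) ->
  is_derive (fun z => Rpower z p * G z) r (Rpower r p * (dG r + p / r * G r)).
Proof.
  intros Hr HG. eapply is_derive_eq.
  - apply (is_derive_mult_R (fun z => Rpower z p) G); [|exact HG].
    apply is_derive_Reals, derivable_pt_lim_power, Hr.
  - assert (E : Rpower r (p - 1) = Rpower r p / r).
    { unfold Rminus. rewrite Rpower_plus, Rpower_Ropp, Rpower_1 by exact Hr. reflexivity. }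
    rewrite E. field. lra.
Qed.

Lemma Rpower_pos x y : 0 < Rpower x y.
Proof. apply exp_pos. Qed.

(** From p >= 2 al the function r^(-2 al) G is nondecreasing, so r^(-al) G grows at least like r^al;
    the witness r is chosen with r^al = Z. *)
Lemma trapped_growth al th j r1 (G : R -> R) :
  0 < al -> 0 < r1 -> trapped al th j r1 ->
  (forall r, r1 <= r -> 0 < G r /\ is_derive G r (G r * (mom th j r / r))) ->
  forall M S0, exists r, S0 <= r /\ M < Rpower r (- al) * G r.
Proof.
  intros Hal Hr1 HT HG M S0.
  set (h := fun r => Rpower r (- (2 * al)) * G r).
  assert (Hd : forall r, r1 <= r -> is_derive h r
    (Rpower r (- (2 * al)) * (G r * (mom th j r / r) + - (2 * al) / r * G r))).
  { intros r Hr.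
    apply (is_derive_Rpower_mult G (fun r => G r * (mom th j r / r))); [lra|apply HG, Hr]. }
  assert (Hm : forall r, r1 <= r -> h r1 <= h r).
  { intros r Hr. apply (nondecreasing_deriv h
      (fun r => Rpower r (- (2 * al)) * (G r * (mom th j r / r) + - (2 * al) / r * G r)) r1 r Hr).
    - intros x Hx. eapply is_derive_continuity, Hd; lra.
    - intros x Hx. apply Hd; lra.
    - intros x Hx. destruct (trapped_mom al th j r1 Hal Hr1 HT x ltac:(lra)) as [_ HP].
      destruct (HG x ltac:(lra)) as [HGx _].
      apply Rmult_le_pos; [left; apply Rpower_pos|].
      replace (G x * (mom th j x / x) + - (2 * al) / x * G x) with
        (G x * ((mom th j x - 2 * al) / x)) by (field; lra).
      apply Rmult_le_pos; [lra|]. apply Rdiv_le_0_compat; lra. }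
  assert (Hh1 : 0 < h r1).
  { apply Rmult_lt_0_compat; [apply Rpower_pos|]. apply HG. lra. }
  set (r0 := Rmax r1 S0). set (Z := Rabs M / h r1 + Rpower r0 al + 1).
  assert (Hr0 : r1 <= r0 /\ S0 <= r0) by (split; [apply Rmax_l|apply Rmax_r]).
  assert (HMh : 0 <= Rabs M / h r1) by (apply Rdiv_le_0_compat; [apply Rabs_pos|exact Hh1]).
  pose proof (Rpower_pos r0 al).
  assert (HZ : 0 < Z) by (unfold Z; lra).
  set (r := Rpower Z (/ al)).
  assert (Er : Rpower r al = Z).
  { unfold r. rewrite Rpower_mult, Rinv_l, Rpower_1 by lra. reflexivity. }
  assert (Hrr : r0 <= r).
  { apply Rnot_lt_le. intros Hlt.
    assert (Rpower r al <= Rpower r0 al).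
    { apply Rle_Rpower_l; [lra|]. split; [apply Rpower_pos|lra]. }
    rewrite Er in H0. unfold Z in H0. lra. }
  exists r. split; [lra|].
  assert (E : Rpower r (- al) * G r = Z * h r).
  { unfold h. rewrite <- Er, <- Rmult_assoc, <- Rpower_plus. f_equal. f_equal. ring. }
  rewrite E. apply Rlt_le_trans with (Z * h r1).
  - apply Rle_lt_trans with (Rabs M / h r1 * h r1).
    + replace (Rabs M / h r1 * h r1) with (Rabs M) by (field; lra). apply Rle_abs.
    + apply Rmult_lt_compat_r; [exact Hh1|unfold Z; lra].
  - apply Rmult_le_compat_l; [lra|]. apply Hm. lra.
Qed.

(* By the equation for p, (p - alpha) / r is the derivative of p / (c r^2) up to O(1 / r^3). *)
Lemma critical_growth n al th j r1 (G : R -> R) :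
  0 < al -> 1 <= r1 -> (forall r, r1 <= r -> phase_at n al th r) -> critical al th j r1 ->
  (forall r, r1 <= r -> 0 < G r /\ is_derive G r (G r * (mom th j r / r))) ->
  exists M, forall r, r1 <= r -> Rpower r (- al) * G r <= M.
Proof.
  intros Hal HR Hp C HG. pose proof (pos_INR n) as Hn. pose proof (ccell_bounds j) as Hcc.
  set (c := ccell j) in *. set (p := mom th j).
  assert (HP : forall r, r1 <= r -> in_cell j (th r) /\ 0 < p r < 2 * al).
  { apply (critical_mom al th j r1 Hal); [lra|exact C]. }
  (* [K] bounds (n + 1 + p) p, the numerator of the remainder of order 1 / r^3 in the logarithmic
     derivative of h e; the weight [e] contributes - 2 K / (c r^3), which dominates it. *)
  set (K := (INR n + 1 + 2 * al) * (2 * al)).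
  set (dp := fun r => (c * r ^ 2 * (p r - al) + (1 - INR n) * p r - p r ^ 2) / r).
  set (h := fun r => Rpower r (- al) * G r).
  set (dh := fun r => Rpower r (- al) * (G r * (p r / r) + - al / r * G r)).
  set (e := fun r => exp ((K - p r) * / (c * r ^ 2))).
  set (de := fun r => (0 - dp r) * / (c * r ^ 2) + (K - p r) * (- 2 / (c * r ^ 3))).
  assert (Hhe : forall r, r1 <= r ->
    is_derive (fun z => - (h z * e z)) r (- (dh r * e r + h r * (de r * e r)))).
  { intros r Hr. apply is_derive_opp_R, is_derive_mult_R.
    - apply (is_derive_Rpower_mult G (fun r => G r * (p r / r))); [lra|apply HG, Hr].
    - apply (is_derive_exp_comp (fun z => (K - p z) * / (c * z ^ 2))).
      apply (is_derive_mult_R (fun z => K - p z) (fun z => / (c * z ^ 2))).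
      + apply is_derive_minus_R; [apply (is_derive_const K)|].
        apply mom_derive; [lra|apply Hp, Hr|apply HP, Hr].
      + auto_derive; [apply Rmult_integral_contrapositive_currified; nra|]. field. lra. }
  exists (h r1 * e r1 * exp (4 * al)). intros r Hr.
  assert (Hm : - (h r1 * e r1) <= - (h r * e r)).
  { apply (nondecreasing_deriv (fun z => - (h z * e z))
      (fun x => - (dh x * e x + h x * (de x * e x))) r1 r Hr).
    - intros x Hx. eapply is_derive_continuity, Hhe; lra.
    - intros x Hx. apply Hhe; lra.
    - intros x Hx. destruct (HP x ltac:(lra)) as [_ Hpx].
      destruct (HG x ltac:(lra)) as [HGx _]. pose proof (Rpower_pos x (- al)).
      replace (- (dh x * e x + h x * (de x * e x))) with
        (e x * (Rpower x (- al) * G x * ((2 * K - (INR n + 1 + p x) * p x) / (c * x ^ 3))))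
        by (unfold dh, h, de, dp; field; lra).
      apply Rmult_le_pos; [left; apply exp_pos|].
      apply Rmult_le_pos; [apply Rmult_le_pos; lra|].
      apply Rdiv_le_0_compat; [|apply Rmult_lt_0_compat; [lra|apply pow_lt; lra]].
      assert ((INR n + 1 + p x) * p x <= K) by (unfold K; apply Rmult_le_compat; lra).
      assert (0 <= K) by (unfold K; apply Rmult_le_pos; lra). lra. }
  destruct (HP r Hr) as [_ Hpr].
  assert (Hh : 0 < h r) by (apply Rmult_lt_0_compat; [apply Rpower_pos|apply HG, Hr]).
  (* As c r^2 >= 1/2, K >= 0 and p < 2 al, the exponent in [e] is at least - 4 al. *)
  assert (He : 1 <= e r * exp (4 * al)).
  { unfold e. rewrite <- exp_plus. apply exp_ge_1.
    assert (0 <= K) by (unfold K; apply Rmult_le_pos; lra).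
    assert (Hq : 0 < / (c * r ^ 2) <= 2).
    { assert (/ 2 <= c * r ^ 2) by nra. split; [apply Rinv_0_lt_compat; lra|].
      rewrite <- (Rinv_inv 2). apply Rinv_le_contravar; lra. }
    nra. }
  fold (h r). assert (h r * 1 <= h r * (e r * exp (4 * al))) by (apply Rmult_le_compat_l; lra).
  pose proof (exp_pos (4 * al)).
  assert (h r * e r * exp (4 * al) <= h r1 * e r1 * exp (4 * al))
    by (apply Rmult_le_compat_r; lra). lra.
Qed.

(** * Thresholds in alpha *)

(** A negative start is a phase starting at pi, one cell further on, so the k-th sign change is the
    crossing of level [idx s + k]. *)
Definition idx (s : bool) : nat := if s then 0%nat else 1%nat.

Lemma th0_idx s : th0 s = INR (idx s) * PI.
Proof. destruct s; simpl; ring. Qed.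

(* The profile changes sign at least [k] times. *)
Definition reaches (n : nat) (s : bool) (k : nat) (al : R) : Prop :=
  exists r, 0 <= r /\ lev (idx s + k) < phase n al s r.

Lemma lev_le i j : (i <= j)%nat -> lev i <= lev j.
Proof.
  intros H. unfold lev. pose proof PI_RGT_0. apply le_INR in H.
  apply Rplus_le_compat_r, Rmult_le_compat_r; lra.
Qed.

Lemma lev_lt_inv i j : lev i < lev j -> (i < j)%nat.
Proof.
  intros H. destruct (Nat.le_gt_cases j i) as [Hle|]; [|assumption].
  apply lev_le in Hle. lra.
Qed.

(** [no_return] starts at a positive radius; for x = 0 the strict inequality is first carried a
    little to the right by continuity. *)
Lemma phase_persist n al s j x y :
  0 <= x <= y -> lev j < phase n al s x -> lev j < phase n al s y.
Proof.
  intros Hxy H. destruct (Req_dec x y) as [<-|Hne]; [exact H|].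
  destruct (continuity_pos_local (fun z => phase n al s z - lev j) x) as [d [Hd Hz]].
  - cont.
  - lra.
  - destruct (point_between_right x y d) as [x' [Hx' Hxd]]; [lra|exact Hd|].
    apply (no_return n al _ j x' y); [lra| |].
    + intros r Hr. apply phase_ode. lra.
    + specialize (Hz x' ltac:(lra)). lra.
Qed.

Lemma phase_start n al s r : 0 <= r -> lev (idx s) < phase n al s r.
Proof.
  intros Hr. apply phase_persist with 0; [lra|]. rewrite phase_0, th0_idx. unfold lev.
  pose proof PI_RGT_0. lra.
Qed.

Lemma phase_mono n al1 al2 s r :
  al1 <= al2 -> 0 <= r -> phase n al1 s r <= phase n al2 s r.
Proof.
  intros Hal Hr. apply (phase_le_from_0 n al1 al2 _ _ (th0 s) r Hr Hal (sin_th0 s)).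
  - intros x _. split; apply phase_continuity.
  - intros x Hx. split; apply phase_ode; lra.
  - apply phase_0.
  - apply phase_0.
Qed.

Lemma reaches_mono_al n s k al1 al2 : al1 <= al2 -> reaches n s k al1 -> reaches n s k al2.
Proof.
  intros Hal [r [Hr H]]. exists r. split; [exact Hr|].
  pose proof (phase_mono n al1 al2 s r Hal Hr). lra.
Qed.

Lemma reaches_mono_k n s k k' al : (k <= k')%nat -> reaches n s k' al -> reaches n s k al.
Proof.
  intros Hk [r [Hr H]]. exists r. split; [exact Hr|].
  pose proof (lev_le (idx s + k) (idx s + k') ltac:(lia)). lra.
Qed.

(** For alpha = 0 constants solve the alpha-equation, so beta = - N is the case of a Gaussian
    profile. Comparison with this constant phase separates al <= 0 from al >= 0. *)
Lemma const_phase n s r : phase_at n 0 (fun _ => th0 s) r.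
Proof.
  eapply is_derive_eq; [apply (is_derive_const (th0 s))|].
  unfold phase_rhs. rewrite sin_th0. unfold zero; simpl. ring.
Qed.

Lemma phase_nonpos n al s r : al <= 0 -> 0 <= r -> phase n al s r <= th0 s.
Proof.
  intros Hal Hr. apply (phase_le_from_0 n al 0 _ (fun _ => th0 s) (th0 s) r Hr Hal (sin_th0 s)).
  - intros x _. split; cont.
  - intros x Hx. split; [apply phase_ode; lra|apply const_phase].
  - apply phase_0.
  - reflexivity.
Qed.

Lemma phase_nonneg n al s r : 0 <= al -> 0 <= r -> th0 s <= phase n al s r.
Proof.
  intros Hal Hr. apply (phase_le_from_0 n 0 al (fun _ => th0 s) _ (th0 s) r Hr Hal (sin_th0 s)).
  - intros x _. split; cont.
  - intros x Hx. split; [apply const_phase|apply phase_ode; lra].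
  - reflexivity.
  - apply phase_0.
Qed.

(** For al > 0 the phase never goes below the centre of its first cell, and from there [push] drives
    it to the next level; for al <= 0 it never rises above that centre. This is the origin of the
    value - N in part (ii). *)
Lemma reaches_1 n s al : reaches n s 1 al <-> 0 < al.
Proof.
  split.
  - intros [r [Hr H]]. apply Rnot_le_lt. intros Hal.
    pose proof (phase_nonpos n al s r Hal Hr) as A.
    rewrite Nat.add_1_r, lev_S in H. rewrite th0_idx in A. unfold lev in H.
    pose proof PI_RGT_0. lra.
  - intros Hal.
    destruct (rcut_sqr n al (rcut n al) ltac:(lra) ltac:(lra)) as [H1 _].
    destruct (push n al al (phase n al s) (idx s) (rcut n al)) as [r [Hr H]]; [lra|lra| | |].
    + intros r Hr. apply phase_ode; lra.
    + rewrite <- th0_idx. apply phase_nonneg; lra.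
    + exists (r + 1). split; [lra|]. rewrite Nat.add_1_r.
      apply (no_return n al _ (S (idx s)) r); [lra| |exact H].
      intros z Hz. apply phase_ode; lra.
Qed.

(** The phases for al - 1 and al + 1 enclose all those in between, which gives one [r0] for every
    nearby parameter, as [phase_upper_bound] requires. *)
Lemma phase_cont_al n s al R eps :
  0 <= R -> 0 < eps ->
  exists d, 0 < d <= 1 /\ forall al', Rabs (al' - al) < d ->
    Rabs (phase n al' s R - phase n al s R) < eps.
Proof.
  intros HR He. destruct (Req_dec R 0) as [->|HR0].
  { exists 1. split; [lra|]. intros al' _. rewrite !phase_0, Rminus_diag, Rabs_R0. exact He. }
  destruct (near_start_exists (th0 s) (phase n (al - 1) s)) as [r1 [Hr1 N1]];
    [apply phase_continuity|apply phase_0|].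
  destruct (near_start_exists (th0 s) (phase n (al + 1) s)) as [r2 [Hr2 N2]];
    [apply phase_continuity|apply phase_0|].
  set (r0 := Rmin (Rmin r1 r2) R).
  assert (L : 0 < r0 /\ r0 <= r1 /\ r0 <= r2 /\ r0 <= R) by (unfold r0; minmax).
  assert (N : forall a, al - 1 <= a <= al + 1 -> near_start (th0 s) r0 (phase n a s)).
  { intros a Ha r Hr. specialize (N1 r ltac:(lra)). specialize (N2 r ltac:(lra)).
    pose proof (phase_mono n (al - 1) a s r ltac:(lra) ltac:(lra)).
    pose proof (phase_mono n a (al + 1) s r ltac:(lra) ltac:(lra)). lra. }
  set (K := 2 * exp ((4 * (Rabs al + 1) + 2 * R + 1 + 2 * (INR n / r0)) * R)).
  assert (HK : 0 < K) by (unfold K; pose proof (exp_pos ((4 * (Rabs al + 1) + 2 * R + 1 +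
    2 * (INR n / r0)) * R)); lra).
  assert (Hlip : forall a b, al - 1 <= a -> b <= al + 1 -> a <= b ->
    0 <= phase n b s R - phase n a s R <= K * (b - a)).
  { intros a b Ha Hb Hab. split.
    - pose proof (phase_mono n a b s R Hab HR). lra.
    - eapply Rle_trans.
      + apply (phase_upper_bound n a b _ _ (th0 s) r0 R); [lra|exact Hab|apply sin_th0| | | | | |].
        * intros x _. split; apply phase_continuity.
        * intros x Hx. split; apply phase_ode; lra.
        * intros x Hx. apply phase_mono; lra.
        * apply N; lra.
        * apply N; lra.
        * rewrite !phase_0. reflexivity.
      + unfold K. rewrite (Rmult_comm (2 * exp _)), <- (Rmult_assoc (b - a)), (Rmult_comm (b - a) 2).
        apply Rmult_le_compat_l; [lra|]. apply exp_nondecreasing.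
        rewrite Rminus_0_r. apply Rmult_le_compat_r; [lra|].
        assert (Rabs a <= Rabs al + 1).
        { replace a with (al + (a - al)) by ring. eapply Rle_trans; [apply Rabs_triang|].
          assert (Rabs (a - al) <= 1) by (apply Rabs_le; lra). lra. }
        lra. }
  exists (Rmin 1 (eps / K)). split.
  { split; [apply Rmin_pos; [lra|apply Rdiv_lt_0_compat; lra]|apply Rmin_l]. }
  intros al' Hal'. pose proof (Rmin_l 1 (eps / K)). pose proof (Rmin_r 1 (eps / K)).
  assert (HKe : K * Rabs (al' - al) < eps).
  { replace eps with (K * (eps / K)) by (field; lra). apply Rmult_lt_compat_l; lra. }
  pose proof (Rabs_def2 (al' - al) 1 ltac:(lra)) as Hb.
  destruct (Rle_lt_dec al al') as [Hle|Hlt].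
  - specialize (Hlip al al' ltac:(lra) ltac:(lra) Hle).
    rewrite (Rabs_right (al' - al)) in HKe by lra. rewrite Rabs_right by lra. lra.
  - specialize (Hlip al' al ltac:(lra) ltac:(lra) ltac:(lra)).
    rewrite (Rabs_left (al' - al)) in HKe by lra. rewrite Rabs_minus_sym, Rabs_right by lra. lra.
Qed.

Lemma reaches_open n s k al :
  reaches n s k al -> exists al', al' < al /\ reaches n s k al'.
Proof.
  intros [r [Hr H]].
  destruct (phase_cont_al n s al r (phase n al s r - lev (idx s + k)) Hr ltac:(lra))
    as [d [Hd Hc]].
  exists (al - d / 2). split; [lra|]. exists r. split; [exact Hr|].
  specialize (Hc (al - d / 2)). apply Rabs_def2 in Hc; [lra|].
  rewrite Rabs_left; lra.
Qed.

Lemma eventually_not_reaches n s k al j R :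
  0 <= R -> (forall r, R <= r -> phase n al s r <= lev (S j)) -> (S j <= idx s + k)%nat ->
  ~ reaches n s k al.
Proof.
  intros HR H Hj [r [Hr Hl]].
  pose proof (phase_persist n al s (idx s + k) r (Rmax r R)) as A.
  pose proof (Rmax_l r R). pose proof (Rmax_r r R).
  specialize (A ltac:(lra) Hl). specialize (H (Rmax r R) H1).
  apply lev_le in Hj. lra.
Qed.

Lemma phase_final n s al A :
  0 < al <= A -> exists j,
    (exists r1, rcut n A <= r1 /\ trapped al (phase n al s) j r1) \/
    critical al (phase n al s) j (rcut n A).
Proof.
  intros Hal. apply final_state; [exact Hal| | |].
  - intros r. apply phase_continuity.
  - intros r Hr. apply phase_ode, Hr.
  - assert (1 <= rcut n A) by (apply (rcut_sqr n A); lra).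
    pose proof (phase_start n al s (rcut n A) ltac:(lra)).
    pose proof (lev_le 0 (idx s) ltac:(lia)). lra.
Qed.

Lemma trapped_lt al th j r1 : 0 < al -> 0 < r1 -> trapped al th j r1 ->
  forall r, r1 <= r -> in_cell j (th r).
Proof. intros Hal Hr1 H r Hr. apply (trapped_mom al th j r1 Hal Hr1 H r Hr). Qed.

Lemma critical_lt al th j r1 : 0 < al -> 0 < r1 -> critical al th j r1 ->
  forall r, r1 <= r -> in_cell j (th r).
Proof. intros Hal Hr1 H r Hr. apply (critical_mom al th j r1 Hal Hr1 H r Hr). Qed.

Lemma phase_final_cell n s al :
  0 < al -> exists j R, 0 < R /\ forall r, R <= r -> in_cell j (phase n al s r).
Proof.
  intros Hal. assert (1 <= rcut n al) by (apply (rcut_sqr n al); lra).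
  destruct (phase_final n s al al ltac:(lra)) as [j [[r1 [Hr1 T]]|C]].
  - exists j, r1. split; [lra|]. apply (trapped_lt al); [lra|lra|exact T].
  - exists j, (rcut n al). split; [lra|]. apply (critical_lt al); [lra|lra|exact C].
Qed.

Lemma reaches_finite n s al : exists k, ~ reaches n s (S k) al.
Proof.
  destruct (Rle_lt_dec al 0) as [Hal|Hal].
  - exists 0%nat. rewrite reaches_1. lra.
  - destruct (phase_final_cell n s al Hal) as [j [R [HR H]]]. exists j.
    apply (eventually_not_reaches n s (S j) al j R); [lra| |lia].
    intros r Hr. left. apply H, Hr.
Qed.

Lemma exact_cell n s k al j R :
  0 < R -> (forall r, R <= r -> in_cell j (phase n al s r)) ->
  reaches n s k al -> ~ reaches n s (S k) al -> j = (idx s + k)%nat.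
Proof.
  intros HR Hc [r [Hr Hl]] Hn.
  assert (H1 : lev (idx s + k) < phase n al s (Rmax r R)).
  { apply phase_persist with r; [|exact Hl]. split; [exact Hr|apply Rmax_l]. }
  assert (H2 : phase n al s (Rmax r R) <= lev (idx s + S k)).
  { apply Rnot_lt_le. intros H. apply Hn. exists (Rmax r R). split; [|exact H].
    eapply Rle_trans; [exact Hr|apply Rmax_l]. }
  destruct (Hc (Rmax r R) (Rmax_r r R)) as [H3 H4].
  assert (A1 : (idx s + k < S j)%nat) by (apply lev_lt_inv; lra).
  assert (A2 : (j < idx s + S k)%nat) by (apply lev_lt_inv; lra).
  lia.
Qed.

(** With b the coefficient of sin * cos and al >= b^2 + 1/4, completing the square bounds the
    right-hand side below by (b cos + sin / 2)^2 + 1/4. *)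
Lemma phase_rhs_lower n al r R t :
  1 <= r <= R -> (R + INR n) ^ 2 + / 4 <= al -> / 4 <= phase_rhs n al r t.
Proof.
  intros Hr Hal. pose proof (pos_INR n) as Hn. pose proof (cof_bounds (cos t)) as Hc.
  pose proof (sin2_cos2 t) as E. unfold Rsqr in E.
  set (b := cof (cos t) * r - INR n / r).
  assert (Hb2 : b ^ 2 <= (R + INR n) ^ 2).
  { assert (0 <= INR n / r <= INR n).
    { split; [apply Rdiv_le_0_compat; lra|]. apply Rmult_le_reg_r with r; [lra|].
      unfold Rdiv. rewrite Rmult_assoc, Rinv_l by lra. nra. }
    rewrite <- pow2_abs. apply pow_incr. split; [apply Rabs_pos|].
    apply Rabs_le. unfold b. split; nra. }
  replace (phase_rhs n al r t) with
    (2 * cof (cos t) * al * (cos t * cos t) + b * (sin t * cos t) + / 2 * (sin t * sin t))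
    by (unfold phase_rhs, b; rewrite bpl_cof; field; lra).
  pose proof (pow2_ge_0 (b * cos t + / 2 * sin t)).
  assert (Hal1 : al <= 2 * cof (cos t) * al) by nra.
  assert ((b ^ 2 + / 4) * (cos t * cos t) <= 2 * cof (cos t) * al * (cos t * cos t))
    by (apply Rmult_le_compat_r; nra).
  nra.
Qed.

Lemma reaches_large n s k : exists al, 0 < al /\ reaches n s k al.
Proof.
  pose proof PI_RGT_0 as Hpi. pose proof (pos_INR k) as Hk.
  (* At speed 1/4 the interval [1, R] is just long enough for a gain of k pi. *)
  set (R := 1 + 4 * (INR k * PI)). set (al := (R + INR n) ^ 2 + / 4).
  assert (HR : 1 <= R) by (unfold R; nra).
  exists al. split; [unfold al; pose proof (pow2_ge_0 (R + INR n)); lra|].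
  exists R. split; [lra|].
  assert (Hd : forall r, 0 < r -> is_derive (fun z => phase n al s z - / 4 * z) r
    (phase_rhs n al r (phase n al s r) - / 4)).
  { intros r Hr. apply is_derive_minus_R; [apply phase_ode, Hr|auto_derive; [exact I|ring]]. }
  assert (A : phase n al s 1 - / 4 * 1 <= phase n al s R - / 4 * R).
  { apply (nondecreasing_deriv (fun z => phase n al s z - / 4 * z)
      (fun r => phase_rhs n al r (phase n al s r) - / 4) 1 R HR).
    - intros r Hr. eapply is_derive_continuity, Hd; lra.
    - intros r Hr. apply Hd; lra.
    - intros r Hr.
      pose proof (phase_rhs_lower n al r R (phase n al s r) ltac:(lra) ltac:(unfold al; lra)). lra. }
  pose proof (phase_start n al s 1 ltac:(lra)) as H1.
  unfold lev in *. rewrite plus_INR. unfold R in A at 2. lra.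
Qed.

(** For al' slightly above al the level of index k is still ahead at [R0], by continuity in alpha.
    Crossing it later leads into the trap, where no further level is reached. So sign changes appear
    one at a time as alpha grows. *)
Lemma reaches_jump n s k al :
  0 <= al -> ~ reaches n s k al -> exists al', al < al' /\ ~ reaches n s (S k) al'.
Proof.
  intros Hal Hn. set (A := al + 1). set (R0 := rcut n A).
  assert (HR0 : 1 <= R0) by (apply (rcut_sqr n A); unfold R0, A; lra).
  assert (Hlt : phase n al s R0 < lev (idx s + k)).
  { apply Rnot_le_lt. intros H. apply Hn. exists (R0 + 1). split; [lra|].
    apply (no_return n al _ _ R0); [lra| |exact H]. intros z Hz. apply phase_ode; lra. }
  destruct (phase_cont_al n s al R0 (lev (idx s + k) - phase n al s R0)) as [d [Hd Hc]]; [lra|lra|].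
  exists (al + d / 2). split; [lra|]. set (al' := al + d / 2).
  assert (Hlt' : phase n al' s R0 < lev (idx s + k)).
  { specialize (Hc al'). apply Rabs_def2 in Hc; [lra|]. unfold al'. rewrite Rabs_right; lra. }
  intros [r [Hr Hl]]. rewrite Nat.add_succ_r, lev_S in Hl. pose proof PI_RGT_0.
  assert (Hrr : R0 <= r).
  { apply Rnot_lt_le. intros H0.
    pose proof (phase_persist n al' s (idx s + k) r R0 ltac:(lra) ltac:(lra)). lra. }
  assert (T : trapped al' (phase n al' s) (idx s + k) (r + 1)).
  { apply (level_reached_trapped n al' A _ _ R0 r).
    - unfold A, al'. lra.
    - unfold R0 in *. lra.
    - intros z. apply phase_continuity.
    - intros z Hz. apply phase_ode, Hz.
    - lra. }
  pose proof (trapped_lt al' _ _ (r + 1) ltac:(unfold al'; lra) ltac:(lra) T (r + 1) ltac:(lra)) as [_ H1].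
  pose proof (phase_persist n al' s (S (idx s + k)) r (r + 1) ltac:(lra)) as H2.
  rewrite lev_S in H1, H2. specialize (H2 Hl). lra.
Qed.

(* [a] is alpha_k: at most [k] sign changes up to [a], more beyond. *)
Definition threshold (n : nat) (s : bool) (k : nat) (a : R) : Prop :=
  forall al, reaches n s (S k) al <-> a < al.

(** The supremum of the parameters that fail to reach the level; it fails as well, because reaching
    is an open condition. *)
Lemma threshold_exists n s k : exists a, threshold n s k a.
Proof.
  destruct (reaches_large n s (S k)) as [b [Hb Hreach]].
  destruct (completeness (fun al => ~ reaches n s (S k) al)) as [a [Hub Hlub]].
  - exists b. intros x Hx. apply Rnot_lt_le. intros H. apply Hx.
    apply (reaches_mono_al n s (S k) b); [lra|exact Hreach].
  - exists 0. intros H. apply (reaches_mono_k n s 1 (S k)) in H; [|lia].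
    apply reaches_1 in H. lra.
  - exists a. intros al. split.
    + intros H. destruct (reaches_open n s (S k) al H) as [al' [Hlt H']].
      apply Rlt_le_trans with (2 := Rle_refl al). apply Rle_lt_trans with al'; [|exact Hlt].
      apply Hlub. intros x Hx. apply Rnot_lt_le. intros Hxx. apply Hx.
      apply (reaches_mono_al n s (S k) al'); [lra|exact H'].
    + intros H. apply NNPP. intros Hn. apply Hub in Hn. lra.
Qed.

Lemma threshold_unique n s k a a' : threshold n s k a -> threshold n s k a' -> a = a'.
Proof.
  intros H H'. destruct (Rtotal_order a a') as [Hlt|[E|Hgt]]; [|exact E|].
  - apply H, H' in Hlt. lra.
  - apply H', H in Hgt. lra.
Qed.

Lemma threshold_nonneg n s k a : threshold n s k a -> 0 <= a.
Proof.
  intros H. apply Rnot_lt_le. intros Ha. apply H in Ha.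
  apply (reaches_mono_k n s 1) in Ha; [|lia]. apply reaches_1 in Ha. lra.
Qed.

Lemma threshold_lt n s k a a' : threshold n s k a -> threshold n s (S k) a' -> a < a'.
Proof.
  intros H H'. destruct (reaches_jump n s (S k) a) as [al [Hlt Hn]].
  - apply (threshold_nonneg n s k a H).
  - rewrite (H a). lra.
  - assert (al <= a'); [|lra]. apply Rnot_lt_le. intros Hl. apply Hn, H', Hl.
Qed.

Lemma threshold_reaches n s k a :
  threshold n s (S k) a -> 0 < a /\ reaches n s (S k) a /\ ~ reaches n s (S (S k)) a.
Proof.
  intros H. destruct (threshold_exists n s k) as [a' H'].
  pose proof (threshold_lt n s k a' a H' H). pose proof (threshold_nonneg n s k a' H').
  split; [lra|]. split; [apply H'; exact H0|]. rewrite (H a). lra.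
Qed.

(** If the phase at a were trapped, continuity in alpha at a single radius would trap it for a + h
    in the same cell, without a new sign change, against the meaning of the threshold. Only the
    critical case of [phase_final] remains. *)
Lemma threshold_critical n s k a :
  threshold n s (S k) a ->
  exists R, 0 < R /\ critical a (phase n a s) (idx s + S k) R.
Proof.
  intros H. destruct (threshold_reaches n s k a H) as [Ha [Hr Hn]].
  set (A := a + 1). set (R0 := rcut n A).
  assert (HR0 : 1 <= R0) by (apply (rcut_sqr n A); unfold R0, A; lra).
  destruct (phase_final n s a A ltac:(unfold A; lra)) as [j [[r1 [Hr1 T]]|C]].
  - exfalso. fold R0 in Hr1.
    assert (Ej : j = (idx s + S k)%nat).
    { apply (exact_cell n s (S k) a j r1); [lra| |exact Hr|exact Hn].
      apply (trapped_lt a); [lra|lra|exact T]. }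
    (* At [r1] the trap inequality may be an equality; one unit later it is strict, hence stable
       under small changes of alpha. *)
    set (r2 := r1 + 1).
    assert (Hs : phase n a s r2 < INR j * PI - atan (4 * a / r2)).
    { apply (trap n a A _ j r1); [unfold A; lra|exact Hr1| |apply T; lra|unfold r2; lra].
      intros z Hz. apply phase_ode; lra. }
    set (eps := INR j * PI - atan (4 * a / r2) - phase n a s r2) in *.
    destruct (phase_cont_al n s a r2 (eps / 2)) as [d [Hd Hc]]; [unfold r2; lra|unfold eps; lra|].
    destruct (continuity_pos_local
      (fun x => eps / 2 - (atan (4 * x / r2) - atan (4 * a / r2))) a) as [d2 [Hd2 Hc2]].
    { cont. unfold r2. lra. }
    { unfold eps. lra. }
    set (h := Rmin (d / 2) (d2 / 2)).
    assert (Hh : 0 < h <= d / 2 /\ h <= d2 / 2).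
    { unfold h. split; [split; [apply Rmin_pos; lra|apply Rmin_l]|apply Rmin_r]. }
    assert (Hreach : reaches n s (S (S k)) (a + h)) by (apply H; lra).
    revert Hreach. apply (eventually_not_reaches n s (S (S k)) (a + h) j (r2 + 1)); [unfold r2; lra| |lia].
    intros r Hr2. specialize (Hc (a + h)). specialize (Hc2 (a + h) ltac:(lra)). cbv beta in Hc2.
    apply Rabs_def2 in Hc; [|rewrite Rabs_right; lra].
    assert (Htr : phase n (a + h) s r < INR j * PI - atan (4 * (a + h) / r)).
    { apply (trap n (a + h) A _ j r2); [unfold A; lra|unfold r2, R0 in *; lra| | |lra].
      - intros z Hz. apply phase_ode. unfold r2 in Hz; lra.
      - unfold eps in *. lra. }
    assert (0 <= 4 * (a + h) / r) by (apply Rdiv_le_0_compat; unfold r2 in *; lra).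
    pose proof (atan_nonneg _ H0). rewrite lev_S. unfold lev. pose proof PI_RGT_0. lra.
  - exists R0. split; [lra|].
    replace (idx s + S k)%nat with j; [exact C|].
    apply (exact_cell n s (S k) a j R0); [lra| |exact Hr|exact Hn].
    apply (critical_lt a); [lra|lra|exact C].
Qed.

(** The threshold a with the same number of sign changes is critical in the same cell, so al < a
    would contradict [critical_unique]. *)
Lemma critical_threshold n s k al j R :
  0 < al -> 0 < R -> critical al (phase n al s) j R ->
  reaches n s (S k) al -> ~ reaches n s (S (S k)) al -> threshold n s (S k) al.
Proof.
  intros Hal HR C Hr Hn. destruct (threshold_exists n s (S k)) as [a Ha].
  destruct (threshold_critical n s k a Ha) as [R' [HR' C']].
  assert (Ej : j = (idx s + S k)%nat).
  { apply (exact_cell n s (S k) al j R); [exact HR| |exact Hr|exact Hn].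
    apply (critical_lt al); assumption. }
  subst j.
  assert (Hle : al <= a) by (apply Rnot_lt_le; intros H; apply Hn, Ha, H).
  destruct Hle as [Hlt|E]; [exfalso|subst al; exact Ha].
  apply (critical_unique n al a (phase n al s) (phase n a s) (idx s + S k) 1 R R');
    try assumption; try lra.
  - intros r Hr1. apply phase_ode; lra.
  - intros r Hr1. apply phase_ode; lra.
  - intros r Hr1. apply phase_mono; lra.
Qed.

(** * Interlacing, and the explicit case alpha = 2 *)

Lemma phase_at_shift n al th r :
  phase_at n al th r -> phase_at n al (fun z => th z + 2 * PI) r.
Proof.
  intros H. eapply is_derive_eq.
  - apply is_derive_plus_R; [exact H|apply (is_derive_const (2 * PI))].
  - unfold phase_rhs.
    replace (cos (th r + 2 * PI)) with (cos (th r)) by (rewrite cos_plus, cos_2PI, sin_2PI; ring).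
    replace (sin (th r + 2 * PI)) with (sin (th r)) by (rewrite sin_plus, cos_2PI, sin_2PI; ring).
    unfold zero; simpl. ring.
Qed.

Lemma critical_shift al th j R :
  critical al th j R -> critical al (fun z => th z + 2 * PI) (j + 2) R.
Proof.
  intros H r Hr. specialize (H r Hr). rewrite plus_INR. simpl. lra.
Qed.

Lemma phase_lt_from_0 n al th1 th2 r :
  0 <= r -> continuity th1 -> continuity th2 ->
  (forall r, 0 < r -> phase_at n al th1 r) -> (forall r, 0 < r -> phase_at n al th2 r) ->
  th1 0 < th2 0 -> th1 r < th2 r.
Proof.
  intros Hr C1 C2 P1 P2 H0.
  destruct (Req_dec r 0) as [->|Hne]; [exact H0|].
  destruct (continuity_pos_local (fun z => th2 z - th1 z) 0) as [d [Hd H]].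
  - cont; [apply C2|apply C1].
  - lra.
  - destruct (point_between_right 0 r d) as [x [Hx Hxd]]; [lra|exact Hd|].
    apply (phase_lt n al al th1 th2 x r); [lra|lra| | |].
    + intros z _. split; [apply C1|apply C2].
    + intros z Hz. split; [apply P1; lra|apply P2; lra].
    + specialize (H x). lra.
Qed.

Lemma phase_continuous n al s : continuity (phase n al s).
Proof. intros r. apply phase_continuity. Qed.

Lemma phase_true_lt_false n al r : 0 <= r -> phase n al true r < phase n al false r.
Proof.
  intros Hr. apply (phase_lt_from_0 n al); try apply phase_continuous; try apply phase_ode.
  - exact Hr.
  - rewrite !phase_0. simpl. apply PI_RGT_0.
Qed.

Lemma phase_false_lt_true n al r : 0 <= r -> phase n al false r < phase n al true r + 2 * PI.
Proof.
  intros Hr. apply (phase_lt_from_0 n al (phase n al false) (fun z => phase n al true z + 2 * PI)).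
  - exact Hr.
  - apply phase_continuous.
  - intros z. cont.
  - apply phase_ode.
  - intros z Hz. apply phase_at_shift, phase_ode, Hz.
  - rewrite !phase_0. simpl. pose proof PI_RGT_0. lra.
Qed.

(** The starts 0 < pi < 2 pi keep the phases for +, for -, and for + after a full turn in strict
    order, so changing the initial sign alters the number of sign changes by at most one; hence a <=
    a'. Equality would give two strictly ordered critical phases for the same alpha in the same
    cell. *)
Lemma interlacing n s k a a' :
  threshold n s (S k) a -> threshold n (negb s) (S (S k)) a' -> a < a'.
Proof.
  intros H H'. pose proof PI_RGT_0 as Hpi.
  destruct (threshold_reaches n s k a H) as [Ha [_ Hn]].
  assert (Hle : a <= a').
  { apply Rnot_lt_le. intros Hlt. apply H' in Hlt. apply Hn.
    destruct Hlt as [r [Hr Hl]]. exists r. split; [exact Hr|].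
    destruct s; simpl negb in *; simpl idx in *; simpl Nat.add in *.
    - pose proof (phase_false_lt_true n a r Hr). repeat rewrite lev_S in Hl. repeat rewrite lev_S. lra.
    - pose proof (phase_true_lt_false n a r Hr). lra. }
  destruct Hle as [Hlt|E]; [exact Hlt|exfalso; subst a'].
  destruct (threshold_critical n s k a H) as [R [HR C]].
  destruct (threshold_critical n (negb s) (S k) a H') as [R' [HR' C']].
  destruct s; simpl negb in *; simpl idx in *; simpl Nat.add in *.
  (* The full turn moves the critical phase started at 0 from cell k + 1 to cell k + 3, that of the
     phase started at pi. *)
  - apply critical_shift in C. replace (S k + 2)%nat with (S (S (S k))) in C by lia.
    apply (critical_unique n a a (phase n a false) (fun z => phase n a true z + 2 * PI)
      (S (S (S k))) 1 R' R); try assumption; try lra.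
    + intros r Hr. apply phase_ode; lra.
    + intros r Hr. apply phase_at_shift, phase_ode; lra.
    + intros r Hr. left. apply phase_false_lt_true; lra.
    + right. intros r Hr. apply phase_false_lt_true; lra.
  - apply (critical_unique n a a (phase n a true) (phase n a false) (S (S k)) 1 R' R);
      try assumption; try lra.
    + intros r Hr. apply phase_ode; lra.
    + intros r Hr. apply phase_ode; lra.
    + intros r Hr. left. apply phase_true_lt_false; lra.
    + right. intros r Hr. apply phase_true_lt_false; lra.
Qed.

(* For alpha = 2 the equation in cell [j] is solved by r^2 - d with [ccell j * d = N];
   its phase is [hphase j d]. *)
Definition hphase (j : nat) (d r : R) : R := INR j * PI + atan (- (4 * r) / (r ^ 2 - d)).

Lemma hphase_ode n j d r :
  0 < r -> r ^ 2 <> d -> ccell j * d = INR n + 1 -> phase_at n 2 (hphase j d) r.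
Proof.
  intros Hr Hne Hd. unfold phase_at.
  assert (Hne' : r ^ 2 - d <> 0) by lra.
  set (T := - (4 * r) / (r ^ 2 - d)).
  pose proof (pow2_ge_0 T) as HT.
  assert (E : phase_rhs n 2 r (hphase j d r) =
    (4 * r ^ 2 + 4 * d) / (r ^ 2 - d) ^ 2 * / (1 + T ^ 2)).
  { apply Rmult_eq_reg_r with (1 + T ^ 2); [|lra].
    unfold hphase. fold T. rewrite phase_rhs_atan.
    replace ((4 * r ^ 2 + 4 * d) / (r ^ 2 - d) ^ 2 * / (1 + T ^ 2) * (1 + T ^ 2)) with
      ((4 * r ^ 2 + 4 * d) / (r ^ 2 - d) ^ 2) by (field; lra).
    unfold T.
    transitivity ((4 * (INR n - ccell j * d) * (r ^ 2 - d) + 8 * r ^ 2) / (r ^ 2 - d) ^ 2);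
      [field; split; lra|]. rewrite Hd. field. exact Hne'. }
  rewrite E. unfold hphase. eapply is_derive_eq.
  - apply is_derive_plus_R; [apply (is_derive_const (INR j * PI))|].
    apply (is_derive_comp_R atan (fun z => - (4 * z) / (z ^ 2 - d))); [apply is_derive_atan|].
    assert (D : is_derive (fun z => - (4 * z) / (z ^ 2 - d)) r
      ((4 * r ^ 2 + 4 * d) / (r ^ 2 - d) ^ 2)).
    { auto_derive; [simpl in Hne'; exact Hne'|]. field. exact Hne'. }
    exact D.
  - cbv beta. fold T. unfold Rsqr. replace (T * T) with (T ^ 2) by ring. apply Rplus_0_l.
Qed.

(** [hphase] jumps at the zero r^2 = d. This form of the branch beyond the zero, and the next one
    for the branch before it, extend continuously to the zero, with values [lev j] and
    [lev (S j)]. *)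
Lemma hphase_above j d r :
  0 < r -> d < r ^ 2 -> hphase j d r = lev j + atan ((r ^ 2 - d) / (4 * r)).
Proof.
  intros Hr Hd. unfold hphase, lev.
  replace (- (4 * r) / (r ^ 2 - d)) with (- / ((r ^ 2 - d) / (4 * r))) by (field; lra).
  rewrite atan_opp, atan_inv; [lra|]. apply Rdiv_lt_0_compat; lra.
Qed.

Lemma hphase_below j d r :
  0 < r -> r ^ 2 < d -> hphase j d r = lev (S j) - atan ((d - r ^ 2) / (4 * r)).
Proof.
  intros Hr Hd. rewrite lev_S. unfold hphase, lev.
  replace (- (4 * r) / (r ^ 2 - d)) with (/ ((d - r ^ 2) / (4 * r))) by (field; lra).
  rewrite atan_inv; [lra|]. apply Rdiv_lt_0_compat; lra.
Qed.

Lemma hphase_continuity j d r : r ^ 2 <> d -> continuity_pt (hphase j d) r.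
Proof.
  intros Hne. unfold hphase. cont. lra.
Qed.

(** Here p = 2 r^2 / (r^2 - d), and p < 4 = 2 alpha amounts to r^2 > 2 d. *)
Lemma hphase_critical j d R :
  0 < R -> 0 < d -> 2 * d < R ^ 2 -> critical 2 (hphase j d) j R.
Proof.
  intros HR Hd HRd r Hr.
  assert (Hr2 : R ^ 2 <= r ^ 2) by (apply pow_incr; lra).
  unfold hphase. replace (- (4 * r) / (r ^ 2 - d)) with (- (4 * r / (r ^ 2 - d))) by (field; lra).
  rewrite atan_opp.
  assert (H1 : 4 * r / (r ^ 2 - d) < 4 * 2 / r).
  { apply Rmult_lt_reg_r with (r * (r ^ 2 - d)); [nra|].
    replace (4 * r / (r ^ 2 - d) * (r * (r ^ 2 - d))) with (4 * r ^ 2) by (field; lra).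
    replace (4 * 2 / r * (r * (r ^ 2 - d))) with (8 * (r ^ 2 - d)) by (field; lra). lra. }
  assert (H2 : 0 < 4 * r / (r ^ 2 - d)) by (apply Rdiv_lt_0_compat; lra).
  apply atan_increasing in H1, H2. rewrite atan_0 in H2. lra.
Qed.

Lemma hphase_0 j d : hphase j d 0 = INR j * PI.
Proof.
  unfold hphase. replace (- (4 * 0) / (0 ^ 2 - d)) with 0 by (unfold Rdiv; ring).
  rewrite atan_0. ring.
Qed.

Lemma ccell_even j : Nat.even j = true -> ccell j = / 2.
Proof. intros E. unfold ccell, par, cof. rewrite E. destruct (Rlt_dec 1 0); lra. Qed.

Lemma ccell_odd j : Nat.even j = false -> ccell j = 1.
Proof. intros E. unfold ccell, par, cof. rewrite E. destruct (Rlt_dec (-1) 0); lra. Qed.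

(* For alpha = 2 the first branch is the explicit solution itself. *)
Lemma phase_2_first_zero n s d :
  0 < d -> ccell (idx s) * d = INR n + 1 -> phase n 2 s (sqrt d) = lev (S (idx s)).
Proof.
  intros Hd Hcd. set (y := sqrt d).
  assert (Hy : 0 < y) by (apply sqrt_lt_R0, Hd).
  assert (Hy2 : y ^ 2 = d) by (apply pow2_sqrt; lra).
  assert (Hsq : forall r, 0 <= r < y -> r ^ 2 < d) by (intros r Hr; rewrite <- Hy2; simpl; nra).
  assert (E : phase n 2 s y - (lev (S (idx s)) - atan ((d - y ^ 2) / (4 * y))) = 0).
  { apply (continuity_eq_limit
      (fun r => phase n 2 s r - (lev (S (idx s)) - atan ((d - r ^ 2) / (4 * r)))) 0 y 0 Hy).
    - cont. lra.
    - intros b Hb. rewrite <- hphase_below; [|lra|apply Hsq; lra].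
      assert (Hc : forall r, 0 <= r <= b ->
        continuity_pt (phase n 2 s) r /\ continuity_pt (hphase (idx s) d) r).
      { intros r Hr. specialize (Hsq r ltac:(lra)).
        split; [apply phase_continuity|apply hphase_continuity; lra]. }
      assert (Hp : forall r, 0 < r < b -> phase_at n 2 (phase n 2 s) r /\
        phase_at n 2 (hphase (idx s) d) r).
      { intros r Hr. specialize (Hsq r ltac:(lra)).
        split; [apply phase_ode; lra|apply hphase_ode; lra]. }
      assert (H0 : hphase (idx s) d 0 = th0 s) by (rewrite hphase_0, th0_idx; reflexivity).
      enough (phase n 2 s b = hphase (idx s) d b) by lra.
      apply Rle_antisym; apply (phase_le_from_0 n 2 2 _ _ (th0 s) b); try lra;
        try apply sin_th0; try apply phase_0; auto; intros r Hr.
      + destruct (Hc r Hr). split; assumption.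
      + destruct (Hp r Hr). split; assumption. }
  rewrite Hy2, Rminus_diag in E. unfold Rdiv in E. rewrite Rmult_0_l, atan_0 in E. lra.
Qed.

(* Starting positive, the second branch stays behind the critical one r^2 - N. *)
Lemma threshold_true_1 n a : threshold n true 1 a -> 2 < a.
Proof.
  intros H. pose proof (pos_INR n) as Hn. pose proof PI_RGT_0 as Hpi.
  (* The profile starts positive, with c = 1/2, and first vanishes at z^2 = 2 N. The comparison
     solution of the next cell, with c = 1, vanishes earlier, at r^2 = N, so at z its phase is
     already ahead. *)
  set (d0 := 2 * (INR n + 1)). set (d1 := INR n + 1). set (z := sqrt d0).
  assert (Hz : 0 < z) by (apply sqrt_lt_R0; unfold d0; lra).
  assert (Hz2 : z ^ 2 = d0) by (apply pow2_sqrt; unfold d0; lra).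
  set (th := phase n 2 true).
  assert (A0 : th z = lev 1).
  { apply phase_2_first_zero; [unfold d0; lra|].
    rewrite ccell_even by reflexivity. unfold d0. field. }
  assert (Hd1 : forall r, z <= r -> d1 < r ^ 2).
  { intros r Hr. assert (z ^ 2 <= r ^ 2) by (apply pow_incr; lra). unfold d0, d1 in *. lra. }
  assert (B : forall r, z <= r -> th r < hphase 1 d1 r).
  { intros r Hr. apply (phase_lt n 2 2 th (hphase 1 d1) z r); try lra.
    - intros x Hx. specialize (Hd1 x ltac:(lra)). split; [apply phase_continuity|].
      apply hphase_continuity. lra.
    - intros x Hx. specialize (Hd1 x ltac:(lra)). split; [apply phase_ode; lra|].
      apply hphase_ode; [lra|lra|]. rewrite ccell_odd by reflexivity. unfold d1. ring.
    - specialize (Hd1 z ltac:(lra)). rewrite hphase_above by lra.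
      assert (0 < atan ((z ^ 2 - d1) / (4 * z))); [|lra].
      rewrite <- atan_0. apply atan_increasing, Rdiv_lt_0_compat; lra. }
  set (R := z + 2 * d1 + 1).
  assert (HR : 2 * d1 < R ^ 2) by (unfold R, d1; simpl; nra).
  assert (HR0 : z <= R /\ 0 < d1) by (unfold R, d1; lra).
  assert (C : critical 2 (hphase 1 d1) 1 R) by (apply hphase_critical; lra).
  (* Lying below a critical phase excludes the next level, whence 2 <= a; equality is then refuted
     by uniqueness of the critical phase. *)
  assert (Hle : 2 <= a).
  { apply Rnot_lt_le. intros Hlt. apply H in Hlt. revert Hlt.
    apply (eventually_not_reaches n true 2 2 1 R); [lra| |simpl; lia].
    intros r Hr. specialize (B r ltac:(lra)). destruct (C r Hr) as [_ C2].
    fold th. unfold lev. simpl INR in *. lra. }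
  destruct Hle as [Hlt|E]; [exact Hlt|exfalso; subst a].
  destruct (threshold_critical n true 0 2 H) as [R' [HR' C']].
  apply (critical_unique n 2 2 th (hphase 1 d1) 1 z R' R); try assumption; try lra.
  - intros r Hr. apply phase_ode; lra.
  - intros r Hr. specialize (Hd1 r Hr).
    apply hphase_ode; [lra|lra|]. rewrite ccell_odd by reflexivity. unfold d1. ring.
  - intros r Hr. left. apply B, Hr.
  - right. exact B.
Qed.

(* Starting negative, the second branch is ahead of the critical one r^2 - 2 N. *)
Lemma threshold_false_1 n a : threshold n false 1 a -> a < 2.
Proof.
  intros H. pose proof (pos_INR n) as Hn. pose proof PI_RGT_0 as Hpi.
  set (d0 := 2 * (INR n + 1)). set (d1 := INR n + 1). set (z := sqrt d0). set (y := sqrt d1).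
  assert (Hz : 0 < z) by (apply sqrt_lt_R0; unfold d0; lra).
  assert (Hz2 : z ^ 2 = d0) by (apply pow2_sqrt; unfold d0; lra).
  assert (Hy : 0 < y) by (apply sqrt_lt_R0; unfold d1; lra).
  assert (Hyz : y < z) by (apply sqrt_lt_1; unfold d0, d1; lra).
  set (th := phase n 2 false).
  assert (A0 : th y = lev 2).
  { apply phase_2_first_zero; [unfold d1; lra|].
    rewrite ccell_odd by reflexivity. unfold d1. ring. }
  assert (A1 : lev 2 < th z).
  { apply (no_return n 2 th 2 y z); [lra| |lra]. intros r Hr. apply phase_ode; lra. }
  assert (Hd0 : forall r, z < r -> d0 < r ^ 2).
  { intros r Hr. rewrite <- Hz2. simpl. nra. }
  assert (Hode : forall r, z < r -> phase_at n 2 (hphase 2 d0) r).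
  { intros r Hr. specialize (Hd0 r Hr). apply hphase_ode; [lra|lra|].
    rewrite ccell_even by reflexivity. unfold d0. field. }
  (* [psi] is the comparison branch extended to its own zero z, where it equals [lev 2], a level
     that [th] has already passed. *)
  set (psi := fun r => lev 2 + atan ((r ^ 2 - d0) / (4 * r))).
  assert (Epsi : forall r, z < r -> hphase 2 d0 r = psi r).
  { intros r Hr. specialize (Hd0 r Hr). apply hphase_above; lra. }
  assert (B : forall r, z < r -> hphase 2 d0 r < th r).
  { intros r Hr. rewrite Epsi by exact Hr.
    apply (phase_lt n 2 2 psi th z r); try lra.
    - intros x Hx. split; [unfold psi; cont; lra|apply phase_continuity].
    - intros x Hx. split; [|apply phase_ode; lra].
      unfold phase_at. rewrite <- Epsi by lra.
      apply is_derive_ext_loc with (hphase 2 d0); [|apply Hode; lra].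
      apply locally_interval with (x - z); [lra|]. intros t Ht. apply Epsi. lra.
    - unfold psi. rewrite Hz2, Rminus_diag. unfold Rdiv. rewrite Rmult_0_l, atan_0. lra. }
  set (R := z + 2 * d0 + 1).
  assert (HR : 2 * d0 < R ^ 2) by (unfold R, d0; simpl; nra).
  assert (HR0 : z < R /\ 0 < d0) by (unfold R, d0; lra).
  assert (C : critical 2 (hphase 2 d0) 2 R) by (apply hphase_critical; lra).
  (* Without a second sign change [th] would end in cell 2, either trapped or critical. Being above
     a critical phase it cannot be below the trap curve, and uniqueness excludes a second critical
     phase. *)
  apply H. apply NNPP. intros Hnr.
  assert (Hr1 : reaches n false 1 2) by (apply reaches_1; lra).
  destruct (phase_final n false 2 2 ltac:(lra)) as [j Hj].
  assert (HRc : 1 <= rcut n 2) by (apply (rcut_sqr n 2); lra).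
  destruct Hj as [[r1 [Hr11 T]]|C'].
  - assert (Ej : j = 2%nat).
    { apply (exact_cell n false 1 2 j r1); [lra| |exact Hr1|exact Hnr].
      apply (trapped_lt 2); [lra|lra|exact T]. }
    subst j. pose proof (Rmax_l r1 R). pose proof (Rmax_r r1 R).
    destruct (T (Rmax r1 R)) as [_ T2]; [lra|]. destruct (C (Rmax r1 R)) as [C2 _]; [lra|].
    specialize (B (Rmax r1 R) ltac:(lra)). unfold th in B. lra.
  - assert (Ej : j = 2%nat).
    { apply (exact_cell n false 1 2 j (rcut n 2)); [lra| |exact Hr1|exact Hnr].
      apply (critical_lt 2); [lra|lra|exact C']. }
    subst j.
    apply (critical_unique n 2 2 (hphase 2 d0) th 2 R R (rcut n 2)); try assumption; try lra.
    + intros r Hr. apply Hode; lra.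
    + intros r Hr. apply phase_ode; lra.
    + intros r Hr. left. apply B; lra.
    + right. intros r Hr. apply B; lra.
Qed.

(** * Sign changes and decay *)

Lemma cos_cell j t : lev j <= t <= lev (S j) -> exists c, 0 <= c /\ cos t = par j * c.
Proof.
  intros Ht. unfold lev in Ht. rewrite S_INR in Ht.
  exists (cos (t - INR j * PI)). split; [apply cos_ge_0; lra|].
  rewrite <- (proj1 (cos_sin_cell j _)). f_equal. ring.
Qed.

Lemma cos_in_cell j t : in_cell j t -> exists c, 0 < c /\ cos t = par j * c.
Proof.
  intros Ht. apply in_cell_shift in Ht.
  exists (cos (t - INR j * PI)). split; [apply cos_gt_0; lra|].
  rewrite <- (proj1 (cos_sin_cell j _)). f_equal. ring.
Qed.

Lemma Rabs_par j : Rabs (par j) = 1.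
Proof.
  unfold par. destruct (Nat.even j); [apply Rabs_R1|]. rewrite Rabs_left; lra.
Qed.

(** Shared by g and by f = e^E g, which differ by a positive factor; sign changes are counted from
    this alone. *)
Definition polar (n : nat) (al : R) (s : bool) (f : R -> R) : Prop :=
  forall r, 0 <= r -> exists X, 0 < X /\ f r = X * cos (phase n al s r).

(** Values of opposite sign cannot come from one closed cell, so each sign change costs a level.
    Conversely, alternating values are found where the phase takes values inside the successive
    cells. *)
Lemma changes_sign_reaches n al s f k :
  polar n al s f -> changes_sign_at_least k f <-> reaches n s k al.
Proof.
  intros Hf. pose proof PI_RGT_0 as Hpi. split.
  - intros [p [Hp0 Hp]].
    assert (H : forall i, (i <= k)%nat -> 0 <= p i /\ lev (idx s + i) < phase n al s (p i)).
    { induction i as [|i IH]; intros Hi.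
      - split; [exact Hp0|]. rewrite Nat.add_0_r. apply phase_start, Hp0.
      - destruct (IH ltac:(lia)) as [Hpi0 Hl]. destruct (Hp i ltac:(lia)) as [Hlt Hs].
        split; [lra|]. apply Rnot_le_lt. intros Hn. rewrite Nat.add_succ_r in Hn.
        assert (H1 : lev (idx s + i) < phase n al s (p (S i)))
          by (apply phase_persist with (p i); [lra|exact Hl]).
        assert (H2 : phase n al s (p i) <= lev (S (idx s + i))).
        { apply Rnot_lt_le. intros H.
          pose proof (phase_persist n al s _ (p i) (p (S i)) ltac:(lra) H). lra. }
        destruct (cos_cell (idx s + i) (phase n al s (p i))) as [c1 [Hc1 E1]]; [lra|].
        destruct (cos_cell (idx s + i) (phase n al s (p (S i)))) as [c2 [Hc2 E2]]; [lra|].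
        destruct (Hf (p i)) as [X1 [HX1 F1]]; [lra|].
        destruct (Hf (p (S i))) as [X2 [HX2 F2]]; [lra|].
        rewrite F1, F2, E1, E2 in Hs.
        replace (X1 * (par (idx s + i) * c1) * (X2 * (par (idx s + i) * c2)))
          with ((par (idx s + i) * par (idx s + i)) * ((X1 * c1) * (X2 * c2))) in Hs by ring.
        rewrite par_sqr in Hs.
        assert (0 <= (X1 * c1) * (X2 * c2))
          by (apply Rmult_le_pos; apply Rmult_le_pos; lra). lra. }
    destruct (H k (le_n k)) as [H0 H1]. exists (p k). split; assumption.
  - intros [r [Hr Hl]]. destruct k as [|k].
    + exists (fun _ => 0). split; [lra|]. intros i Hi. lia.
    (* The centres of the successive cells; the minimum matters only in the last cell, whose centre
       the phase may not have reached at r. *)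
    + set (v := fun i => Rmin (phase n al s r) (INR (idx s + i) * PI)).
      assert (Hr0 : INR (idx s) * PI <= phase n al s r).
      { pose proof (lev_le (idx s + 1) (idx s + S k) ltac:(lia)).
        rewrite Nat.add_1_r, lev_S in H. unfold lev at 1 in H. lra. }
      assert (Hv : forall i, Rmin (phase n al s 0) (phase n al s r) <= v i <=
                             Rmax (phase n al s 0) (phase n al s r)).
      { intros i. rewrite phase_0, th0_idx, Rmin_left; [|exact Hr0].
        rewrite Rmax_right; [|exact Hr0]. split; [|apply Rmin_l].
        apply Rmin_glb; [exact Hr0|]. apply Rmult_le_compat_r; [lra|]. apply le_INR. lia. }
      set (p := fun i => proj1_sig (IVT_gen (phase n al s) 0 r (v i) (phase_continuous n al s) (Hv i))).
      assert (Hp : forall i, 0 <= p i /\ phase n al s (p i) = v i).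
      { intros i. unfold p. destruct (IVT_gen _ _ _ _ _ _) as [x [Hx E]]. simpl.
        rewrite Rmin_left in Hx; [|exact Hr]. split; [lra|exact E]. }
      assert (Hcell : forall i, (i <= S k)%nat -> in_cell (idx s + i) (v i)).
      { intros i Hi. split.
        - apply Rmin_glb_lt; [|unfold lev; lra].
          pose proof (lev_le (idx s + i) (idx s + S k) ltac:(lia)). lra.
        - eapply Rle_lt_trans; [apply Rmin_r|]. rewrite lev_S. unfold lev. lra. }
      exists p. split; [apply Hp|]. intros i Hi.
      destruct (Hcell i ltac:(lia)) as [_ Hu]. destruct (Hcell (S i) ltac:(lia)) as [Hlo _].
      destruct (Hp i) as [Hpi0 Ei]. destruct (Hp (S i)) as [HpS ES].
      rewrite Nat.add_succ_r in Hlo. split.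
      * apply Rnot_le_lt. intros Hle. rewrite <- ES in Hlo.
        pose proof (phase_persist n al s _ (p (S i)) (p i) ltac:(lra) Hlo). lra.
      * destruct (Hf (p i) Hpi0) as [X1 [HX1 F1]]. destruct (Hf (p (S i)) HpS) as [X2 [HX2 F2]].
        destruct (cos_in_cell (idx s + i) (v i)) as [c1 [Hc1 E1]]; [apply Hcell; lia|].
        destruct (cos_in_cell (idx s + S i) (v (S i))) as [c2 [Hc2 E2]]; [apply Hcell; lia|].
        rewrite F1, F2, Ei, ES, E1, E2, Nat.add_succ_r, par_S.
        replace (X1 * (par (idx s + i) * c1) * (X2 * (- par (idx s + i) * c2)))
          with (- ((par (idx s + i) * par (idx s + i)) * ((X1 * c1) * (X2 * c2)))) by ring.
        rewrite par_sqr.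
        assert (0 < (X1 * c1) * (X2 * c2))
          by (apply Rmult_lt_0_compat; apply Rmult_lt_0_compat; lra). lra.
Qed.

Lemma changes_sign_exactly_reaches n al s f k :
  polar n al s f ->
  changes_sign_exactly k f <-> (reaches n s k al /\ ~ reaches n s (S k) al).
Proof.
  intros Hf. unfold changes_sign_exactly.
  rewrite (changes_sign_reaches n al s f k Hf), (changes_sign_reaches n al s f (S k) Hf).
  reflexivity.
Qed.

Lemma prof_polar n al s : polar n al s (prof n al (sgn_val s)).
Proof. intros r Hr. apply prof_sign, Hr. Qed.

Lemma asol_polar n al s : polar n al s (asol n al (sgn_val s)).
Proof.
  intros r Hr. destruct (prof_sign n al s r Hr) as [X [HX E]].
  exists (X * exp (expo n al (sgn_val s) r)). split.
  - apply Rmult_lt_0_compat; [exact HX|apply exp_pos].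
  - unfold asol. rewrite E. ring.
Qed.

(* [g e^(c r^2 / 2)], up to sign: proportional to the alpha-solution in the last cell. *)
Definition amp (n : nat) (al : R) (s : bool) (j : nat) (r : R) : R :=
  par j * prof n al (sgn_val s) r * exp (ccell j * r ^ 2 / 2).

Lemma prof_cell n al s j r :
  0 <= r -> in_cell j (phase n al s r) -> 0 < par j * prof n al (sgn_val s) r.
Proof.
  intros Hr Hc. destruct (prof_sign n al s r Hr) as [X [HX E]].
  destruct (cos_in_cell j _ Hc) as [c [Hc0 Ec]]. rewrite E, Ec.
  replace (par j * (X * (par j * c))) with ((par j * par j) * (X * c)) by ring.
  rewrite par_sqr. assert (0 < X * c) by (apply Rmult_lt_0_compat; assumption). lra.
Qed.

Lemma amp_derive n al s j r :
  0 < r -> in_cell j (phase n al s r) ->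
  0 < amp n al s j r /\
  is_derive (amp n al s j) r (amp n al s j r * (mom (phase n al s) j r / r)).
Proof.
  intros Hr Hc. split.
  { apply Rmult_lt_0_compat; [apply prof_cell; [lra|exact Hc]|apply exp_pos]. }
  destruct (phase_polar n al s r ltac:(lra)) as [X [HX [Eg Ew]]].
  assert (Hexp : is_derive (fun z => exp (ccell j * z ^ 2 / 2)) r
    (ccell j * r * exp (ccell j * r ^ 2 / 2))).
  { apply (is_derive_exp_comp (fun z => ccell j * z ^ 2 / 2)).
    auto_derive; [exact I|]. simpl. field. }
  pose proof (prof_derive n al (sgn_val s) r Hr) as Hg.
  pose proof (is_derive_mult_R _ _ _ _ _ (is_derive_scal _ r (par j) _ Hg) Hexp) as H.
  eapply is_derive_eq; [exact H|].
  apply in_cell_shift in Hc. set (u := phase n al s r - INR j * PI) in *.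
  assert (Hcu : 0 < cos u) by (apply cos_gt_0; lra).
  assert (Et : phase n al s r = INR j * PI + u) by (unfold u; ring).
  rewrite Et in Eg, Ew. destruct (cos_sin_cell j u) as [E1 E2]. rewrite E1 in Eg. rewrite E2 in Ew.
  change (par j * dprof n al (sgn_val s) r * exp (ccell j * r ^ 2 / 2) +
    par j * prof n al (sgn_val s) r * (ccell j * r * exp (ccell j * r ^ 2 / 2)) =
    amp n al s j r * (mom (phase n al s) j r / r)).
  unfold amp, mom. fold u. unfold dprof. rewrite Eg, Ew.
  replace (bpl (X * (par j * cos u))) with (2 * ccell j * (par j * (X * cos u))).
  - unfold tan. field. lra.
  - replace (X * (par j * cos u)) with (par j * (X * cos u)) by ring.
    symmetry. apply bpl_par. apply Rmult_le_pos; lra.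
Qed.

Lemma in_cell_unique i j t : in_cell i t -> in_cell j t -> i = j.
Proof.
  intros [H1 H2] [H3 H4].
  assert (i < S j)%nat by (apply lev_lt_inv; lra).
  assert (j < S i)%nat by (apply lev_lt_inv; lra). lia.
Qed.

(** The boundedness in the definition of alpha_k and the decay in part (i) are both read off from
    [amp], so each becomes equivalent to the phase being critical. The alternatives are exclusive:
    in a common cell, critical and trapped phases lie on opposite sides of the trap curve. *)
Lemma growth_dichotomy n s al :
  0 < al -> exists j R, 0 < R /\
    (forall r, R <= r -> in_cell j (phase n al s r)) /\
    ((critical al (phase n al s) j R /\
      exists M, forall r, R <= r -> Rpower r (- al) * amp n al s j r <= M) \/
     ((forall i R', 0 < R' -> ~ critical al (phase n al s) i R') /\
      forall M S0, exists r, S0 <= r /\ M < Rpower r (- al) * amp n al s j r)).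
Proof.
  intros Hal. assert (Hcut : 1 <= rcut n al) by (apply (rcut_sqr n al); lra).
  destruct (phase_final n s al al ltac:(lra)) as [j [[r1 [Hr1 T]]|C]].
  - pose proof (trapped_lt al _ j r1 Hal ltac:(lra) T) as Hc.
    exists j, r1. split; [lra|]. split; [exact Hc|]. right. split.
    + intros i R' HR' C.
      pose proof (Rmax_l r1 R') as M1. pose proof (Rmax_r r1 R') as M2.
      assert (Ei : i = j).
      { apply (in_cell_unique i j (phase n al s (Rmax r1 R'))); [|apply Hc, M1].
        apply (critical_lt al _ i R' Hal HR' C _ M2). }
      subst i. destruct (T _ M1) as [_ H1]. destruct (C _ M2) as [H2 _]. lra.
    + apply (trapped_growth al (phase n al s) j r1 (amp n al s j) Hal ltac:(lra) T).
      intros r Hr. apply amp_derive; [lra|apply Hc, Hr].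
  - pose proof (critical_lt al _ j (rcut n al) Hal ltac:(lra) C) as Hc.
    exists j, (rcut n al). split; [lra|]. split; [exact Hc|]. left. split; [exact C|].
    apply (critical_growth n al (phase n al s) j _ (amp n al s j) Hal Hcut).
    + intros r Hr. apply phase_ode. lra.
    + exact C.
    + intros r Hr. apply amp_derive; [lra|apply Hc, Hr].
Qed.

(** In the last cell c(g) is constant, so [expo] differs from c r^2 / 2 by a constant. *)
Lemma asol_amp n al s j R :
  0 < R -> (forall r, R <= r -> in_cell j (phase n al s r)) ->
  exists K, 0 < K /\ forall r, R <= r -> Rabs (asol n al (sgn_val s) r) = K * amp n al s j r.
Proof.
  intros HR Hc. set (g := prof n al (sgn_val s)).
  assert (Hg : forall r, R <= r -> 0 < par j * g r).
  { intros r Hr. apply prof_cell; [lra|apply Hc, Hr]. }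
  assert (Hcof : forall r, R <= r -> cof (g r) = ccell j).
  { intros r Hr. unfold ccell. symmetry. apply cof_same_sign, Hg, Hr. }
  exists (exp (expo n al (sgn_val s) R - ccell j * R ^ 2 / 2)). split; [apply exp_pos|].
  intros r Hr. unfold asol, amp. fold g.
  assert (Habs : Rabs (g r) = par j * g r).
  { specialize (Hg r Hr). rewrite <- (Rabs_right (par j * g r)); [|lra].
    rewrite Rabs_mult, Rabs_par. ring. }
  rewrite Rabs_mult, Habs, (Rabs_right (exp _)); [|left; apply exp_pos].
  rewrite (expo_cell n al (sgn_val s) (sgn_val_neq_0 s) R r).
  - fold g. rewrite (Hcof r Hr).
    replace (exp (expo n al (sgn_val s) R - ccell j * R ^ 2 / 2) *
      (par j * g r * exp (ccell j * r ^ 2 / 2))) with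
      (par j * g r * (exp (expo n al (sgn_val s) R - ccell j * R ^ 2 / 2) *
        exp (ccell j * r ^ 2 / 2))) by ring.
    rewrite <- exp_plus. f_equal. f_equal. field.
  - lra.
  - intros z Hz. fold g. rewrite (Hcof z), ?(Hcof r); lra.
Qed.

(** * The numbers alpha_k and the theorem *)

Lemma ode_at_eq f df p q p' q' r : ode_at f df p q r -> p = p' -> q = q' -> ode_at f df p' q' r.
Proof. intros H <- <-. exact H. Qed.

Lemma cof_neg y : y < 0 -> cof y = 1.
Proof. intros H. unfold cof. destruct (Rlt_dec y 0); lra. Qed.

Lemma cof_pos y : 0 < y -> cof y = / 2.
Proof. intros H. unfold cof. destruct (Rlt_dec y 0); lra. Qed.

Ltac same_ode H cof_eq :=
  eapply ode_at_eq; [apply H; lra| |]; rewrite ?S_INR, ?cof_eq by lra; field; lra.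

Ltac split_by_sign :=
  let HC := fresh in let H0 := fresh in let Hd := fresh in
  let Hneg := fresh in let Hpos := fresh in let H := fresh in
  split;
  [ intros [dy [HC [H0 [Hd [Hneg Hpos]]]]]; exists dy; repeat (split; [assumption|]);
    intros r Hr Hn; destruct (Rdichotomy _ _ Hn) as [H|H];
    [same_ode Hneg cof_neg|same_ode Hpos cof_pos]
  | intros [dy [HC [H0 [Hd Hneg]]]]; exists dy; repeat (split; [assumption|]);
    split; intros r Hr H; [same_ode Hneg cof_neg|same_ode Hneg cof_pos] ].

Lemma profile_sol_def n b g :
  profile (S n) b g <-> exists dg, sol_def n (-1) (- b) g dg.
Proof. split_by_sign. Qed.

Lemma alpha_solution_sol_def n a f :
  alpha_solution (S n) a f <-> exists df, sol_def n 1 (- a) f df.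
Proof. split_by_sign. Qed.

(** By uniqueness every admissible f coincides with [asol]; its sign changes are then read off from
    the phase, and boundedness of r^(-a) f excludes the trapped case. *)
Lemma is_alpha_threshold n s k a : is_alpha (S n) s (S k) a <-> threshold n s (S k) a.
Proof.
  split.
  - intros [Ha [f [Hf [Hf0 [Hk [M [S0 [HS0 HM]]]]]]]].
    apply alpha_solution_sol_def in Hf. destruct Hf as [df Hf].
    assert (Ef : forall r, 0 <= r -> f r = asol n a (sgn_val s) r).
    { apply (sol_def_unique n 1 (- a) f df _ (dasol n a (sgn_val s))); [ring|exact Hf| |].
      - apply asol_sol_def, sgn_val_neq_0.
      - rewrite asol_0. exact Hf0. }
    assert (Hpol : polar n a s f).
    { intros r Hr. rewrite (Ef r Hr). apply asol_polar, Hr. }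
    apply (changes_sign_exactly_reaches n a s f (S k) Hpol) in Hk. destruct Hk as [Hr Hn].
    destruct (growth_dichotomy n s a Ha) as [j [R [HR [Hc [[C _]|[_ Hun]]]]]].
    + apply (critical_threshold n s k a j R); assumption.
    + exfalso. destruct (asol_amp n a s j R HR Hc) as [K [HK HKe]].
      destruct (Hun (M / K) (Rmax R S0)) as [r [Hrr Hlt]].
      pose proof (Rmax_l R S0). pose proof (Rmax_r R S0).
      specialize (HM r ltac:(lra)). rewrite Rabs_mult, Ef in HM; [|lra].
      rewrite HKe in HM; [|lra]. rewrite Rabs_right in HM; [|left; apply Rpower_pos].
      apply (Rmult_lt_compat_l K) in Hlt; [|exact HK].
      replace (K * (M / K)) with M in Hlt by (field; lra). lra.
  - intros Ht. destruct (threshold_reaches n s k a Ht) as [Ha [Hr Hn]].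
    split; [exact Ha|]. exists (asol n a (sgn_val s)). split; [|split; [|split]].
    + apply alpha_solution_sol_def. exists (dasol n a (sgn_val s)).
      apply asol_sol_def, sgn_val_neq_0.
    + apply asol_0.
    + apply (changes_sign_exactly_reaches n a s _ (S k) (asol_polar n a s)). split; assumption.
    + destruct (growth_dichotomy n s a Ha) as [j [R [HR [Hc [[_ [M HM]]|[Hnc _]]]]]].
      * destruct (asol_amp n a s j R HR Hc) as [K [HK HKe]].
        exists (K * M), R. split; [exact HR|]. intros r Hrr.
        rewrite Rabs_mult, HKe; [|exact Hrr]. rewrite Rabs_right; [|left; apply Rpower_pos].
        specialize (HM r Hrr). apply (Rmult_le_compat_l K) in HM; lra.
      * exfalso. destruct (threshold_critical n s k a Ht) as [R' [HR' C]].
        exact (Hnc _ R' HR' C).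
Qed.

Lemma alpha_threshold n s k : threshold n s (S k) (alpha (S n) s (S k)).
Proof.
  destruct (threshold_exists n s (S k)) as [a Ha].
  replace (alpha (S n) s (S k)) with a; [exact Ha|]. symmetry.
  apply (iota_unique (V := R_CompleteNormedModule)).
  - intros y Hy. apply is_alpha_threshold in Hy. exact (threshold_unique n s (S k) y a Hy Ha).
  - apply is_alpha_threshold, Ha.
Qed.

Lemma enorm_origin n : enorm n (origin n) = 0.
Proof.
  unfold enorm, origin.
  replace (\big[Rplus/0]_(i < n) 0 ^ 2) with 0; [apply sqrt_0|symmetry].
  apply (big_ind (fun x => x = 0)).
  - reflexivity.
  - intros x y -> ->. ring.
  - intros i _. ring.
Qed.

Lemma enorm_surjective n r : 0 <= r -> exists x, enorm (S n) x = r.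
Proof.
  intros Hr. exists (fun i => if Nat.eqb (nat_of_ord i) 0 then r else 0).
  unfold enorm. rewrite big_ord_recl.
  match goal with |- sqrt (_ + ?X) = _ => assert (E : X = 0) end.
  { apply (big_ind (fun x => x = 0)); [reflexivity|intros x y -> ->; ring|].
    intros i _. simpl. ring. }
  rewrite E, Rplus_0_r. apply sqrt_pow2, Hr.
Qed.

Definition self_similar (n : nat) (b : R) (s : bool) (x : 'I_(S n) -> R) (t : R) : R :=
  Rpower t (b / 2) * prof n (- INR (S n) - b) (sgn_val s) (enorm (S n) x / sqrt t).

Lemma self_similar_unique n b s :
  unique_homogeneous_solution (S n) b (sgn_val s) (self_similar n b s)
    (prof n (- INR (S n) - b) (sgn_val s)).
Proof.
  assert (Hsol : sol_def n (-1) (- b) (prof n (- INR (S n) - b) (sgn_val s))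
                   (dprof n (- INR (S n) - b) (sgn_val s))).
  { replace (- b) with (INR n + 1 + (- INR (S n) - b)) at 1 by (rewrite S_INR; ring).
    apply prof_sol_def, sgn_val_neq_0. }
  assert (H1 : forall p, Rpower 1 p = 1).
  { intros p. unfold Rpower. rewrite ln_1, Rmult_0_r. apply exp_0. }
  assert (H0 : enorm (S n) (origin (S n)) / sqrt 1 = 0).
  { rewrite enorm_origin. unfold Rdiv. ring. }
  split; [split|split].
  - apply profile_sol_def. exists (dprof n (- INR (S n) - b) (sgn_val s)). exact Hsol.
  - intros x t Ht. reflexivity.
  - unfold self_similar. rewrite H0, H1, prof_0. ring.
  - intros v' g' [Hprof Hv'] H x t Ht. rewrite (Hv' x t Ht). unfold self_similar. f_equal.
    apply profile_sol_def in Hprof. destruct Hprof as [dg' Hg'].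
    apply (sol_def_unique n (-1) (- b) g' dg' _ (dprof n (- INR (S n) - b) (sgn_val s)));
      [ring|exact Hg'|exact Hsol| |].
    + rewrite prof_0. rewrite <- H, (Hv' _ 1 Rlt_0_1), H0, H1. ring.
    + apply Rdiv_le_0_compat; [apply sqrt_pos|apply sqrt_lt_R0, Ht].
Qed.

(** The powers of t cancel because N + al + b = 0, which leaves a function of r = |x| / sqrt t. With
    ell / 2 equal to c in the last cell, the second factor is [amp] up to sign. *)
Lemma decay_expression n b s x t :
  0 < t -> 0 < enorm (S n) x / sqrt t ->
  forall ell, let r := enorm (S n) x / sqrt t in let al := - INR (S n) - b in
  Rpower (enorm (S n) x) (INR (S n) + al) *
    Rpower (enorm (S n) x / sqrt t) (- (INR (S n) + 2 * al)) *
    exp (ell * enorm (S n) x ^ 2 / (4 * t)) * self_similar n b s x t =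
  Rpower r (- al) * (prof n al (sgn_val s) r * exp (ell / 2 * r ^ 2 / 2)).
Proof.
  intros Ht Hr ell r al.
  assert (Hst : 0 < sqrt t) by (apply sqrt_lt_R0, Ht).
  assert (Ee : enorm (S n) x = r * sqrt t) by (unfold r; field; lra).
  unfold self_similar. fold r. fold al.
  assert (Hexp : ell * enorm (S n) x ^ 2 / (4 * t) = ell / 2 * r ^ 2 / 2).
  { rewrite Ee. replace ((r * sqrt t) ^ 2) with (r ^ 2 * (sqrt t * sqrt t)) by ring.
    rewrite sqrt_sqrt; [|lra]. field. lra. }
  rewrite Hexp, Ee, <- Rpower_mult_distr; [|exact Hr|exact Hst].
  rewrite <- (Rpower_sqrt t Ht) at 1. rewrite Rpower_mult.
  set (g := prof n al (sgn_val s) r). set (e := exp _).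
  transitivity ((Rpower r (INR (S n) + al) * Rpower r (- (INR (S n) + 2 * al))) *
    (Rpower t (/ 2 * (INR (S n) + al)) * Rpower t (b / 2)) * (g * e)); [ring|].
  rewrite <- !Rpower_plus.
  replace (/ 2 * (INR (S n) + al) + b / 2) with 0 by (unfold al; field).
  rewrite Rpower_O; [|exact Ht].
  replace (INR (S n) + al + - (INR (S n) + 2 * al)) with (- al) by ring. ring.
Qed.

Lemma lambda_par j y : 0 < par j * y -> lambda y = 2 * ccell j.
Proof.
  intros H. unfold lambda. unfold par in H.
  destruct (Nat.even j) eqn:E.
  - rewrite (ccell_even j E), sign_eq_1; [field|lra].
  - rewrite (ccell_odd j E), sign_eq_m1; [field|lra].
Qed.

Lemma decay_threshold n b s :
  b < - INR (S n) ->
  exists ell : R,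
    is_lim (fun r => lambda (prof n (- INR (S n) - b) (sgn_val s) r)) p_infty ell /\
    (decay_bounded (S n) (- INR (S n) - b) ell (self_similar n b s) <->
     exists k, threshold n s (S k) (- INR (S n) - b)).
Proof.
  intros Hb. set (al := - INR (S n) - b). assert (Hal : 0 < al) by (unfold al; lra).
  destruct (growth_dichotomy n s al Hal) as [j [R [HR [Hc Hdich]]]].
  assert (Hg : forall r, R <= r -> 0 < par j * prof n al (sgn_val s) r).
  { intros r Hr. apply prof_cell; [lra|apply Hc, Hr]. }
  exists (2 * ccell j). split.
  { apply (is_lim_ext_loc (fun _ => 2 * ccell j)).
    - exists R. intros r Hr. symmetry. apply lambda_par, Hg. lra.
    - apply is_lim_const. }
  assert (Habs : forall x t, 0 < t -> R <= enorm (S n) x / sqrt t ->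
    Rabs (Rpower (enorm (S n) x) (INR (S n) + al) *
      Rpower (enorm (S n) x / sqrt t) (- (INR (S n) + 2 * al)) *
      exp (2 * ccell j * enorm (S n) x ^ 2 / (4 * t)) * self_similar n b s x t) =
    Rpower (enorm (S n) x / sqrt t) (- al) * amp n al s j (enorm (S n) x / sqrt t)).
  { intros x t Ht Hr.
    pose proof (decay_expression n b s x t Ht ltac:(lra) (2 * ccell j)) as E. cbv zeta in E.
    fold al in E. rewrite E. set (r := enorm (S n) x / sqrt t) in *.
    rewrite Rabs_mult, (Rabs_right (Rpower _ _)); [|left; apply Rpower_pos]. f_equal.
    rewrite Rabs_mult, (Rabs_right (exp _)); [|left; apply exp_pos]. unfold amp.
    replace (2 * ccell j / 2) with (ccell j) by field. f_equal.
    specialize (Hg r Hr). rewrite <- (Rabs_right (par j * _)); [|lra]. rewrite Rabs_mult, Rabs_par. ring. }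
  split.
  - intros [M [R0 [HR0 HM]]].
    destruct Hdich as [[C _]|[_ Hun]].
    + assert (Hex : exists k, reaches n s (S k) al /\ ~ reaches n s (S (S k)) al).
      { destruct (reaches_finite n s al) as [m Hm].
        induction m as [|m IH]; [exfalso; apply Hm, reaches_1, Hal|].
        destruct (classic (reaches n s (S m) al)) as [H|H]; [exists m; split; assumption|].
        apply IH, H. }
      destruct Hex as [k [H1 H2]]. exists k. apply (critical_threshold n s k al j R); assumption.
    + exfalso. destruct (Hun M (Rmax R R0)) as [r [Hr Hlt]].
      pose proof (Rmax_l R R0). pose proof (Rmax_r R R0).
      destruct (enorm_surjective n r) as [x Hx]; [lra|].
      assert (Er : enorm (S n) x / sqrt 1 = r) by (rewrite Hx, sqrt_1; field).
      specialize (HM x 1 Rlt_0_1). specialize (Habs x 1 Rlt_0_1).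
      rewrite Er in HM, Habs. specialize (HM ltac:(lra)). rewrite Habs in HM; lra.
  - intros [k Hk]. destruct Hdich as [[_ [M HM]]|[Hnc _]].
    + exists M, R. split; [exact HR|]. intros x t Ht Hr. rewrite (Habs x t Ht Hr).
      apply HM, Hr.
    + exfalso. destruct (threshold_critical n s k al Hk) as [R' [HR' C]].
      exact (Hnc _ R' HR' C).
Qed.

Lemma reaches_alpha n s k al : reaches n s (S (S k)) al <-> alpha (S n) s (S k) < al.
Proof. apply alpha_threshold. Qed.

Theorem theorem4p1 (N : nat) (hN : (1 <= N)%nat) :
  (* (i) *)
  (forall (s : bool) (b : R), b < - INR N ->
     exists v g, unique_homogeneous_solution N b (sgn_val s) v g /\
       exists ell : R,
         is_lim (fun r => lambda (g r)) p_infty ell /\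
         (decay_bounded N (- INR N - b) ell v <->
          exists k : nat, (1 <= k)%nat /\ b = beta N s k)) /\
  (* (ii) *)
  (forall (s : bool) (b : R), b < 0 ->
     exists v g, unique_homogeneous_solution N b (sgn_val s) v g /\
       (changes_sign_exactly 0 g <-> - INR N <= b < 0) /\
       (changes_sign_exactly 1 g <-> beta N s 1 <= b < - INR N) /\
       (forall k : nat, (2 <= k)%nat ->
          (changes_sign_exactly k g <-> beta N s k <= b < beta N s (k - 1)))) /\
  (* (iii) *)
  (forall s : bool,
     (forall k : nat, (1 <= k)%nat -> beta N s (k + 1) < beta N s k) /\
     (forall M : R, exists k : nat, (1 <= k)%nat /\ M < Rabs (beta N s k))) /\
  (* (iv) *)
  (beta N true 1 < - INR N - 2 /\ - INR N - 2 < beta N false 1 /\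
   beta N false 1 < - INR N) /\
  (* (v) *)
  (forall k : nat, (1 <= k)%nat ->
     beta N false (k + 2) < beta N true (k + 1) /\
     beta N true (k + 1) < beta N false k).
Proof.
  destruct N as [|n]; [lia|]. unfold beta.
  split; [|split; [|split; [|split]]].
  - intros s b Hb.
    exists (self_similar n b s), (prof n (- INR (S n) - b) (sgn_val s)).
    split; [apply self_similar_unique|].
    destruct (decay_threshold n b s Hb) as [ell [Hl Hiff]].
    exists ell. split; [exact Hl|]. rewrite Hiff. split.
    + intros [k Hk]. exists (S k). split; [lia|].
      rewrite (threshold_unique _ _ _ _ _ (alpha_threshold n s k) Hk). ring.
    + intros [[|k] [Hk Eb]]; [lia|]. exists k.
      replace (- INR (S n) - b) with (alpha (S n) s (S k)); [apply alpha_threshold|]. lra.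
  - intros s b Hb.
    exists (self_similar n b s), (prof n (- INR (S n) - b) (sgn_val s)).
    split; [apply self_similar_unique|].
    set (al := - INR (S n) - b).
    assert (Hex : forall k, changes_sign_exactly k (prof n al (sgn_val s)) <->
      (reaches n s k al /\ ~ reaches n s (S k) al)).
    { intros k. apply changes_sign_exactly_reaches, prof_polar. }
    split; [|split].
    + rewrite Hex, reaches_1. split.
      * intros [_ H]. unfold al in H. lra.
      * intros H. split; [|unfold al; lra].
        exists 0. split; [lra|]. rewrite Nat.add_0_r. apply phase_start. lra.
    + rewrite Hex, reaches_1, reaches_alpha. unfold al. split; intros; lra.
    + intros k Hk. destruct k as [|[|k]]; [lia|lia|].
      replace (S (S k) - 1)%nat with (S k) by lia.
      rewrite Hex, !reaches_alpha. unfold al. split; intros; lra.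
  - intros s. split.
    + intros k Hk. destruct k as [|k]; [lia|]. rewrite Nat.add_1_r.
      pose proof (threshold_lt n s (S k) _ _ (alpha_threshold n s k) (alpha_threshold n s (S k))).
      lra.
    + intros M. set (al := Rabs M + 1).
      assert (Hal : 0 < al) by (unfold al; pose proof (Rabs_pos M); lra).
      (* Only finitely many sign changes occur for this alpha, so some threshold is at least |M| +
         1. *)
      destruct (reaches_finite n s al) as [k Hk].
      destruct k as [|k]; [exfalso; apply Hk, reaches_1, Hal|].
      exists (S k). split; [lia|]. rewrite reaches_alpha in Hk.
      pose proof (pos_INR (S n)). rewrite Rabs_left; [|lra].
      pose proof (Rle_abs M). unfold al in Hk. lra.
  - pose proof (threshold_true_1 n _ (alpha_threshold n true 0)).
    pose proof (threshold_false_1 n _ (alpha_threshold n false 0)).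
    pose proof (threshold_reaches n false 0 _ (alpha_threshold n false 0)) as [H1 _]. lra.
  - intros k Hk. destruct k as [|k]; [lia|].
    replace (S k + 2)%nat with (S (S (S k))) by lia. replace (S k + 1)%nat with (S (S k)) by lia.
    pose proof (interlacing n true (S k) _ _ (alpha_threshold n true (S k))
      (alpha_threshold n false (S (S k)))).
    pose proof (interlacing n false k _ _ (alpha_threshold n false k)
      (alpha_threshold n true (S k))). lra.
Qed.
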